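(* Consider elements of $(U/J,\Diamond)$ of the form $$C^{(2)}=f_2(H)\,\bar x_{-2\alpha}\Diamond\bar x_{2\alpha}+f_1(H)\,\bar x_{-\alpha}\Diamond\bar x_\alpha+f_0(H)\,\hat h\Diamond\hat h+g(H),\qquad f_0,f_1,f_2,g\in D^{-1}U(\mathfrak h).$$ The unique (up to complex scalar multiple) anti-central element of this form is $$16\bar{\mathcal L}=4\frac{H-2}{H-1}\,\bar x_{-2\alpha}\Diamond\bar x_{2\alpha}-\Big(2(H-2)+\frac{1}{H-1}\Big)\bar x_{-\alpha}\Diamond\bar x_\alpha-\frac{1}{(H-1)^2}\,\hat h\Diamond\hat h+(H-1)^2,$$ where $\bar{\mathcal L}=L\otimes L+J$ with $L=x_{-\alpha}x_\alpha-\frac12h+\frac14\in U(\mathfrak{osp}(1|2))$.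
   Context: Everything is over $\mathbb{C}$; $[\cdot,\cdot]$ is the supercommutator. The Lie superalgebra $\mathfrak{osp}(1|2)$ has even basis elements $x_{-2\alpha},h,x_{2\alpha}$ and odd basis elements $x_{-\alpha},x_\alpha$, with $[h,x_{k\alpha}]=-k\,x_{k\alpha}$ for $k\in\{\pm1,\pm2\}$, $[x_\alpha,x_\alpha]=-2x_{2\alpha}$, $[x_{-\alpha},x_{-\alpha}]=2x_{-2\alpha}$, $[x_\alpha,x_{-2\alpha}]=x_{-\alpha}$, $[x_{-\alpha},x_{2\alpha}]=x_\alpha$, $[x_\alpha,x_{-\alpha}]=h$, $[x_{-2\alpha},x_{2\alpha}]=h$, $[x_\alpha,x_{2\alpha}]=0=[x_{-\alpha},x_{-2\alpha}]$. Let $\mathfrak{G}=\mathfrak{osp}(1|2)\times\mathfrak{osp}(1|2)$, so $U(\mathfrak G)\cong U(\mathfrak{osp}(1|2))\otimes U(\mathfrak{osp}(1|2))$ (super tensor product). Put $X_{k\alpha}=(x_{k\alpha},x_{k\alpha})$, $H=(h,h)$, $\tilde x_{k\alpha}=(x_{k\alpha},-x_{k\alpha})$, $\tilde h=(h,-h)$. Let $\mathfrak h=\mathbb{C}H$, $\mathfrak g_\pm=\mathbb{C}X_{\pm\alpha}\oplus\mathbb{C}X_{\pm2\alpha}$. Let $D\subset U(\mathfrak h)=\mathbb{C}[H]$ be the multiplicative set generated by $\{H-n\mid n\in\mathbb{Z}\}$, $U=D^{-1}U(\mathfrak G)$ the localization, and $J=\mathfrak g_-U+U\mathfrak g_+$.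 Define rational functions by $\varphi_0(H)=1$, $\varphi_{2n-1}(H)=\frac{-1}{H-n}\varphi_{2n-2}(H)$, $\varphi_{2n}(H)=\frac1n\varphi_{2n-1}(H)$ for $n\ge1$. For $u\in U$ write $\bar u=u+J\in U/J$. The diamond product on $U/J$ is $$\bar u\Diamond\bar v=\sum_{n\ge0}u\,\varphi_n(H)X_{-\alpha}^nX_\alpha^n\,v+J$$ (all but finitely many terms lie in $J$); it is well defined and makes $U/J$ an associative superalgebra. Put $\bar x_{k\alpha}=\tilde x_{k\alpha}+J$, $\bar h=\tilde h+J$, $\hat h=(H-1)\bar h$; elements $f(H)\in D^{-1}U(\mathfrak h)$ act on $U/J$ by $f(H)\bar u=f(H)u+J=f(H)\Diamond\bar u$. An even element of a superalgebra is called anti-central if it commutes with all even elements and anti-commutes with all odd elements.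
   Formalization: The coefficient of x̄_{-2α}◇x̄_{2α} in the displayed formula for 16L̄ is corrected from 4(H-2)/(H-1) to 4(H-1)/(H-2); with the printed coefficient the identity is false under the given conventions. *)

(* Defs.v *)
From HB Require Import structures.
From mathcomp Require Import all_boot all_order all_algebra.
From mathcomp Require Import generic_quotient ring_quotient ring.
From mathcomp Require Import boolp classical_sets fsbigop reals.
From mathcomp Require Import complex.

Set Implicit Arguments.
Unset Strict Implicit.
Unset Printing Implicit Defensive.
Import GRing.Theory.
Local Open Scope ring_scope.
Local Open Scope quotient_scope.

(* [shom b v] means that v lies in the component of parity b, false being the
   even parity; in particular 0 is homogeneous of both parities. *)
HB.mixin Record isLieSuperalgebra (K : fieldType) V of GRing.Lmodule K V := {
  shom : bool -> V -> Prop;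
  sbr : V -> V -> V;
  shom_linear : forall b k (x y : V), shom b x -> shom b y ->
    shom b (k *: x + y);
  shom_decomp : forall x : V, exists y z,
    [/\ shom false y, shom true z & x = y + z];
  shom_direct : forall x : V, shom false x -> shom true x -> x = 0;
  sbr_linearl : forall k (x y z : V),
    sbr (k *: x + y) z = k *: sbr x z + sbr y z;
  sbr_linearr : forall k (x y z : V),
    sbr z (k *: x + y) = k *: sbr z x + sbr z y;
  sbr_shom : forall a b (x y : V), shom a x -> shom b y ->
    shom (a (+) b) (sbr x y);
  sbr_skew : forall a b (x y : V), shom a x -> shom b y ->
    sbr x y = - ((-1) ^+ (a && b) *: sbr y x);
  sbr_jacobi : forall a b c (x y z : V), shom a x -> shom b y -> shom c z ->
    sbr x (sbr y z) = sbr (sbr x y) z + (-1) ^+ (a && b) *: sbr y (sbr x z)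
}.

#[short(type="lieSuperalgType")]
HB.structure Definition LieSuperalgebra (K : fieldType) :=
  {V of GRing.Lmodule K V & isLieSuperalgebra K V}.

Section ProductSuperalgebra.
Variables (K : fieldType) (g1 g2 : lieSuperalgType K).

Definition prod_shom b (x : (g1 * g2)%type) := shom b x.1 /\ shom b x.2.
Definition prod_sbr (x y : (g1 * g2)%type) : (g1 * g2)%type :=
  (sbr x.1 y.1, sbr x.2 y.2).

Fact prod_shom_linear b k x y : prod_shom b x -> prod_shom b y ->
  prod_shom b (k *: x + y).
Proof. by case=> ? ? [? ?]; split; apply: shom_linear. Qed.

Fact prod_shom_decomp x : exists y z,
  [/\ prod_shom false y, prod_shom true z & x = y + z].
Proof.
case: x => x1 x2.
have [y1 [z1 [hy1 hz1 ->]]] := shom_decomp x1.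
have [y2 [z2 [hy2 hz2 ->]]] := shom_decomp x2.
by exists (y1, y2), (z1, z2).
Qed.

Fact prod_shom_direct x : prod_shom false x -> prod_shom true x -> x = 0.
Proof.
by case: x => x1 x2 [/= h1 h2] [/= h3 h4]; congr pair; apply: shom_direct.
Qed.

Fact prod_sbr_linearl k x y z :
  prod_sbr (k *: x + y) z = k *: prod_sbr x z + prod_sbr y z.
Proof. by congr pair; apply: sbr_linearl. Qed.

Fact prod_sbr_linearr k x y z :
  prod_sbr z (k *: x + y) = k *: prod_sbr z x + prod_sbr z y.
Proof. by congr pair; apply: sbr_linearr. Qed.

Fact prod_sbr_shom a b x y : prod_shom a x -> prod_shom b y ->
  prod_shom (a (+) b) (prod_sbr x y).
Proof. by case=> ? ? [? ?]; split; apply: sbr_shom. Qed.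

Fact prod_sbr_skew a b x y : prod_shom a x -> prod_shom b y ->
  prod_sbr x y = - ((-1) ^+ (a && b) *: prod_sbr y x).
Proof. by case=> ? ? [? ?]; congr pair; apply: sbr_skew. Qed.

Fact prod_sbr_jacobi a b c x y z :
  prod_shom a x -> prod_shom b y -> prod_shom c z ->
  prod_sbr x (prod_sbr y z) =
    prod_sbr (prod_sbr x y) z + (-1) ^+ (a && b) *: prod_sbr y (prod_sbr x z).
Proof.
by case=> ? ? [? ?] [? ?]; congr pair; apply: sbr_jacobi; eassumption.
Qed.

HB.instance Definition _ := isLieSuperalgebra.Build K (g1 * g2)%type
  prod_shom_linear prod_shom_decomp prod_shom_direct prod_sbr_linearl
  prod_sbr_linearr prod_sbr_shom prod_sbr_skew prod_sbr_jacobi.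

End ProductSuperalgebra.

(* X0 stands for h, the other names for x_{-2alpha}, ..., x_{2alpha}. *)
Variant ospb := Xm2 | Xm1 | X0 | Xp1 | Xp2.

Definition ospb_code (a : ospb) : nat :=
  match a with Xm2 => 0 | Xm1 => 1 | X0 => 2 | Xp1 => 3 | Xp2 => 4 end.
Definition ospb_decode (n : nat) : ospb :=
  match n with 0 => Xm2 | 1 => Xm1 | 2 => X0 | 3 => Xp1 | _ => Xp2 end.
Fact ospb_codeK : cancel ospb_code ospb_decode. Proof. by case. Qed.

HB.instance Definition _ := Countable.copy ospb (can_type ospb_codeK).
Fact ospb_enumP : Finite.axiom [:: Xm2; Xm1; X0; Xp1; Xp2].
Proof. by case. Qed.
HB.instance Definition _ := isFinite.Build ospb ospb_enumP.

Lemma big_ospb (V : nmodType) (F : ospb -> V) :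
  \sum_a F a = F Xm2 + F Xm1 + F X0 + F Xp1 + F Xp2.
Proof.
have -> : index_enum ospb = [:: Xm2; Xm1; X0; Xp1; Xp2].
  by rewrite [index_enum _]unlock Finite.enum.unlock.
by rewrite !big_cons big_nil addr0 !addrA.
Qed.

Definition ospb_odd (a : ospb) : bool :=
  match a with Xm1 | Xp1 => true | _ => false end.

Section Osp.
Variable K : fieldType.

Definition osp12 : Type := {ffun ospb -> K^o}.
HB.instance Definition _ := GRing.Lmodule.on osp12.

Definition osp_e (a : ospb) : osp12 := [ffun b => (b == a)%:R].

Definition osp_brb (a b : ospb) : osp12 :=
  match a, b with
  | X0, Xm2 => 2 *: osp_e Xm2
  | X0, Xm1 => osp_e Xm1
  | X0, Xp1 => - osp_e Xp1
  | X0, Xp2 => - (2 *: osp_e Xp2)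
  | Xm2, X0 => - (2 *: osp_e Xm2)
  | Xm1, X0 => - osp_e Xm1
  | Xp1, X0 => osp_e Xp1
  | Xp2, X0 => 2 *: osp_e Xp2
  | Xp1, Xp1 => - (2 *: osp_e Xp2)
  | Xm1, Xm1 => 2 *: osp_e Xm2
  | Xp1, Xm2 => osp_e Xm1
  | Xm2, Xp1 => - osp_e Xm1
  | Xm1, Xp2 => osp_e Xp1
  | Xp2, Xm1 => - osp_e Xp1
  | Xp1, Xm1 => osp_e X0
  | Xm1, Xp1 => osp_e X0
  | Xm2, Xp2 => osp_e X0
  | Xp2, Xm2 => - osp_e X0
  | _, _ => 0
  end.

Definition osp_sbr (u v : osp12) : osp12 :=
  \sum_a \sum_b (u a * v b) *: osp_brb a b.

Definition osp_shom (p : bool) (u : osp12) : Prop :=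
  forall a, ospb_odd a != p -> u a = 0.

Lemma osp_sbrE (u v : osp12) c : osp_sbr u v c =
  match c with
  | Xm2 => 2 * u X0 * v Xm2 - 2 * u Xm2 * v X0 + 2 * u Xm1 * v Xm1
  | Xm1 => u X0 * v Xm1 - u Xm1 * v X0 + u Xp1 * v Xm2 - u Xm2 * v Xp1
  | X0 => u Xp1 * v Xm1 + u Xm1 * v Xp1 + u Xm2 * v Xp2 - u Xp2 * v Xm2
  | Xp1 => u Xp1 * v X0 - u X0 * v Xp1 + u Xm1 * v Xp2 - u Xp2 * v Xm1
  | Xp2 => 2 * u Xp2 * v X0 - 2 * u X0 * v Xp2 - 2 * u Xp1 * v Xp1
  end.
Proof.
rewrite /osp_sbr !big_ospb /osp_brb !ffunE.
by case: c; rewrite /= /GRing.scale /=; ring.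
Qed.

Fact osp_shom_linear b k x y : osp_shom b x -> osp_shom b y ->
  osp_shom b (k *: x + y).
Proof. by move=> hx hy a ha; rewrite !ffunE hx ?hy ?scaler0 ?addr0. Qed.

Fact osp_shom_decomp x : exists y z,
  [/\ osp_shom false y, osp_shom true z & x = y + z].
Proof.
exists [ffun a => if ospb_odd a then 0 else x a],
  [ffun a => if ospb_odd a then x a else 0]; split.
- by move=> a; rewrite ffunE; case: ospb_odd.
- by move=> a; rewrite ffunE; case: ospb_odd.
- by apply/ffunP => a; rewrite !ffunE; case: ospb_odd; rewrite ?add0r ?addr0.
Qed.

Fact osp_shom_direct x : osp_shom false x -> osp_shom true x -> x = 0.
Proof.
move=> h0 h1; apply/ffunP => a; rewrite ffunE.
by case E: (ospb_odd a); [apply: h0 | apply: h1]; rewrite E.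
Qed.

Fact osp_sbr_linearl k x y z :
  osp_sbr (k *: x + y) z = k *: osp_sbr x z + osp_sbr y z.
Proof.
apply/ffunP => c; rewrite ffunE [X in _ = X + _]ffunE !osp_sbrE.
rewrite !ffunE /GRing.scale /=.
by case: c; ring.
Qed.

Fact osp_sbr_linearr k x y z :
  osp_sbr z (k *: x + y) = k *: osp_sbr z x + osp_sbr z y.
Proof.
apply/ffunP => c; rewrite ffunE [X in _ = X + _]ffunE !osp_sbrE.
rewrite !ffunE /GRing.scale /=.
by case: c; ring.
Qed.

Lemma osp_shomE p x : osp_shom p x ->
  if p then [/\ x Xm2 = 0, x X0 = 0 & x Xp2 = 0]
  else x Xm1 = 0 /\ x Xp1 = 0.
Proof. by case: p => h; split; apply: h. Qed.

Ltac osp_zero := repeat match goal with H : _ = 0 |- _ => rewrite H; clear H end.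

Fact osp_sbr_shom a b x y : osp_shom a x -> osp_shom b y ->
  osp_shom (a (+) b) (osp_sbr x y).
Proof.
move=> /osp_shomE hx /osp_shomE hy c; rewrite osp_sbrE.
by case: a hx => -[]; case: b hy => -[]; case: c => //= *; osp_zero; ring.
Qed.

Fact osp_sbr_skew a b x y : osp_shom a x -> osp_shom b y ->
  osp_sbr x y = - ((-1) ^+ (a && b) *: osp_sbr y x).
Proof.
move=> /osp_shomE hx /osp_shomE hy; apply/ffunP => c.
rewrite 2!ffunE !osp_sbrE /GRing.scale /=.
by case: a hx => -[]; case: b hy => -[]; case: c => /= *; osp_zero; ring.
Qed.

Fact osp_sbr_jacobi a b c x y z :
  osp_shom a x -> osp_shom b y -> osp_shom c z ->
  osp_sbr x (osp_sbr y z) =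
    osp_sbr (osp_sbr x y) z + (-1) ^+ (a && b) *: osp_sbr y (osp_sbr x z).
Proof.
move=> /osp_shomE hx /osp_shomE hy /osp_shomE hz; apply/ffunP => d.
rewrite 2!ffunE !osp_sbrE /GRing.scale /=.
by case: a hx => -[]; case: b hy => -[]; case: c hz => -[]; case: d => /= *;
  osp_zero; ring.
Qed.

HB.instance Definition _ := isLieSuperalgebra.Build K osp12
  osp_shom_linear osp_shom_decomp osp_shom_direct osp_sbr_linearl
  osp_sbr_linearr osp_sbr_shom osp_sbr_skew osp_sbr_jacobi.

End Osp.

(* The unital associative algebra with generators X and relations rel, as the
   quotient of the formal algebra expressions by the least congruence which
   contains rel and the algebra axioms. *)
Section PresentedAlgebra.
Variables (K : fieldType) (X : Type).

Inductive aterm :=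
  | Gen of X
  | Cst of K
  | Add of aterm & aterm
  | Mul of aterm & aterm.

HB.instance Definition _ := gen_eqMixin aterm.
HB.instance Definition _ := gen_choiceMixin aterm.

Section Congruence.
Variable rel : aterm -> aterm -> Prop.

Inductive acong : aterm -> aterm -> Prop :=
  | acong_rel s t : rel s t -> acong s t
  | acong_refl s : acong s s
  | acong_sym s t : acong s t -> acong t s
  | acong_trans s t u : acong s t -> acong t u -> acong s u
  | acong_add s s' t t' : acong s s' -> acong t t' ->
      acong (Add s t) (Add s' t')
  | acong_mul s s' t t' : acong s s' -> acong t t' ->
      acong (Mul s t) (Mul s' t')
  | acong_addA s t u : acong (Add s (Add t u)) (Add (Add s t) u)
  | acong_addC s t : acong (Add s t) (Add t s)
  | acong_add0 s : acong (Add (Cst 0) s) s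
  | acong_mulA s t u : acong (Mul s (Mul t u)) (Mul (Mul s t) u)
  | acong_mul0 s : acong (Mul (Cst 0) s) (Cst 0)
  | acong_mul1 s : acong (Mul (Cst 1) s) s
  | acong_mulDl s t u : acong (Mul (Add s t) u) (Add (Mul s u) (Mul t u))
  | acong_mulDr s t u : acong (Mul s (Add t u)) (Add (Mul s t) (Mul s u))
  | acong_cstD a b : acong (Cst (a + b)) (Add (Cst a) (Cst b))
  | acong_cstM a b : acong (Cst (a * b)) (Mul (Cst a) (Cst b))
  | acong_cstC a s : acong (Mul (Cst a) s) (Mul s (Cst a)).

Definition acongb (s t : aterm) : bool := `[< acong s t >].
Fact acongb_equiv : equiv_class_of acongb.
Proof.
split=> [s|s t|t s u].
- exact/asboolP/acong_refl.
- by apply/asboolP/asboolP; apply: acong_sym.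
- by move=> /asboolP st /asboolP tu; apply/asboolP/(acong_trans st tu).
Qed.
Canonical acongb_equiv_rel := EquivRelPack acongb_equiv.
Canonical acongb_encModRel := defaultEncModRel acongb.

Definition palg := {eq_quot acongb}.
HB.instance Definition _ := Choice.on palg.
HB.instance Definition _ := EqQuotient.on palg.

Implicit Types u v w : palg.

Lemma palgP s t : reflect (\pi_palg s = \pi_palg t) `[< acong s t >].
Proof. by rewrite -/(acongb s t); apply: (iffP idP) => /eqmodP. Qed.

Lemma palg_eq s t : acong s t -> \pi_palg s = \pi_palg t.
Proof. by move=> st; apply/palgP/asboolP. Qed.

Lemma palg_repr s : acong (repr (\pi_palg s)) s.
Proof. by apply/asboolP/palgP; rewrite reprK. Qed.

Definition palg_gen (x : X) : palg := \pi_palg (Gen x).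
Definition palg_cst (a : K) : palg := \pi_palg (Cst a).
Definition palg_add u v : palg := \pi_palg (Add (repr u) (repr v)).
Definition palg_mul u v : palg := \pi_palg (Mul (repr u) (repr v)).
Definition palg_opp u : palg := palg_mul (palg_cst (-1)) u.

Lemma palg_addE s t : palg_add (\pi_palg s) (\pi_palg t) = \pi_palg (Add s t).
Proof. by apply: palg_eq; apply: acong_add; apply: palg_repr. Qed.
Lemma palg_mulE s t : palg_mul (\pi_palg s) (\pi_palg t) = \pi_palg (Mul s t).
Proof. by apply: palg_eq; apply: acong_mul; apply: palg_repr. Qed.

Fact palg_addA : associative palg_add.
Proof.
elim/quotW=> s; elim/quotW=> t; elim/quotW=> u.
rewrite (palg_addE t u) (palg_addE s t) (palg_addE s _) (palg_addE _ u).
by apply: palg_eq; apply: acong_addA.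
Qed.
Fact palg_addC : commutative palg_add.
Proof.
elim/quotW=> s; elim/quotW=> t; rewrite (palg_addE s t) (palg_addE t s).
by apply: palg_eq; apply: acong_addC.
Qed.
Fact palg_add0 : left_id (palg_cst 0) palg_add.
Proof.
elim/quotW=> s; rewrite (palg_addE (Cst 0) s).
by apply: palg_eq; apply: acong_add0.
Qed.

Fact palg_mulA : associative palg_mul.
Proof.
elim/quotW=> s; elim/quotW=> t; elim/quotW=> u.
rewrite (palg_mulE t u) (palg_mulE s t) (palg_mulE s _) (palg_mulE _ u).
by apply: palg_eq; apply: acong_mulA.
Qed.
Fact palg_cstC a u : palg_mul (palg_cst a) u = palg_mul u (palg_cst a).
Proof.
elim/quotW: u => s; rewrite (palg_mulE (Cst a) s) (palg_mulE s (Cst a)).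
by apply: palg_eq; apply: acong_cstC.
Qed.
Fact palg_mul0 u : palg_mul (palg_cst 0) u = palg_cst 0.
Proof.
elim/quotW: u => s; rewrite (palg_mulE (Cst 0) s).
by apply: palg_eq; apply: acong_mul0.
Qed.
Fact palg_mul1 : left_id (palg_cst 1) palg_mul.
Proof.
elim/quotW=> s; rewrite (palg_mulE (Cst 1) s).
by apply: palg_eq; apply: acong_mul1.
Qed.
Fact palg_mulr1 : right_id (palg_cst 1) palg_mul.
Proof. by move=> u; rewrite -palg_cstC palg_mul1. Qed.
Fact palg_mulDl : left_distributive palg_mul palg_add.
Proof.
elim/quotW=> s; elim/quotW=> t; elim/quotW=> u.
rewrite (palg_addE s t) (palg_mulE _ u) (palg_mulE s u) (palg_mulE t u).
by rewrite (palg_addE _ (Mul t u)); apply: palg_eq; apply: acong_mulDl.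
Qed.
Fact palg_mulDr : right_distributive palg_mul palg_add.
Proof.
elim/quotW=> s; elim/quotW=> t; elim/quotW=> u.
rewrite (palg_addE t u) (palg_mulE s _) (palg_mulE s t) (palg_mulE s u).
by rewrite (palg_addE _ (Mul s u)); apply: palg_eq; apply: acong_mulDr.
Qed.
Fact palg_cstD a b : palg_cst (a + b) = palg_add (palg_cst a) (palg_cst b).
Proof.
by rewrite (palg_addE (Cst a) (Cst b)); apply: palg_eq; apply: acong_cstD.
Qed.
Fact palg_cstM a b : palg_cst (a * b) = palg_mul (palg_cst a) (palg_cst b).
Proof.
by rewrite (palg_mulE (Cst a) (Cst b)); apply: palg_eq; apply: acong_cstM.
Qed.
Fact palg_addN : left_inverse (palg_cst 0) palg_opp palg_add.
Proof.
move=> u; rewrite -{2}[u]palg_mul1 -palg_mulDl -palg_cstD addNr.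
exact: palg_mul0.
Qed.

HB.instance Definition _ := GRing.isZmodule.Build palg
  palg_addA palg_addC palg_add0 palg_addN.
HB.instance Definition _ := GRing.Zmodule_isPzRing.Build palg
  palg_mulA palg_mul1 palg_mulr1 palg_mulDl palg_mulDr.

Definition palg_scale a u : palg := palg_cst a * u.
Fact palg_scaleA a b u : palg_scale a (palg_scale b u) = palg_scale (a * b) u.
Proof.
by rewrite /palg_scale mulrA; congr (_ * _); apply: esym; apply: palg_cstM.
Qed.
Fact palg_scale1 : left_id 1 palg_scale.
Proof. exact: palg_mul1. Qed.
Fact palg_scaleDr : right_distributive palg_scale +%R.
Proof. by move=> a u v; rewrite /palg_scale mulrDr. Qed.
Fact palg_scaleDl u : {morph palg_scale^~ u : a b / a + b}.
Proof.
by move=> a b; rewrite /palg_scale -mulrDl; congr (_ * _); apply: palg_cstD.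
Qed.
HB.instance Definition _ := GRing.Zmodule_isLmodule.Build K palg
  palg_scaleA palg_scale1 palg_scaleDr palg_scaleDl.

Lemma palg_scalerAl k u v : k *: (u * v) = (k *: u) * v.
Proof. exact: mulrA. Qed.
Lemma palg_scalerAr k u v : k *: (u * v) = u * (k *: v).
Proof.
rewrite /GRing.scale /= /palg_scale !mulrA; congr (_ * _); exact: palg_cstC.
Qed.

Lemma palg_piD s t : \pi_palg (Add s t) = \pi_palg s + \pi_palg t.
Proof. exact/esym/palg_addE. Qed.
Lemma palg_piM s t : \pi_palg (Mul s t) = \pi_palg s * \pi_palg t.
Proof. exact/esym/palg_mulE. Qed.
Lemma palg_piC a : \pi_palg (Cst a) = a *: (1 : palg).
Proof. exact/esym/(mulr1 (palg_cst a)). Qed.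
Definition palg_piE := (palg_piD, palg_piM, palg_piC).

End Congruence.
End PresentedAlgebra.

Arguments Gen {K X}.
Arguments Cst {K X}.

(* Extension of a map on generators to an algebra morphism; meaningful when it
   is compatible with the relations, see palg_liftE. *)
Section Lift.
Variables (K : fieldType) (X Y : Type).
Variables (relX : aterm K X -> aterm K X -> Prop).
Variables (relY : aterm K Y -> aterm K Y -> Prop).
Variable f : X -> palg relY.

Fixpoint aeval (t : aterm K X) : palg relY :=
  match t with
  | Gen x => f x
  | Cst a => a *: (1 : palg relY)
  | Add s t => aeval s + aeval t
  | Mul s t => aeval s * aeval t
  end.

Definition palg_lift (u : palg relX) : palg relY := aeval (repr u).

Hypothesis relf : forall s t, relX s t -> aeval s = aeval t.

Lemma aeval_cong s t : acong relX s t -> aeval s = aeval t.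
Proof.
elim=> {s t} /=.
- exact: relf.
- by [].
- by move=> s t _ ->.
- by move=> s t u _ -> _ ->.
- by move=> s s' t t' _ -> _ ->.
- by move=> s s' t t' _ -> _ ->.
- by move=> s t u; rewrite addrA.
- by move=> s t; rewrite addrC.
- by move=> s; rewrite scale0r add0r.
- by move=> s t u; rewrite mulrA.
- by move=> s; rewrite scale0r mul0r.
- by move=> s; rewrite scale1r mul1r.
- by move=> s t u; rewrite mulrDl.
- by move=> s t u; rewrite mulrDr.
- by move=> a b; rewrite scalerDl.
- by move=> a b; rewrite -palg_scalerAl mul1r scalerA.
- by move=> a s; rewrite -palg_scalerAl -palg_scalerAr mul1r mulr1.
Qed.

Lemma palg_liftE t : palg_lift (\pi_(palg relX) t) = aeval t.
Proof. exact/aeval_cong/palg_repr. Qed.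

Lemma palg_lift_gen x : palg_lift (palg_gen relX x) = f x.
Proof. exact: palg_liftE. Qed.

Lemma palg_lift1 : palg_lift 1 = 1.
Proof. by rewrite [LHS]palg_liftE /= scale1r. Qed.

Lemma palg_liftD u v : palg_lift (u + v) = palg_lift u + palg_lift v.
Proof. by rewrite [LHS]palg_liftE. Qed.

Lemma palg_liftM u v : palg_lift (u * v) = palg_lift u * palg_lift v.
Proof. by rewrite [LHS]palg_liftE. Qed.

Lemma palg_liftZ a u : palg_lift (a *: u) = a *: palg_lift u.
Proof.
rewrite [a *: u]/(palg_cst relX a * u) palg_liftM [palg_lift (_ a)]palg_liftE.
by rewrite /= -palg_scalerAl mul1r.
Qed.

End Lift.

(* The enveloping superalgebra: xy - (-1)^(|x||y|) yx = [x, y] for homogeneous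
   x and y. *)
Section Enveloping.
Variables (K : fieldType) (g : lieSuperalgType K).

Inductive uea_rel : aterm K g -> aterm K g -> Prop :=
  | uea_rel_linear k x y :
      uea_rel (Gen (k *: x + y)) (Add (Mul (Cst k) (Gen x)) (Gen y))
  | uea_rel_br a b x y : shom a x -> shom b y ->
      uea_rel (Mul (Gen x) (Gen y))
        (Add (Mul (Cst ((-1) ^+ (a && b))) (Mul (Gen y) (Gen x)))
             (Gen (sbr x y))).

Definition uea := palg uea_rel.
HB.instance Definition _ := GRing.PzRing.on uea.
HB.instance Definition _ := GRing.Lmodule.on uea.

Definition uea_in (x : g) : uea := palg_gen uea_rel x.

Lemma uea_in_linear k x y : uea_in (k *: x + y) = k *: uea_in x + uea_in y.
Proof.
have /acong_rel/palg_eq := uea_rel_linear k x y.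
by rewrite !palg_piE -palg_scalerAl mul1r.
Qed.

Lemma uea_in_br a b x y : shom a x -> shom b y ->
  uea_in x * uea_in y =
    (-1) ^+ (a && b) *: (uea_in y * uea_in x) + uea_in (sbr x y).
Proof.
move=> hx hy; have /acong_rel/palg_eq := uea_rel_br hx hy.
by rewrite !palg_piE -palg_scalerAl mul1r.
Qed.

Inductive uea_hom : bool -> uea -> Prop :=
  | uea_hom_in a x : shom a x -> uea_hom a (uea_in x)
  | uea_hom1 : uea_hom false 1
  | uea_hom_linear a k u v : uea_hom a u -> uea_hom a v ->
      uea_hom a (k *: u + v)
  | uea_homM a b u v : uea_hom a u -> uea_hom b v -> uea_hom (a (+) b) (u * v).

End Enveloping.

(* Functoriality of U on Lie superalgebra morphisms f. *)
Section EnvelopingMap.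
Variables (K : fieldType) (g1 g2 : lieSuperalgType K) (f : g1 -> g2).

Definition uea_map : uea g1 -> uea g2 := palg_lift (fun x => uea_in (f x)).

Lemma uea_mapP :
  (forall k x y, f (k *: x + y) = k *: f x + f y) ->
  (forall a x, shom a x -> shom a (f x)) ->
  (forall x y, f (sbr x y) = sbr (f x) (f y)) ->
  forall s t, uea_rel s t ->
    aeval (fun x => uea_in (f x)) s = aeval (fun x => uea_in (f x)) t.
Proof.
move=> fL fH fB _ _ [k x y|a b x y hx hy] /=; rewrite -palg_scalerAl mul1r.
  by rewrite fL uea_in_linear.
by rewrite fB (uea_in_br (fH _ _ hx) (fH _ _ hy)).
Qed.

End EnvelopingMap.

Section EnvelopingTensor.
Variables (K : fieldType) (g1 g2 : lieSuperalgType K).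

Definition lie_inl (x : g1) : (g1 * g2)%type := (x, 0).
Definition lie_inr (y : g2) : (g1 * g2)%type := (0, y).

Lemma lie_shom0 (g : lieSuperalgType K) b : shom b (0 : g).
Proof.
have [y [z [hy hz]]] := shom_decomp (0 : g); case: b.
  by have := shom_linear _ (-1) _ _ hz hz; rewrite scaleN1r addNr.
by have := shom_linear _ (-1) _ _ hy hy; rewrite scaleN1r addNr.
Qed.

Lemma lie_sbr00 (g : lieSuperalgType K) : sbr (0 : g) 0 = 0.
Proof.
by have := sbr_linearl (-1) (0 : g) 0 0; rewrite scaler0 addr0 scaleN1r addNr.
Qed.

Lemma lie_inlP s t : uea_rel s t ->
  aeval (fun x => uea_in (lie_inl x)) s = aeval (fun x => uea_in (lie_inl x)) t.
Proof.
apply: uea_mapP => [k x y|a x hx|x y].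
- by congr pair; rewrite /= scaler0 addr0.
- by split=> //; apply: lie_shom0.
- by congr pair; rewrite /= lie_sbr00.
Qed.

Lemma lie_inrP s t : uea_rel s t ->
  aeval (fun x => uea_in (lie_inr x)) s = aeval (fun x => uea_in (lie_inr x)) t.
Proof.
apply: uea_mapP => [k x y|a x hx|x y].
- by congr pair; rewrite /= scaler0 addr0.
- by split=> //; apply: lie_shom0.
- by congr pair; rewrite /= lie_sbr00.
Qed.

(* The image of u (x) v under U(g1) (x) U(g2) = U(g1 x g2). *)
Definition uea_tensor (u : uea g1) (v : uea g2) : uea (g1 * g2)%type :=
  uea_map lie_inl u * uea_map lie_inr v.

End EnvelopingTensor.

(* The universal algebra under A := palg rel in which the elements of S become
   invertible; it is the Ore localization when S is an Ore set. *)
Section Localization.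
Variables (K : fieldType) (X : Type) (rel : aterm K X -> aterm K X -> Prop).
Variable S : palg rel -> Prop.

Let gens : Type := (palg rel + {s : palg rel | S s})%type.
Let inA (u : palg rel) : aterm K gens := Gen (inl u).
Let invS (s : {s : palg rel | S s}) : aterm K gens := Gen (inr s).

Inductive loc_rel : aterm K gens -> aterm K gens -> Prop :=
  | loc_rel_linear k u v :
      loc_rel (inA (k *: u + v)) (Add (Mul (Cst k) (inA u)) (inA v))
  | loc_rel_mul u v : loc_rel (inA (u * v)) (Mul (inA u) (inA v))
  | loc_rel_one : loc_rel (inA 1) (Cst 1)
  | loc_rel_invl s : loc_rel (Mul (invS s) (inA (sval s))) (Cst 1)
  | loc_rel_invr s : loc_rel (Mul (inA (sval s)) (invS s)) (Cst 1).

Definition loc := palg loc_rel.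
HB.instance Definition _ := GRing.PzRing.on loc.
HB.instance Definition _ := GRing.Lmodule.on loc.

Definition loc_in (u : palg rel) : loc := palg_gen loc_rel (inl u).
Definition loc_inv (s : palg rel) (Ss : S s) : loc :=
  palg_gen loc_rel (inr (exist _ s Ss)).

Lemma loc_in_linear k u v : loc_in (k *: u + v) = k *: loc_in u + loc_in v.
Proof.
have /acong_rel/palg_eq := loc_rel_linear k u v.
by rewrite !palg_piE -palg_scalerAl mul1r.
Qed.
Lemma loc_inM u v : loc_in (u * v) = loc_in u * loc_in v.
Proof. by have /acong_rel/palg_eq := loc_rel_mul u v; rewrite !palg_piE. Qed.
Lemma loc_in1 : loc_in 1 = 1.
Proof.
by have /acong_rel/palg_eq := loc_rel_one; rewrite !palg_piE scale1r.
Qed.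
Lemma loc_invl s (Ss : S s) : loc_inv Ss * loc_in s = 1.
Proof.
have /acong_rel/palg_eq := loc_rel_invl (exist _ s Ss).
by rewrite !palg_piE scale1r.
Qed.
Lemma loc_invr s (Ss : S s) : loc_in s * loc_inv Ss = 1.
Proof.
have /acong_rel/palg_eq := loc_rel_invr (exist _ s Ss).
by rewrite !palg_piE scale1r.
Qed.

End Localization.

Section Diamond.
Variable K : fieldType.

Definition GG : lieSuperalgType K := (osp12 K * osp12 K)%type.
Definition UG := uea GG.

Definition gX (a : ospb) : GG := (osp_e K a, osp_e K a).
Definition gT (a : ospb) : GG := (osp_e K a, - osp_e K a).

Inductive Dset : UG -> Prop :=
  | Dset1 : Dset 1
  | Dset_gen (n : int) : Dset (uea_in (gX X0) - n%:~R)
  | DsetM d e : Dset d -> Dset e -> Dset (d * e).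

Definition DUG := loc Dset.
HB.instance Definition _ := GRing.PzRing.on DUG.
HB.instance Definition _ := GRing.Lmodule.on DUG.

Definition UX (a : ospb) : DUG := loc_in Dset (uea_in (gX a)).
Definition UT (a : ospb) : DUG := loc_in Dset (uea_in (gT a)).
Definition UH : DUG := UX X0.
Definition Hinv (n : int) : DUG := loc_inv (Dset_gen n).

Inductive DUG_hom : bool -> DUG -> Prop :=
  | DUG_hom_in a u : uea_hom a u -> DUG_hom a (loc_in Dset u)
  | DUG_hom_inv d (Dd : Dset d) : DUG_hom false (loc_inv Dd)
  | DUG_hom_linear a k u v : DUG_hom a u -> DUG_hom a v ->
      DUG_hom a (k *: u + v)
  | DUG_homM a b u v : DUG_hom a u -> DUG_hom b v -> DUG_hom (a (+) b) (u * v).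

(* The subalgebra D^-1 U(h) of U. *)
Definition DUh (f : DUG) : Prop := exists (p : {poly K}) (d : UG) (Dd : Dset d),
  f = (\sum_(i < size p) p`_i *: UH ^+ i) * loc_inv Dd.

(* g_- U + U g_+, with g_- and g_+ spanned by X_-alpha, X_-2alpha and by
   X_alpha, X_2alpha. *)
Definition inJ (u : DUG) : Prop := exists u1 u2 v1 v2 : DUG,
  u = UX Xm1 * u1 + UX Xm2 * u2 + v1 * UX Xp1 + v2 * UX Xp2.

Definition J : {pred DUG} := [pred u | `[< inJ u >]].
Fact J_zmod_closed : zmod_closed J.
Proof.
split; first by apply/asboolP; exists 0, 0, 0, 0; rewrite !mulr0 !mul0r !addr0.
move=> u v /asboolP[u1 [u2 [u3 [u4 ->]]]] /asboolP[v1 [v2 [v3 [v4 ->]]]].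
apply/asboolP; exists (u1 - v1), (u2 - v2), (u3 - v3), (u4 - v4).
by rewrite !mulrBr !mulrBl !opprD addrACA; congr (_ + _);
  rewrite addrACA; congr (_ + _); rewrite addrACA.
Qed.
HB.instance Definition _ := GRing.isZmodClosed.Build DUG J J_zmod_closed.

Definition UJ := {ideal_quot J}.
HB.instance Definition _ := GRing.Zmodule.on UJ.

Definition cl (u : DUG) : UJ := \pi u.

Definition UJ_scale (k : K) (a : UJ) : UJ := cl (k *: repr a).

Lemma clD u v : cl (u + v) = cl u + cl v.
Proof. exact: (Quotient.pi_add (J : zmodClosed DUG) u v). Qed.

Lemma clP u v : reflect (cl u = cl v) (u - v \in J).
Proof.
rewrite (Quotient.idealrBE (J : zmodClosed DUG) u v); exact: eqP.
Qed.

Lemma cl_scale k u : cl (k *: u) = UJ_scale k (cl u).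
Proof.
have : u - repr (cl u) \in J by apply/clP; rewrite /cl reprK.
move=> /asboolP[u1 [u2 [v1 [v2 e]]]].
apply/clP/asboolP; exists (k *: u1), (k *: u2), (k *: v1), (k *: v2).
rewrite -scalerBr e !scalerDr.
by congr (_ + _ + _ + _); rewrite 1?palg_scalerAr // -palg_scalerAr palg_scalerAl.
Qed.

Fact UJ_scaleA j k a : UJ_scale j (UJ_scale k a) = UJ_scale (j * k) a.
Proof. by rewrite -cl_scale scalerA. Qed.
Fact UJ_scale1 : left_id 1 UJ_scale.
Proof. by move=> a; rewrite /UJ_scale scale1r /cl reprK. Qed.
Fact UJ_scaleDr : right_distributive UJ_scale +%R.
Proof.
move=> k; elim/quotW=> u; elim/quotW=> v.
by rewrite -[\pi u]/(cl u) -[\pi v]/(cl v) -clD -!cl_scale scalerDr clD.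
Qed.
Fact UJ_scaleDl a : {morph UJ_scale^~ a : j k / j + k}.
Proof. by move=> j k; rewrite /UJ_scale scalerDl clD. Qed.
HB.instance Definition _ := GRing.Zmodule_isLmodule.Build K UJ
  UJ_scaleA UJ_scale1 UJ_scaleDr UJ_scaleDl.

(* f(H) acts on U/J by left multiplication, which preserves J when f is in
   D^-1 U(h). *)
Definition lact (f : DUG) (a : UJ) : UJ := cl (f * repr a).

Fixpoint phi (n : nat) : DUG :=
  match n with
  | 0 => 1
  | m.+1 => if odd m then (m.+1./2)%:R^-1 *: phi m
            else - Hinv (m./2.+1) * phi m
  end.

(* The sum has finite support, and the choice of representatives is immaterial
   as \sum_n phi_n(H) X_-alpha^n X_alpha^n is annihilated by g_+ on the left and
   by g_- on the right. *)
Definition dia (a b : UJ) : UJ :=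
  \sum_(n \in [set: nat])
    cl (repr a * phi n * UX Xm1 ^+ n * UX Xp1 ^+ n * repr b).

Definition xbar (a : ospb) : UJ := cl (UT a).
Definition hhat : UJ := lact (UH - 1) (xbar X0).

Definition UJ_hom (p : bool) (a : UJ) : Prop :=
  exists2 u, DUG_hom p u & a = cl u.

Definition anticentral (a : UJ) : Prop :=
  [/\ UJ_hom false a,
      forall b, UJ_hom false b -> dia a b = dia b a
    & forall b, UJ_hom true b -> dia a b = - dia b a].

Definition C2 (f2 f1 f0 g : DUG) : UJ :=
  lact f2 (dia (xbar Xm2) (xbar Xp2)) + lact f1 (dia (xbar Xm1) (xbar Xp1)) +
  lact f0 (dia hhat hhat) + cl g.

(* For 16 L (x) L the coefficient f_2 is 4 (H - 1) / (H - 2), whereas the source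
   states 4 (H - 2) / (H - 1), which fails.  Modulo J,
     16 L (x) L = - 4 t_-2 t_2 - 2 (H - 2) t_-1 t_1 - t_0^2 + (H - 1)^2,
     x_-1 <> x_1 = t_-1 t_1 + 4 / (H - 2) t_-2 t_2,    x_-2 <> x_2 = t_-2 t_2,
     hhat <> hhat = (H - 1)^2 t_0^2 - (H - 1) t_-1 t_1 + 4 (H - 1) t_-2 t_2
   where t_k and t_0 are the images of (x_k, - x_k) and (h, - h), so
   f_2 = - 4 + 4 / (H - 2) (2 (H - 2) + 1 / (H - 1)) + 4 / (H - 1). *)
Definition has_C2_form (a : UJ) : Prop :=
  exists f2 f1 f0 g, [/\ DUh f2, DUh f1, DUh f0, DUh g & a = C2 f2 f1 f0 g].

Definition ospL : uea (osp12 K) :=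
  uea_in (osp_e K Xm1) * uea_in (osp_e K Xp1)
  - 2^-1 *: uea_in (osp_e K X0) + 4^-1 *: (1 : uea (osp12 K)).

Definition Lbar : UJ := cl (loc_in Dset (uea_tensor ospL ospL)).

End Diamond.

(* Main.v *)
(* The ghost L of U(osp(1|2)) commutes with even and anticommutes with odd
   elements, hence so does L (x) L in U(G).  For the diamond product, moving
   L (x) L through \sum_n phi_n X_-a^n X_a^n leaves only the term n = 0 modulo J,
   so that its class is anti-central.

   Uniqueness: on the tensor product of two Verma modules of highest weights la
   and mu with s = la + mu not an integer, an anti-central class acts on the
   singular vectors v_0, v_1, v_2, v_3 (of weights s, ..., s + 3) by scalars that
   alternate in sign.  With d = la - mu, the class of
   F_2 t_-2 t_2 + F_1 t_-1 t_1 + F_0 t_0^2 + G acts on v_0 by F_0(s) d^2 + G(s), and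
   comparing the coefficients of d^2 and 1 expresses F_1 and F_2 through F_0 and
   leaves
     s F_0(s + 3) + (s + 1) F_0(s + 2) - s F_0(s + 1) - (s + 1) F_0(s) = 0.
   Hence (F_0(s + 2) - F_0(s)) / s is an antiperiodic rational function, so it
   vanishes, F_0 is a constant c, and finally G = - c (s - 1)^2. *)

From HB Require Import structures.
Require Import Defs.
From mathcomp Require Import all_boot all_order all_algebra.
From mathcomp Require Import generic_quotient ring_quotient ring.
From mathcomp Require Import boolp classical_sets functions fsbigop.
From mathcomp Require Import reals complex.
From Stdlib Require Ncring_tac.
Set Implicit Arguments.
Unset Strict Implicit.
Unset Printing Implicit Defensive.
Import GRing.Theory.
Local Open Scope ring_scope.

(** No basis of U or of U/J is used. Since X_2a and X_-2a are, up to sign, the squares of p = X_a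
    and m = X_-a, the space J equals m U + U p, and an equality of classes is proved by exhibiting a
    and b whose combination m a + b p is the difference. The opposite kind of statement, that a
    class is nonzero or that coefficients are forced, cannot be reached by rewriting, because U is
    known only through generators and relations; it is tested on matrix coefficients of a
    representation. There H is diagonal with eigenvalues s + n, so s being no integer is what lets D
    act invertibly. This leaves d free, and every equation becomes an identity in d. The vectors v_1
    and v_2 serve to solve for F_1 and F_2; substituting these in the equation of v_3 leaves F_0
    alone. Elements of D^-1 U(h) are finally recovered from their values at the points 1/2 + k,
    which avoid all poles and are numerous enough to determine a polynomial. *)

Definition ncring_ops (A : pzRingType) :
  @Ncring.Ring_ops A 0 1 +%R *%R (fun x y => x - y) -%R eq.
Proof. by constructor. Defined.
#[local] Existing Instance ncring_ops.
#[local] Instance ncring_ring (A : pzRingType) : Ncring.Ring (Ro := ncring_ops A).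
Proof.
split; try exact _; try (by move=> ? ? -> ? ? ->); try by move=> ? ? ->.
- exact: add0r.
- exact: addrC.
- exact: addrA.
- exact: mul1r.
- exact: mulr1.
- exact: mulrA.
- by move=> *; apply: mulrDl.
- by move=> *; apply: mulrDr.
- by [].
- exact: addrN.
Defined.

(* The preliminary rewriting unfolds numerals, which Ncring_tac would take for
   indeterminates.  The tactic is run over an abstract ring: in DUG, where - x
   is by definition (- 1) * x, unification misfires. *)
Ltac ncring :=
  rewrite ?(mulrS, mulr0n); Ncring_tac.non_commutative_ring.

(** * Relations in the localized enveloping algebra *)

Section InLinear.
Variables (K : fieldType) (g : lieSuperalgType K).

Lemma uea_in0 : uea_in (0 : g) = 0.
Proof.
by rewrite -[0 in LHS](addNr (0 : g)) -scaleN1r uea_in_linear scaleN1r addNr.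
Qed.
Lemma uea_inD (x y : g) : uea_in (x + y) = uea_in x + uea_in y.
Proof. by rewrite -[x]scale1r uea_in_linear !scale1r. Qed.

Variables (X : Type) (rel : aterm K X -> aterm K X -> Prop).
Variable S : palg rel -> Prop.

Lemma loc_in0 : loc_in S 0 = 0.
Proof.
by rewrite -[0 in LHS](addNr (0 : palg rel)) -scaleN1r loc_in_linear scaleN1r addNr.
Qed.
Lemma loc_inZ k u : loc_in S (k *: u) = k *: loc_in S u.
Proof. by rewrite -[k *: u]addr0 loc_in_linear loc_in0 addr0. Qed.
Lemma loc_inD u v : loc_in S (u + v) = loc_in S u + loc_in S v.
Proof. by rewrite -[u]scale1r loc_in_linear !scale1r. Qed.
Lemma loc_inN u : loc_in S (- u) = - loc_in S u.
Proof. by rewrite -!scaleN1r loc_inZ. Qed.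

End InLinear.

Lemma osp_brE (K : fieldType) a b : sbr (osp_e K a) (osp_e K b) = osp_brb K a b.
Proof.
rewrite [LHS]/(osp_sbr _ _) /osp_sbr (bigD1 a) //= (bigD1 b) //= !ffunE !eqxx mulr1.
rewrite scale1r !big1 ?addr0 // => [a' /negPf na|b' /negPf nb].
  by rewrite big1 // => b' _; rewrite !ffunE na mul0r scale0r.
by rewrite !ffunE nb mulr0 scale0r.
Qed.

Lemma osp_eE (K : fieldType) (x : osp12 K) : x = \sum_a x a *: osp_e K a.
Proof.
apply/ffunP => b; rewrite sum_ffunE (bigD1 b) //= !ffunE eqxx big1.
  by rewrite /GRing.scale /= mulr1 addr0.
by move=> a /negPf na; rewrite !ffunE eq_sym na scaler0.
Qed.

Lemma shom_osp_e (K : fieldType) a : shom (ospb_odd a) (osp_e K a).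
Proof.
by move=> b nb; rewrite ffunE; case: (b =P a) nb => // ->; rewrite eqxx.
Qed.

Lemma sbr0r (K : fieldType) (g : lieSuperalgType K) (x : g) : sbr x 0 = 0.
Proof.
by have := sbr_linearr (-1) 0 0 x; rewrite scaler0 addr0 scaleN1r addNr.
Qed.

Lemma sbr0l (K : fieldType) (g : lieSuperalgType K) (x : g) : sbr 0 x = 0.
Proof.
by have := sbr_linearl (-1) 0 0 x; rewrite scaler0 addr0 scaleN1r addNr.
Qed.

Section Relations.
Variable K : fieldType.
Implicit Types (a b : ospb).

Definition in1 (x : osp12 K) : DUG K := loc_in (@Dset K) (uea_in (lie_inl _ x)).
Definition in2 (x : osp12 K) : DUG K := loc_in (@Dset K) (uea_in (lie_inr _ x)).

Lemma in1_linear k x y : in1 (k *: x + y) = k *: in1 x + in1 y.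
Proof.
rewrite /in1 -loc_in_linear -uea_in_linear; congr (loc_in _ (uea_in _)).
by congr pair; rewrite /= scaler0 addr0.
Qed.
Lemma in2_linear k x y : in2 (k *: x + y) = k *: in2 x + in2 y.
Proof.
rewrite /in2 -loc_in_linear -uea_in_linear; congr (loc_in _ (uea_in _)).
by congr pair; rewrite /= scaler0 addr0.
Qed.

Lemma in_pair (x y : osp12 K) :
  loc_in (@Dset K) (uea_in ((x, y) : GG K)) = in1 x + in2 y.
Proof.
rewrite -loc_inD -uea_inD; congr (loc_in _ (uea_in _)).
by congr pair; rewrite /= ?addr0 ?add0r.
Qed.

Lemma in1_br p q (x y : osp12 K) : shom p x -> shom q y ->
  in1 x * in1 y = (-1) ^+ (p && q) *: (in1 y * in1 x) + in1 (sbr x y).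
Proof.
move=> hx hy; rewrite -!loc_inM (@uea_in_br K (GG K) p q).
- rewrite loc_in_linear; congr (_ + loc_in _ (uea_in _)).
  by apply: (congr1 (pair _)); apply: sbr0r.
- by split=> //; apply: lie_shom0.
- by split=> //; apply: lie_shom0.
Qed.
Lemma in2_br p q (x y : osp12 K) : shom p x -> shom q y ->
  in2 x * in2 y = (-1) ^+ (p && q) *: (in2 y * in2 x) + in2 (sbr x y).
Proof.
move=> hx hy; rewrite -!loc_inM (@uea_in_br K (GG K) p q).
- rewrite loc_in_linear; congr (_ + loc_in _ (uea_in _)).
  by apply: (congr1 (pair^~ _)); apply: sbr0r.
- by split=> //; apply: lie_shom0.
- by split=> //; apply: lie_shom0.
Qed.
Lemma in12_comm p q (x y : osp12 K) : shom p x -> shom q y ->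
  in1 x * in2 y = (-1) ^+ (p && q) *: (in2 y * in1 x).
Proof.
move=> hx hy; rewrite -!loc_inM (@uea_in_br K (GG K) p q).
- rewrite loc_in_linear [sbr _ _](_ : _ = 0) ?uea_in0 ?loc_in0 ?addr0 //.
  by apply: (congr2 pair); [apply: sbr0r | apply: sbr0l].
- by split=> //; apply: lie_shom0.
- by split=> //; apply: lie_shom0.
Qed.

Definition y1 a := in1 (osp_e K a).
Definition y2 a := in2 (osp_e K a).

Lemma UXE a : UX K a = y1 a + y2 a. Proof. exact: in_pair. Qed.

Lemma in10 : in1 0 = 0.
Proof.
by have := in1_linear (-1) 0 0; rewrite scaler0 addr0 scaleN1r addNr.
Qed.
Lemma in1Z k x : in1 (k *: x) = k *: in1 x.
Proof. by rewrite -[k *: x]addr0 in1_linear in10 addr0. Qed.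
Lemma in1N x : in1 (- x) = - in1 x.
Proof. by rewrite -!scaleN1r in1Z. Qed.
Lemma in20 : in2 0 = 0.
Proof.
by have := in2_linear (-1) 0 0; rewrite scaler0 addr0 scaleN1r addNr.
Qed.
Lemma in2Z k x : in2 (k *: x) = k *: in2 x.
Proof. by rewrite -[k *: x]addr0 in2_linear in20 addr0. Qed.
Lemma in2N x : in2 (- x) = - in2 x.
Proof. by rewrite -!scaleN1r in2Z. Qed.

Lemma UTE a : UT K a = y1 a - y2 a.
Proof. by rewrite [LHS]in_pair in2N. Qed.

Lemma y1_br a b : y1 a * y1 b =
  (-1) ^+ (ospb_odd a && ospb_odd b) *: (y1 b * y1 a) + in1 (osp_brb K a b).
Proof. by rewrite -osp_brE; apply: in1_br; apply: shom_osp_e. Qed.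
Lemma y2_br a b : y2 a * y2 b =
  (-1) ^+ (ospb_odd a && ospb_odd b) *: (y2 b * y2 a) + in2 (osp_brb K a b).
Proof. by rewrite -osp_brE; apply: in2_br; apply: shom_osp_e. Qed.
Lemma y12_comm a b : y1 a * y2 b =
  (-1) ^+ (ospb_odd a && ospb_odd b) *: (y2 b * y1 a).
Proof. by apply: in12_comm; apply: shom_osp_e. Qed.

End Relations.

Section DiagonalRelations.
Variable K : fieldType.

(** Linear extensions of [UX] and [UT]: a bracket [osp_brb] is a combination of basis vectors, and
    these maps carry it to U term by term. *)
Definition inX (x : osp12 K) : DUG K := in1 x + in2 x.
Definition inT (x : osp12 K) : DUG K := in1 x - in2 x.

Lemma shom_gX a : @shom K (GG K) (ospb_odd a) (gX K a).
Proof. by split; apply: shom_osp_e. Qed.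
Lemma shom_gT a : @shom K (GG K) (ospb_odd a) (gT K a).
Proof.
split; first exact: shom_osp_e.
have := shom_linear _ (-1) _ _ (@shom_osp_e K a) (lie_shom0 _ _).
by rewrite scaleN1r addr0.
Qed.

Lemma in_br a (x y : GG K) b : shom a x -> shom b y ->
  loc_in (@Dset K) (uea_in x) * loc_in (@Dset K) (uea_in y) =
  (-1) ^+ (a && b) *: (loc_in (@Dset K) (uea_in y) * loc_in (@Dset K) (uea_in x))
  + in1 (sbr x.1 y.1) + in2 (sbr x.2 y.2).
Proof.
by move=> hx hy; rewrite -addrA -in_pair -!loc_inM (uea_in_br hx hy) loc_in_linear.
Qed.

Lemma sbrNr (g : lieSuperalgType K) (x y : g) : sbr x (- y) = - sbr x y.
Proof.
by rewrite -scaleN1r -[_ *: y]addr0 sbr_linearr sbr0r addr0 scaleN1r.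
Qed.

Lemma XX_br a b : UX K a * UX K b =
  (-1) ^+ (ospb_odd a && ospb_odd b) *: (UX K b * UX K a) + inX (osp_brb K a b).
Proof. by rewrite (in_br (shom_gX a) (shom_gX b)) /= osp_brE addrA. Qed.
Lemma XT_br a b : UX K a * UT K b =
  (-1) ^+ (ospb_odd a && ospb_odd b) *: (UT K b * UX K a) + inT (osp_brb K a b).
Proof.
by rewrite (in_br (shom_gX a) (shom_gT b)) /= sbrNr osp_brE in2N addrA.
Qed.

Lemma inXZ k x : inX (k *: x) = k *: inX x.
Proof. by rewrite /inX in1Z in2Z scalerDr. Qed.
Lemma inTZ k x : inT (k *: x) = k *: inT x.
Proof. by rewrite /inT in1Z in2Z scalerBr. Qed.
Lemma inXN x : inX (- x) = - inX x.
Proof. by rewrite -!scaleN1r inXZ. Qed.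
Lemma inTN x : inT (- x) = - inT x.
Proof. by rewrite -!scaleN1r inTZ. Qed.
Lemma inX0 : inX 0 = 0. Proof. by rewrite -(scale0r 0) inXZ scale0r. Qed.
Lemma inT0 : inT 0 = 0. Proof. by rewrite -(scale0r 0) inTZ scale0r. Qed.
Lemma inX_e a : inX (osp_e K a) = UX K a. Proof. by rewrite UXE. Qed.
Lemma inT_e a : inT (osp_e K a) = UT K a. Proof. by rewrite UTE. Qed.

Definition in_simpl := (inXZ, inTZ, inXN, inTN, inX0, inT0, inX_e, inT_e,
  expr1, expr0, scaleN1r, scale1r, addr0).

Local Notation m := (UX K Xm1).
Local Notation p := (UX K Xp1).
Local Notation H := (UH K).
Local Notation t := (UT K).

Lemma Xp1_Xm1 : p * m = - (m * p) + H.
Proof. by rewrite XX_br /= !in_simpl. Qed.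
Lemma UH_Xm1 : H * m = m * H + m.
Proof. by rewrite XX_br /= !in_simpl. Qed.
Lemma Xp1_UH : p * H = H * p + p.
Proof. by rewrite XX_br /= !in_simpl. Qed.
Lemma UH_T b : H * UT K b = UT K b * H + inT (osp_brb K X0 b).
Proof. by rewrite XT_br /= !in_simpl. Qed.
Lemma Xp1_T0 : p * t X0 = t X0 * p + t Xp1.
Proof. by rewrite XT_br /= !in_simpl. Qed.
Lemma Xp1_Tp1 : p * t Xp1 = - (t Xp1 * p) - 2 *: t Xp2.
Proof. by rewrite XT_br /= !in_simpl. Qed.
Lemma Xp1_Tp2 : p * t Xp2 = t Xp2 * p.
Proof. by rewrite XT_br /= !in_simpl. Qed.
Lemma Xp1_Tm1 : p * t Xm1 = - (t Xm1 * p) + t X0.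
Proof. by rewrite XT_br /= !in_simpl. Qed.
Lemma Xp1_Tm2 : p * t Xm2 = t Xm2 * p + t Xm1.
Proof. by rewrite XT_br /= !in_simpl. Qed.
Lemma Xm1_Tm1 : m * t Xm1 = - (t Xm1 * m) + 2 *: t Xm2.
Proof. by rewrite XT_br /= !in_simpl. Qed.
Lemma Xm1_T0 : m * t X0 = t X0 * m - t Xm1.
Proof. by rewrite XT_br /= !in_simpl. Qed.

Hypothesis char0 : [pchar K] =i pred0.

Lemma natK_neq0 n : n.+1%:R != 0 :> K.
Proof. by rewrite ((pcharf0P K).1 char0). Qed.

(** For an odd generator u, the relation of u with itself reads u u = - u u + [u, u]. Halving it
    exhibits the generators of weight 2a and -2a as squares up to sign. *)
Lemma half_id (V : lmodType K) (x y : V) : x = - x + 2 *: y -> x = y.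
Proof.
move=> e; apply: (scalerI (natK_neq0 1)).
by rewrite {1}scaler_nat mulr2n {2}e addrA subrr add0r.
Qed.

Lemma UXm2E : UX K Xm2 = m * m.
Proof.
by apply/esym/half_id; rewrite {1}XX_br /= !in_simpl.
Qed.
Lemma UXp2E : UX K Xp2 = - (p * p).
Proof.
apply: oppr_inj; rewrite opprK.
by apply/esym/half_id; rewrite {1}XX_br /= !in_simpl scalerN.
Qed.
Lemma y1_m2 : y1 K Xm2 = y1 K Xm1 * y1 K Xm1.
Proof.
by apply/esym/half_id; rewrite {1}y1_br /= in1Z !in_simpl.
Qed.
Lemma y2_m2 : y2 K Xm2 = y2 K Xm1 * y2 K Xm1.
Proof.
by apply/esym/half_id; rewrite {1}y2_br /= in2Z !in_simpl.
Qed.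
Lemma y1_p2 : y1 K Xp2 = - (y1 K Xp1 * y1 K Xp1).
Proof.
apply: oppr_inj; rewrite opprK.
by apply/esym/half_id; rewrite {1}y1_br /= in1N in1Z !in_simpl scalerN.
Qed.
Lemma y2_p2 : y2 K Xp2 = - (y2 K Xp1 * y2 K Xp1).
Proof.
apply: oppr_inj; rewrite opprK.
by apply/esym/half_id; rewrite {1}y2_br /= in2N in2Z !in_simpl scalerN.
Qed.

End DiagonalRelations.

Lemma palg_ind (K : fieldType) (X : Type) (rel : aterm K X -> aterm K X -> Prop)
    (P : palg rel -> Prop) :
  (forall x, P (palg_gen rel x)) -> (forall a, P (a *: (1 : palg rel))) ->
  (forall u v, P u -> P v -> P (u + v)) ->
  (forall u v, P u -> P v -> P (u * v)) -> forall u, P u.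
Proof.
move=> Pg Pc PD PM; elim/quotW; elim=> [x|a|s Ps t Pt|s Ps t Pt].
- exact: Pg.
- by rewrite [X in P X]palg_piC; apply: Pc.
- by rewrite [X in P X]palg_piD; apply: PD.
- by rewrite [X in P X]palg_piM; apply: PM.
Qed.

(** * The extremal series and the diamond product *)

Lemma natr_central (A : pzSemiRingType) (x : A) n : x * n%:R = n%:R * x.
Proof. by rewrite mulr_natr mulr_natl. Qed.

Lemma signr_central (A : pzRingType) (x : A) n : x * (-1) ^+ n = (-1) ^+ n * x.
Proof.
by rewrite -signr_odd; case: odd; rewrite ?expr1 ?expr0; ncring.
Qed.

(** Inductive step of [Xp1_Psum]: s is the sign (-1)^N, f and g are the coefficients of orders N and
    N + 1, and c is the coefficient from [p_mX]. The hypothesis on g c makes the old boundary term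
    cancel. *)
Lemma telescope_l (A : pzRingType) (s f g c p q x y : A) :
  g * c = - s * f -> g * s = s * g ->
  s * (f * x * q) + g * (- s * (y * p) + c * x) * q = - s * (g * y * (p * q)).
Proof.
move=> e es; rewrite mulrDr mulrDl [g * (c * _)]mulrA e !mulrA !mulrN es.
ncring.
Qed.

(** Mirror image for [Psum_Xm1]. Here c stands to the right of y = m^(N+1), whence the different
    hypothesis. *)
Lemma telescope_r (A : pzRingType) (s f g c m p q y : A) :
  g * (y * c) = - s * f * y -> g * y * s = s * (g * y) ->
  s * (f * y * q) + g * y * (- s * (m * p) + c * q) = - s * (g * (y * m) * p).
Proof.
move=> e es; rewrite mulrDr [g * y * (c * _)]mulrA -[g * y * c]mulrA e !mulrA !mulrN es.
ncring.
Qed.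

(** * Moving an odd generator past a power of the other one *)

Section BorelCommutation.
Variables (A : pzRingType) (p m H : A).
Hypothesis pm : p * m = - (m * p) + H.
Hypothesis Hm : H * m = m * H + m.
Hypothesis pH : p * H = H * p + p.

Lemma mXH j : m ^+ j * H = (H - j%:R) * m ^+ j.
Proof.
elim: j => [|j IH]; first by rewrite subr0 mulr1 mul1r.
have mH : m * H = H * m - m by rewrite Hm addrK.
rewrite exprSr -natr1 opprD addrA -[LHS]mulrA mH mulrBr [_ * (H * m)]mulrA IH.
by rewrite [in RHS]mulrBl mul1r mulrA.
Qed.

Lemma pXH j : p ^+ j * H = (H + j%:R) * p ^+ j.
Proof.
elim: j => [|j IH]; first by rewrite addr0 mulr1 mul1r.
rewrite exprSr -natr1 addrA -[LHS]mulrA pH mulrDr [_ * (H * p)]mulrA IH.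
by rewrite [in RHS]mulrDl mul1r mulrA.
Qed.

(** The alternating sum H - (H - 1) + (H - 2) - ... with j terms, produced when p anticommutes past
    j factors m. Its two closed forms, according to the parity of j, are the origin of the two cases
    in the recursion of phi. *)
Definition pm_coef j : A := if odd j then H - j./2%:R else j./2%:R.
Definition mp_coef j : A := if odd j then H + j./2%:R else j./2%:R.

Lemma natr_half j : j%:R = (odd j)%:R + j./2%:R + j./2%:R :> A.
Proof. by rewrite -!natrD -addnA addnn odd_double_half. Qed.

Lemma pm_coefS j : pm_coef j.+1 = (-1) ^+ j * (H - j%:R) + pm_coef j.
Proof.
rewrite (natr_half j) -signr_odd /pm_coef /= uphalf_half natrD.
case: (odd j); rewrite /= ?expr0 ?expr1 ?mulr0n ?mulr1n;
  move: H (j./2%:R) => h x; ncring.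
Qed.

Lemma mp_coefS j : p * mp_coef j = ((-1) ^+ j.+1 * H + mp_coef j.+1) * p.
Proof.
have e n : p * n%:R = n%:R * p by rewrite mulr_natr mulr_natl.
rewrite exprS -signr_odd /mp_coef /= uphalf_half natrD.
by case: (odd j); rewrite /= ?expr0 ?expr1 ?mulr0n ?mulr1n ?mulrDr ?pH e;
  move: (j./2%:R : A) => x; ncring.
Qed.

Lemma p_mX j :
  p * m ^+ j.+1 = (-1) ^+ j.+1 * (m ^+ j.+1 * p) + pm_coef j.+1 * m ^+ j.
Proof.
elim: j => [|j IH].
  by rewrite !expr1 mulN1r mulr1 /pm_coef /= subr0 pm.
have e2 : m ^+ j.+2 = m ^+ j.+1 * m by rewrite exprSr.
have e3 : (-1) ^+ j.+2 = - (-1) ^+ j.+1 :> A by rewrite exprS mulN1r.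
rewrite pm_coefS e3 e2 [p * (_ * m)]mulrA IH mulrDl -!mulrA -exprSr pm.
rewrite [m ^+ _ * (_ + H)]mulrDr mXH.
move: (m ^+ _) (pm_coef _) ((-1) ^+ _) (j.+1%:R) => *; ncring.
Qed.

Lemma pX_m j :
  p ^+ j.+1 * m = (-1) ^+ j.+1 * (m * p ^+ j.+1) + mp_coef j.+1 * p ^+ j.
Proof.
elim: j => [|j IH].
  by rewrite !expr1 mulN1r mulr1 /mp_coef /= addr0 pm.
have e2 : p ^+ j.+2 = p * p ^+ j.+1 by rewrite exprS.
have e3 : (-1) ^+ j.+2 = - (-1) ^+ j.+1 :> A by rewrite exprS mulN1r.
have e4 x : p * ((-1) ^+ j.+1 * x) = (-1) ^+ j.+1 * (p * x).
  by rewrite -signr_odd; case: odd; rewrite ?expr1 ?expr0; ncring.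
have e : p * p ^+ j = p ^+ j.+1 by rewrite exprS.
rewrite [in LHS]e2 -mulrA IH mulrDr e4 [p * (m * _)]mulrA pm.
rewrite [p * (mp_coef _ * _)]mulrA mp_coefS e3 -[_ * p * p ^+ _]mulrA e e2.
move: (p ^+ j.+1) (mp_coef j.+2) ((-1) ^+ _) => *; ncring.
Qed.

End BorelCommutation.

Section Diamond.
Variable K : fieldType.
Hypothesis char0 : [pchar K] =i pred0.

Local Notation m := (UX K Xm1).
Local Notation p := (UX K Xp1).
Local Notation H := (UH K).
Local Notation t := (UT K).
Implicit Types (u v w : DUG K).

Lemma loc_in_subC n : loc_in (@Dset K) (uea_in (gX K X0) - n%:~R) = H - n%:~R.
Proof.
by rewrite loc_inD loc_inN -scaler_int loc_inZ loc_in1 scaler_int.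
Qed.

Lemma HinvK n : Hinv K n * (H - n%:~R) = 1.
Proof. by rewrite -loc_in_subC loc_invl. Qed.
Lemma HinvKr n : (H - n%:~R) * Hinv K n = 1.
Proof. by rewrite -loc_in_subC loc_invr. Qed.

(** Sandwich x f' between g' g = 1 and f f' = 1. Every commutation rule of H - n passes to its
    inverse in this way. *)
Lemma swap_inv (A : pzRingType) (x f f' g g' : A) :
  f * f' = 1 -> g' * g = 1 -> g * x = x * f -> x * f' = g' * x.
Proof.
by move=> ff gg e; rewrite -[LHS]mul1r -gg -mulrA [g * _]mulrA e -mulrA ff mulr1.
Qed.

Lemma Hinv_comm n : GRing.comm H (Hinv K n).
Proof.
apply: (swap_inv (HinvKr n) (HinvK n)).
rewrite mulrBl mulrBr; congr (_ - _).
by rewrite -scaler_int -palg_scalerAl -palg_scalerAr mulr1 mul1r.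
Qed.

Lemma Hinv_Xm1_shift n : Hinv K (n + 1) * m = m * Hinv K n.
Proof.
apply/esym/(swap_inv (HinvKr n) (HinvK _)).
rewrite mulrBl mulrBr UH_Xm1 -addrA; congr (_ + _).
by rewrite rmorphD /= mulrDl mul1r opprD addrCA subrr addr0 mulrzl mulrzr.
Qed.

Lemma Xp1_Hinv n : p * Hinv K n = Hinv K (n - 1) * p.
Proof.
apply: (swap_inv (HinvKr n) (HinvK _)).
rewrite mulrBl mulrBr Xp1_UH rmorphB /= mulrBl mul1r opprB addrA.
by rewrite mulrzl mulrzr.
Qed.

(* phi_n(H + k) *)
Fixpoint phis (k : int) (n : nat) : DUG K :=
  match n with
  | 0 => 1
  | n.+1 => if odd n then (n.+1./2)%:R^-1 *: phis k n
            else - Hinv K (n./2.+1%:Z - k) * phis k n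
  end.

Lemma phiE (n : nat) : phi K n = phis 0 n.
Proof. by elim: n => //= n ->; rewrite subr0. Qed.

Lemma scaler_comm u k v : GRing.comm u v -> GRing.comm u (k *: v).
Proof. by rewrite /GRing.comm -palg_scalerAl -palg_scalerAr => ->. Qed.

Lemma phis_comm k (n : nat) : GRing.comm H (phis k n).
Proof.
elim: n => [|n IH] /=; first exact: commr1.
case: odd; first exact: scaler_comm.
by apply: commrM => //; apply/commrN/Hinv_comm.
Qed.

Lemma Xp1_phis k (n : nat) : p * phis k n = phis (k + 1) n * p.
Proof.
elim: n => [|n IH] /=; first by rewrite mulr1 mul1r.
case: odd; first by rewrite -palg_scalerAr IH palg_scalerAl.
by rewrite !mulNr mulrN mulrA Xp1_Hinv -!mulrA IH opprD addrA.
Qed.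
Lemma phis_Xm1 k (n : nat) : phis k n * m = m * phis (k + 1) n.
Proof.
elim: n => [|n IH] /=; first by rewrite mulr1 mul1r.
case: odd; first by rewrite -palg_scalerAr -IH palg_scalerAl.
rewrite !mulNr mulrN [m * (_ * _)]mulrA -Hinv_Xm1_shift -!mulrA IH.
by congr (- (Hinv _ _ * _)); rewrite opprD addrA subrK.
Qed.

(** Truncations of the extremal projector of the diagonal osp(1|2), which p annihilates from the
    left and m from the right. *)
Definition Psum (N : nat) : DUG K := \sum_(n < N) phis 0 n * m ^+ n * p ^+ n.

Lemma scale_half (j : nat) u : odd j -> (j.+1./2)%:R^-1 *: u * (j.+1./2)%:R = u.
Proof.
case: j => // j _; rewrite /= -scaler_nat -palg_scalerAl -palg_scalerAr mulr1.
by rewrite scalerA mulVf ?natK_neq0 // scale1r.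
Qed.

Lemma Hinv_phis k n j (x : DUG K) : x = H - n%:~R ->
  - Hinv K n * phis k j * x = - phis k j.
Proof.
move=> ->; rewrite -mulrA mulNr; congr (- _).
have -> : phis k j * (H - n%:~R) = (H - n%:~R) * phis k j.
  by rewrite mulrBr mulrBl (phis_comm k j) mulrzl mulrzr.
by rewrite mulrA HinvK mul1r.
Qed.

(** The recursion of phi is made for this: the factor leading from phi_j(H + 1) to phi_(j+1)(H + 1)
    is, up to sign, the inverse of [pm_coef H j.+1]. *)
Lemma phis_pm (j : nat) :
  phis 1 j.+1 * pm_coef H j.+1 = (-1) ^+ j.+1 * phis 1 j.
Proof.
rewrite -[(-1) ^+ _]signr_odd /pm_coef /=; case: (boolP (odd j)) => oj.
  by rewrite scale_half //= expr0 mul1r.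
rewrite (Hinv_phis _ _ (n := j./2.+1%:Z - 1)) ?expr1 ?mulN1r //.
by rewrite uphalf_half (negPf oj) add0n -addn1 PoszD addrK.
Qed.

Lemma phis_mp (j : nat) : phis 0 j.+1 * (m ^+ j.+1 * mp_coef H j.+1) =
  (-1) ^+ j.+1 * phis 0 j * m ^+ j.+1.
Proof.
rewrite -[(-1) ^+ _]signr_odd /mp_coef.
rewrite [phis 0 j.+1]/= [odd j.+1]/=; case: (boolP (odd j)) => oj.
  rewrite expr0 mul1r natr_central mulrA.
  by rewrite scale_half.
(* Crossing m^(j+1) turns H + j/2 into H - (j + 1) + j/2. For even j this is H - (j/2 + 1), the
   factor inverted in phi_(j+1)(H). *)
rewrite expr1 mulN1r mulrDr mXH ?UH_Xm1 // natr_central -mulrDl.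
rewrite mulrA (Hinv_phis _ _ (n := j./2.+1%:Z - 0)) //.
rewrite subr0 [j in j.+1%:R](_ : j = j./2 + j./2)%N; last first.
  by rewrite addnn -[LHS]odd_double_half (negPf oj).
rewrite [_.+1./2]/= uphalf_half (negPf oj) add0n.
rewrite -addrA; congr (_ + _).
by rewrite -addSn natrD opprD addrNK.
Qed.

(* The sum telescopes, only its boundary term remains; the latter vanishes modulo
   J against any v, because p ^+ N.+1 * v lies in U p for N large. *)
Lemma Xp1_Psum N : p * Psum N.+1 = (-1) ^+ N * (phis 1 N * m ^+ N * p ^+ N.+1).
Proof.
elim: N => [|N IH]; first by rewrite /Psum big_ord1 !mulr1 !mul1r.
rewrite /Psum big_ord_recr -/(Psum _) mulrDr IH /=.
rewrite -/(phis 0 N.+1).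
have -> : p * (phis 0 N.+1 * m ^+ N.+1 * p ^+ N.+1)
        = phis 1 N.+1 * (p * m ^+ N.+1) * p ^+ N.+1.
  by rewrite !mulrA Xp1_phis.
rewrite (p_mX (Xp1_Xm1 K) (UH_Xm1 K)).
rewrite [p ^+ N.+2]exprS [(-1) ^+ N.+1]exprS mulN1r.
apply: telescope_l; last exact: signr_central.
by rewrite phis_pm exprS mulN1r.
Qed.

Lemma Psum_Xm1 N : Psum N.+1 * m = (-1) ^+ N * (phis 0 N * m ^+ N.+1 * p ^+ N).
Proof.
elim: N => [|N IH]; first by rewrite /Psum big_ord1 !mulr1 !mul1r.
rewrite /Psum big_ord_recr -/(Psum _) mulrDl IH /=.
rewrite -/(phis 0 N.+1).
have -> : phis 0 N.+1 * m ^+ N.+1 * p ^+ N.+1 * m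
        = phis 0 N.+1 * m ^+ N.+1 * (p ^+ N.+1 * m).
  by rewrite !mulrA.
rewrite (pX_m (Xp1_Xm1 K) (Xp1_UH K)).
rewrite [m ^+ N.+2]exprSr [(-1) ^+ N.+1]exprS mulN1r.
apply: telescope_r; last exact: signr_central.
by rewrite phis_mp exprS mulN1r.
Qed.

End Diamond.

(** * Local nilpotence of the adjoint action of p *)

Section Nilpotence.
Variables (A : pzRingType) (p : A).
Implicit Types u v w : A.

(* The exponent k, instead of 1, makes the property stable under products. *)
Definition absorbs v := forall k, exists N w, p ^+ N * v = w * p ^+ k.

Lemma absorbsD u v : absorbs u -> absorbs v -> absorbs (u + v).
Proof.
move=> hu hv k; have [M [x ex]] := hu k; have [N [y ey]] := hv k.
exists (M + N)%N, (p ^+ N * x + p ^+ M * y).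
by rewrite mulrDr {1}[(M + N)%N]addnC !exprD -!mulrA ex ey mulrDl !mulrA.
Qed.

Lemma absorbsM u v : absorbs u -> absorbs v -> absorbs (u * v).
Proof.
move=> hu hv k; have [M [x ex]] := hv k; have [N [y ey]] := hu M.
by exists N, (y * x); rewrite mulrA ey -mulrA ex mulrA.
Qed.

(** Each further p on the left of v either crosses v up to a sign or produces v', which p^N has
    already turned into a multiple of p^k. *)
Lemma absorbs_br v (e : bool) v' :
  p * v = (-1) ^+ e * (v * p) + v' -> absorbs v' -> absorbs v.
Proof.
move=> ev hv' k; have [N [w ew]] := hv' k.
suff [y ey] : exists y, p ^+ (k + N) * v = y * p ^+ k by exists (k + N)%N, y.
(* With k fixed in advance, the same N serves all i <= k: the correction p^i w p^k still ends in
   p^(i+1) as long as i < k. *)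
suff H i : (i <= k)%N -> exists y, p ^+ (i + N) * v = y * p ^+ i by exact: H.
elim: i => [_|i IH ik]; first by exists (p ^+ (0 + N) * v); rewrite mulr1.
have [y ey] := IH (ltnW ik).
exists ((-1) ^+ e * y + p ^+ i * w * p ^+ (k - i.+1)).
rewrite addSn exprSr -mulrA ev mulrDr mulrDl.
rewrite mulrA signr_central -!mulrA [p ^+ (i + N) * (v * p)]mulrA ey.
rewrite [in X in _ + X]exprD -[in X in _ + X]mulrA ew -exprD subnK //.
by rewrite -[in LHS]mulrA -exprSr !mulrA.
Qed.

Lemma absorbs_ge v N w : p ^+ N * v = w * p ->
  forall M, (N <= M)%N -> exists w', p ^+ M * v = w' * p.
Proof.
move=> e M NM; exists (p ^+ (M - N) * w).
by rewrite -mulrA -e mulrA -exprD subnK.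
Qed.

End Nilpotence.

Lemma add3K (V : zmodType) (x y z : V) : x + y + z - x = y + z.
Proof. by rewrite addrAC [x + y]addrC addrK. Qed.

(** * Calculus modulo J and truncation of the diamond product *)

Section Quotient.
Variable K : fieldType.
Hypothesis char0 : [pchar K] =i pred0.

Local Notation m := (UX K Xm1).
Local Notation p := (UX K Xp1).
Local Notation H := (UH K).
Local Notation t := (UT K).
Implicit Types (u v w : DUG K).

Lemma absorbs_scal k : absorbs p (k *: (1 : DUG K)).
Proof.
move=> j; exists j, (k *: (1 : DUG K)).
by rewrite -palg_scalerAl -palg_scalerAr mul1r mulr1.
Qed.

Lemma absorbsZ k u : absorbs p u -> absorbs p (k *: u).
Proof.
move=> hu; rewrite -[u]mul1r palg_scalerAl; apply: absorbsM => //.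
exact: absorbs_scal.
Qed.

Lemma absorbs_UX a : absorbs p (UX K a).
Proof.
have h1 : absorbs p p by move=> k; exists k, p; rewrite -exprSr exprS.
have h0 : absorbs p H by move=> k; exists k, (H + k%:R); rewrite (pXH (Xp1_UH K)).
have hm : absorbs p m.
  by apply: (@absorbs_br _ _ _ true) h0; rewrite expr1 mulN1r Xp1_Xm1.
case: a => //; first by rewrite UXm2E //; apply: absorbsM.
rewrite UXp2E // -scaleN1r; apply: absorbsZ; exact: absorbsM.
Qed.

(** The t's form a copy of the adjoint module, in which bracketing with p climbs from t_-2 up to t_2
    and then to 0. The property therefore descends from t_2 by [absorbs_br]. *)
Lemma absorbs_UT a : absorbs p (t a).
Proof.
have h2 : absorbs p (t Xp2).
  apply: (@absorbs_br _ _ _ false 0); first by rewrite mul1r addr0 Xp1_Tp2.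
  by move=> k; exists 0%N, 0; rewrite mul0r mulr0.
have h1 : absorbs p (t Xp1).
  apply: (@absorbs_br _ _ _ true (- 2 *: t Xp2)).
    by rewrite expr1 mulN1r Xp1_Tp1 scaleNr.
  exact: absorbsZ.
have h0 : absorbs p (t X0).
  by apply: (@absorbs_br _ _ _ false _ _ h1); rewrite mul1r Xp1_T0.
have hm1 : absorbs p (t Xm1).
  by apply: (@absorbs_br _ _ _ true _ _ h0); rewrite expr1 mulN1r Xp1_Tm1.
case: a => //.
by apply: (@absorbs_br _ _ _ false _ _ hm1); rewrite mul1r Xp1_Tm2.
Qed.

Lemma absorbs_y a : absorbs p (y1 K a) /\ absorbs p (y2 K a).
Proof.
have e1 : y1 K a = 2^-1 *: (UX K a + t a).
  rewrite UXE UTE addrACA subrr addr0 -mulr2n -scaler_nat scalerA mulVf ?scale1r //.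
  exact: natK_neq0.
have e2 : y2 K a = 2^-1 *: (UX K a + -1 *: t a).
  rewrite scaleN1r UXE UTE opprB [_ + (_ - _)]addrC addrA subrK -mulr2n -scaler_nat.
  rewrite scalerA mulVf ?scale1r //; exact: natK_neq0.
have hX := absorbs_UX a; have hT := absorbs_UT a.
rewrite e1 e2; split; apply: absorbsZ; apply: absorbsD => //; exact: absorbsZ.
Qed.

Lemma absorbs_in (x : GG K) : absorbs p (loc_in (@Dset K) (uea_in x)).
Proof.
case: x => x y; rewrite in_pair; apply: absorbsD.
  rewrite (osp_eE x) big_ospb.
  do 4?[rewrite -[X in in1 (X + _)]scale1r in1_linear scale1r; apply: absorbsD];
    rewrite in1Z; apply: absorbsZ; exact: (absorbs_y _).1.
rewrite (osp_eE y) big_ospb.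
do 4?[rewrite -[X in in2 (X + _)]scale1r in2_linear scale1r; apply: absorbsD];
  rewrite in2Z; apply: absorbsZ; exact: (absorbs_y _).2.
Qed.

Lemma absorbs_loc_in (u : UG K) : absorbs p (loc_in (@Dset K) u).
Proof.
move: u; apply: palg_ind => [x|a|u v hu hv|u v hu hv].
- exact: absorbs_in.
- by rewrite loc_inZ loc_in1; apply: absorbs_scal.
- by rewrite loc_inD; apply: absorbsD.
- by rewrite loc_inM; apply: absorbsM.
Qed.

Lemma inv_uniq (A : pzRingType) (x y z : A) : y * x = 1 -> x * z = 1 -> y = z.
Proof. by move=> yx xz; rewrite -[y]mulr1 -xz mulrA yx mul1r. Qed.

(** The localization has a separate generator [loc_inv Dd] for each d and each proof [Dd].
    Uniqueness of inverses identifies it with a product of [Hinv n]. *)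
Lemma loc_inv_ind (P : DUG K -> Prop) : P 1 -> (forall n, P (Hinv K n)) ->
  (forall u v, P u -> P v -> P (u * v)) ->
  forall d (Dd : Dset d), P (loc_inv Dd).
Proof.
move=> P1 PH PM d Dd.
suff [x [xd Px]] : exists x, x * loc_in (@Dset K) d = 1 /\ P x.
  by rewrite -(inv_uniq xd (loc_invr Dd)).
elim: d / Dd => [|n|d e _ [x [xd Px]] _ [y [ye Py]]].
- by exists 1; rewrite loc_in1 mulr1.
- by exists (Hinv K n); rewrite loc_invl.
- exists (y * x); split; last exact: PM.
  by rewrite loc_inM -mulrA [x * _]mulrA xd mul1r.
Qed.

(** This is what makes the sum in [dia] finite modulo J, whatever the right factor. *)
Lemma absorbs_all u : absorbs p u.
Proof.
move: u; apply: palg_ind => [[u|[d Dd]]|a|u v hu hv|u v hu hv].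
- exact: absorbs_loc_in.
- rewrite -/(loc_inv Dd).
  apply: (@loc_inv_ind (absorbs p)) => [|n|]; last exact: absorbsM.
    by rewrite -(scale1r (1 : DUG K)); apply: absorbs_scal.
  move=> k; exists k; elim: k n => [|k IH] n.
    by exists (Hinv K n); rewrite mul1r mulr1.
  have [w ew] := IH (n - 1); exists w.
  by rewrite exprSr -[LHS]mulrA Xp1_Hinv [LHS]mulrA ew -mulrA.
- exact: absorbs_scal.
- exact: absorbsD.
- exact: absorbsM.
Qed.

(** The summands of weights -2a and 2a are swallowed, since X_-2a = m m and X_2a = - p p. *)
Lemma inJP u : inJ u <-> exists a b, u = m * a + b * p.
Proof.
split=> [[a [a2 [b [b2 ->]]]]|[a [b ->]]]; last first.
  by exists a, 0, b, 0; rewrite mulr0 mul0r !addr0.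
exists (a + m * a2), (b + b2 * - p); rewrite UXm2E // UXp2E //.
by move: m p => x y; ncring.
Qed.

Lemma cl_eq u v a b : u - v = m * a + b * p -> cl u = cl v.
Proof. by move=> e; apply/clP/asboolP/inJP; exists a, b. Qed.

Lemma clE u v : cl u = cl v -> exists a b, u = v + m * a + b * p.
Proof.
move=> /clP/asboolP/inJP[a [b e]]; exists a, b.
by rewrite -addrA -e addrC subrK.
Qed.

Lemma cl0 : cl 0 = 0 :> UJ K.
Proof. by apply: (addrI (cl 0)); rewrite -clD !addr0. Qed.
Lemma clN u : cl (- u) = - cl u.
Proof. by apply/eqP; rewrite eq_sym eqr_oppLR -addr_eq0 -clD addrN cl0. Qed.
Lemma clZ k u : cl (k *: u) = k *: cl u. Proof. exact: cl_scale. Qed.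

Lemma cl_m a : cl (m * a) = 0.
Proof. by rewrite -cl0; apply: (@cl_eq _ _ a 0); rewrite subr0 mul0r addr0. Qed.
Lemma cl_p b : cl (b * p) = 0.
Proof. by rewrite -cl0; apply: (@cl_eq _ _ 0 b); rewrite subr0 mulr0 add0r. Qed.

Lemma cl_sum (I : Type) (r : seq I) (P : pred I) (F : I -> DUG K) :
  cl (\sum_(i <- r | P i) F i) = \sum_(i <- r | P i) cl (F i).
Proof. exact: (big_morph _ (@clD K) cl0). Qed.

Lemma p_large u : exists N, forall M, (N <= M)%N -> exists w, p ^+ M * u = w * p.
Proof.
by have [N [w e]] := absorbs_all u 1; exists N; apply: absorbs_ge e.
Qed.

Lemma Psum_cl N M u v w : p ^+ N * v = w * p -> (N <= M)%N ->
  cl (u * Psum K M * v) = cl (u * Psum K N * v).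
Proof.
move=> /absorbs_ge e NM; rewrite -(subnKC NM); elim: (M - N)%N => [|j IH].
  by rewrite addn0.
rewrite addnS /Psum big_ord_recr -/(Psum K _) mulrDr mulrDl clD IH.
have [w' ew] := e _ (leq_addr j N).
by rewrite -!mulrA ew !mulrA cl_p addr0.
Qed.

(** Working form of the diamond product: representatives and truncation order are free. A change m a
    + b p of u meets [p * Psum], a change of v meets [Psum * m]; both telescope to boundary terms
    that vanish modulo J at large order. *)
Lemma diaE u v N w : p ^+ N * v = w * p ->
  dia (cl u) (cl v) = cl (u * Psum K N * v).
Proof.
move=> pv; rewrite /dia; set u' := repr (cl u); set v' := repr (cl v).
have [a [b eu]] : exists a b, u' = u + m * a + b * p.
  by apply: clE; rewrite /cl reprK.
have [c [d ev]] : exists c d, v' = v + m * c + d * p.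
  by apply: clE; rewrite /cl reprK.
have [N1 h1] := p_large v'; have [N2 h2] := p_large c.
(* N serves v, N1 serves v', and N2 serves the coefficient c of m in v' - v. Each bound makes the
   power of p in front of that element end in U p. The sums have order M + 1, as in the telescoping
   formulas. *)
pose M := (maxn N (maxn N1 N2)).
have M1 : (N1 <= M)%N by rewrite !leq_max leqnn !orbT.
have M2 : (N2 <= M)%N by rewrite !leq_max leqnn !orbT.
transitivity (cl (u' * Psum K M.+1 * v')).
  rewrite /Psum mulr_sumr mulr_suml cl_sum -(@fsbig_widen _ _ _ _ `I_(M.+1)) //.
    rewrite -fsbig_ord; apply: eq_bigr => i _.
    by rewrite phiE !mulrA.
  move=> n [_ /negP]; rewrite -leqNgt => Mn.
  have [w' ew] := h1 _ (leq_trans M1 (ltnW Mn)).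
  by rewrite /= -mulrA ew mulrA cl_p.
have -> : cl (u' * Psum K M.+1 * v') = cl (u * Psum K M.+1 * v').
  rewrite eu; have [w' ew] := h1 _ (leqW M1).
  apply: (@cl_eq _ _ (a * Psum K M.+1 * v')
    (b * ((-1) ^+ M * (phis K 1 M * m ^+ M * w')))).
  have -> : (u + m * a + b * p) * Psum K M.+1 * v' =
    u * Psum K M.+1 * v' + m * (a * Psum K M.+1 * v')
     + b * (p * Psum K M.+1 * v').
    by rewrite !mulrDl !mulrA.
  rewrite add3K Xp1_Psum //; congr (_ + _).
  by rewrite -!mulrA ew !mulrA.
rewrite -(Psum_cl _ pv (leqW (leq_maxl _ _ : (N <= M)%N))).
have [w' ew] := h2 _ M2.
rewrite ev; apply: (@cl_eq _ _ 0
  (u * ((-1) ^+ M * (phis K 0 M * m ^+ M.+1 * w')) + u * Psum K M.+1 * d)).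
have -> : u * Psum K M.+1 * (v + m * c + d * p) =
    u * Psum K M.+1 * v + u * (Psum K M.+1 * m) * c + u * Psum K M.+1 * d * p.
  by rewrite !mulrDr !mulrA.
rewrite add3K Psum_Xm1 // mulr0 add0r [RHS]mulrDl; congr (_ + _).
by rewrite -!mulrA ew !mulrA.
Qed.

End Quotient.

(** * The class of L (x) L *)

(** Here T, s, t1, t2 stand for t_-1, t_-2, t_1, t_2 and i1, i2 for the inverses of H - 1, H - 2.
    The corrections 2 s from T m and - 2 t2 from p t1 multiply to 4 i2 s t2; what is left starts
    with m or ends with p. *)
Lemma dia11_identity (A : pzRingType) (T i1 i2 m p s t1 t2 : A) :
  T * i1 = i2 * T -> i2 * m = m * i1 -> T * m = - (m * T) + (s + s) ->
  p * t1 = - (t1 * p) - (t2 + t2) ->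
  T * (1 - i1 * m * p) * t1 = T * t1 + 4 * i2 * s * t2
    + m * (- 2 * i1 * T * t2) + (i2 * T * m * t1) * p.
Proof.
move=> hi him hT ht.
have -> : T * (1 - i1 * m * p) * t1 = T * t1 - i2 * (T * m) * (p * t1).
  by rewrite !mulrA -hi; ncring.
rewrite ht mulrBr [i2 * (T * m) * (t2 + _)](_ : _ =
   4 * i2 * s * t2 + m * (- 2 * i1 * T * t2)); first by ncring.
have -> : m * (- 2 * i1 * T * t2) = - 2 * (m * i1) * T * t2 by ncring.
by rewrite hT -him; ncring.
Qed.

(** The factor H - 1 in [hhat] commutes past t0 and cancels the denominator i1 of the series, so the
    result is polynomial in H. *)
Lemma dia00_identity (A : pzRingType) (H i1 m p T t0 t1 t2 s : A) :
  (H - 1) * i1 = 1 -> H * t0 = t0 * H -> H * m = m * H + m ->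
  p * H = H * p + p -> T * m = - (m * T) + (s + s) -> 
  t0 * m = m * t0 + T -> p * t1 = - (t1 * p) - (t2 + t2) ->
  p * t0 = t0 * p + t1 -> H * T = T * H + T -> H * s = s * H + (s + s) ->
  (H - 1) * t0 * (1 - i1 * m * p - i1 * (m * m) * (p * p)) * ((H - 1) * t0) =
  (H - 1) * (H - 1) * t0 * t0 - (H - 1) * T * t1 + 4 * (H - 1) * s * t2
  + m * (- (t0 * H * (t0 * p + t1))
         - t0 * m * (H + 1) * (t0 * p * p - (t2 + t2))
         - 2 * T * (H + 1) * t2)
  + (- (T * H * t0) - T * m * (H + 1) * t0 * p) * p.
Proof.
move=> hi h0 hm hp hT h0m h1 hp0 hHT hHs.
have e1 : (H - 1) * t0 * i1 = t0.
  by rewrite mulrBl h0 mul1r -{2}[t0]mulr1 -mulrBr -mulrA hi mulr1.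
have e2 : p * ((H - 1) * t0) = H * (t0 * p + t1).
  rewrite mulrA mulrBr hp mulr1 addrK -mulrA hp0 //.
have e3 : p * p * ((H - 1) * t0) = (H + 1) * (t0 * p * p - (t2 + t2)).
  rewrite -mulrA e2 mulrA hp mulrDl -[H * p * _]mulrA !mulrDr.
  rewrite [p * (t0 * _)]mulrA hp0 h1.
  by ncring.
have e4 : T * H = (H - 1) * T by rewrite mulrBl hHT; ncring.
have e5 : s * (H + 1) = (H - 1) * s by rewrite mulrBl hHs; ncring.
have -> : (H - 1) * t0 * (1 - i1 * m * p - i1 * (m * m) * (p * p)) * ((H - 1) * t0)
  = (H - 1) * t0 * ((H - 1) * t0) - (H - 1) * t0 * i1 * m * (p * ((H - 1) * t0))
    - (H - 1) * t0 * i1 * m * m * (p * p * ((H - 1) * t0)) by ncring.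
rewrite e1 e2 e3 h0m.
have -> : (H - 1) * t0 * ((H - 1) * t0) = (H - 1) * (H - 1) * t0 * t0.
  by rewrite -!mulrA; congr (_ * _); rewrite mulrA mulrBr -h0; ncring.
have -> : (H - 1) * T * t1 = T * H * t1 by rewrite e4.
have -> : 4 * (H - 1) * s * t2 = 4 * (s * (H + 1)) * t2 by rewrite e5; ncring.
have -> : (m * t0 + T) * m = m * t0 * m + (- (m * T) + (s + s)) by rewrite mulrDl hT.
by rewrite hT -[m * t0 * m]mulrA h0m; ncring.
Qed.

(** * The ghost of osp(1|2) and its tensor square in normal order *)

Section NormalOrder.
Variables (A : pzRingType) (a b h c e k : A).
Hypotheses (ba : b * a = - (a * b) + h) (ha : h * a = a * h + a)
  (bh : b * h = h * b + b) (ec : e * c = - (c * e) + k)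
  (kc : k * c = c * k + c) (ek : e * k = k * e + e)
  (ca : c * a = - (a * c)) (ea : e * a = - (a * e)) (bc : b * c = - (c * b))
  (eb : e * b = - (b * e)) (ka : k * a = a * k) (hc : h * c = c * h)
  (kh : k * h = h * k) (bk : b * k = k * b) (eh : e * h = h * e).

Let assoc (x y z : A) : x * y = z -> forall w, x * (y * w) = z * w.
Proof. by move=> <- w; rewrite mulrA. Qed.

(** Read from left to right, the relations sort words into the order a, c, h, k, b, e. The versions
    in [rulesA] apply at the head of a longer right-associated word. *)
Let rules := (ba, ha, bh, ec, kc, ek, ca, ea, bc, eb, ka, hc, kh, bk, eh).
Let rulesA := (assoc ba, assoc ha, assoc bh, assoc ec, assoc kc, assoc ek,
  assoc ca, assoc ea, assoc bc, assoc eb, assoc ka, assoc hc, assoc kh,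
  assoc bk, assoc eh).

Ltac normal_order :=
  rewrite ?(mulrS, mulr0n);
  do 12?[rewrite ?(mulrDl, mulrDr, mulrN, mulNr, mul1r, mulr1, opprD, opprK);
         rewrite -?mulrA ?(rules, rulesA)].

Lemma ghost_anticomm_a : (4 * a * b - 2 * h + 1) * a = - (a * (4 * a * b - 2 * h + 1)).
Proof. by normal_order; ncring. Qed.
Lemma ghost_anticomm_b : (4 * a * b - 2 * h + 1) * b = - (b * (4 * a * b - 2 * h + 1)).
Proof. by normal_order; ncring. Qed.
(** The other tensor factor only sees that L is even. Hence L (x) L takes one sign, and not two,
    past an odd generator of either factor. *)
Lemma ghost_comm_c : (4 * a * b - 2 * h + 1) * c = c * (4 * a * b - 2 * h + 1).
Proof. by normal_order; ncring. Qed.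
Lemma ghost_comm_e : (4 * a * b - 2 * h + 1) * e = e * (4 * a * b - 2 * h + 1).
Proof. by normal_order; ncring. Qed.

(** The generators c and e are eliminated through a c = a a - m a and b e = b p - b b. The last two
    summands are the explicit part in m U + U p. *)
Lemma ghost2_identity (m := a + c) (p := b + e) (H := h + k) :
  (4 * a * b - 2 * h + 1) * (4 * c * e - 2 * k + 1) =
  - 4 * (a * a - c * c) * (e * e - b * b) - 2 * (H - 2) * (a - c) * (b - e)
  - (h - k) * (h - k) + (H - 1) * (H - 1)
  + m * (16 * a * (b * p - b * b) - 4 * m * (p * p - 2 * b * b)
        - 8 * h * (p - b) + 4 * (p - b) - 2 * (H - 1) * (2 * b - p))
  + (- 16 * a * a * b + 8 * a * a * p + 8 * a * h - 4 * a - 4 * (H - 2) * a) * p.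
Proof.
have E1 : a * b * c * e = - ((a * a - m * a) * (b * p - b * b)).
  have -> : a * b * c * e = a * (b * c) * e by rewrite /m /p /H; ncring.
  have -> : m * a = a * a - a * c by rewrite mulrDl ca.
  by rewrite bc; rewrite /m /p /H; ncring.
have E2 : a * b * k = k * a * b by rewrite ka -!mulrA bk.
have E3 : h * c * e = m * h * (p - b) - a * h * p + (h * a - a) * b.
  by rewrite hc ha; rewrite /m /p /H; ncring.
have E5 : a * a - c * c = 2 * a * a - m * m.
  have -> : m * m = a * a + a * c + c * a + c * c by rewrite /m /p /H; ncring.
  by rewrite ca; rewrite /m /p /H; ncring.
have E6 : e * e - b * b = p * p - 2 * b * b.
  have -> : p * p = b * b + b * e + e * b + e * e by rewrite /m /p /H; ncring.
  by rewrite eb; rewrite /m /p /H; ncring.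
have E8 : H * m = m * H + m.
  have -> : H * m = h * a + h * c + k * a + k * c by rewrite /m /p /H; ncring.
  by rewrite ha hc ka kc; rewrite /m /p /H; ncring.
have -> : (4 * a * b - 2 * h + 1) * (4 * c * e - 2 * k + 1) =
  16 * (a * b * c * e) - 8 * (a * b * k) - 8 * (h * c * e) + 4 * a * b
  + 4 * c * e + 4 * h * k - 2 * H + 1 by rewrite /m /p /H; ncring.
have -> : 2 * (H - 2) * (a - c) * (b - e) =
  2 * ((H - 2) * (2 * a) - (H * m - 2 * m)) * (2 * b - p) by rewrite /m /p /H; ncring.
rewrite -[- 4 * _ * _]mulrA E1 E2 E3 E5 E6 E8.
have -> : (h - k) * (h - k) = (H - 1) * (H - 1) - 4 * h * k + 2 * H - 1.
  have -> : (h - k) * (h - k) = h * h - h * k - k * h + k * k by ncring.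
  have -> : (H - 1) * (H - 1) = h * h + h * k + k * h + k * k - 2 * H + 1.
    by rewrite /m /p /H; ncring.
  by rewrite kh; rewrite /m /p /H; ncring.
rewrite /m /p /H; ncring.
Qed.
End NormalOrder.

(** Bracketing with p sends t0 to t1, then to - 2 t2, then to 0, while crossing H only shifts it. So
    three factors p suffice, and the square of [hhat] needs the series only to order 3. *)
Lemma cube_absorb (A : pzRingType) (H p t0 t1 t2 : A) :
  p * H = H * p + p -> p * t0 = t0 * p + t1 ->
  p * t1 = - (t1 * p) - (t2 + t2) -> p * t2 = t2 * p ->
  p ^+ 3 * ((H - 1) * t0) = (H + 1 + 1) * (t0 * p * p + t1 * p - (t2 + t2)) * p.
Proof.
move=> hp h0 h1 h2.
have e1 : p * ((H - 1) * t0) = H * (t0 * p + t1).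
  by rewrite mulrA mulrBr hp mulr1 addrK -mulrA h0.
have e2 x : p * (H * x) = (H + 1) * (p * x) by rewrite mulrA hp; ncring.
have e3 x : p * ((H + 1) * x) = (H + 1 + 1) * (p * x).
  by rewrite mulrA mulrDr hp; ncring.
have e4 : p * (t0 * p + t1) = t0 * p * p - (t2 + t2).
  by rewrite mulrDr mulrA h0 h1; ncring.
have e5 : p * (t0 * p * p - (t2 + t2)) = (t0 * p * p + t1 * p - (t2 + t2)) * p.
  by rewrite mulrBr mulrDr h2 !mulrA h0; ncring.
by rewrite !exprS mulr1 -!mulrA e1 e2 e4 e3 e5; ncring.
Qed.

(** * Diamond monomials and the class of 16 L (x) L in terms of the t's *)

Section GhostClass.
Variable K : fieldType.
Hypothesis char0 : [pchar K] =i pred0.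

Local Notation m := (UX K Xm1).
Local Notation p := (UX K Xp1).
Local Notation H := (UH K).
Local Notation t := (UT K).
Local Notation Hi := (Hinv K).
Implicit Types (u v w f : DUG K).

(* Left multiplication by such an f preserves J. *)
Definition hfun f := exists f', f * m = m * f'.

Lemma hfunM f g : hfun f -> hfun g -> hfun (f * g).
Proof.
move=> [f' ef] [g' eg]; exists (f' * g').
by rewrite -mulrA eg mulrA ef mulrA.
Qed.
Lemma hfunD f g : hfun f -> hfun g -> hfun (f + g).
Proof.
by move=> [f' ef] [g' eg]; exists (f' + g'); rewrite mulrDl mulrDr ef eg.
Qed.
Lemma hfun_scal k : hfun (k *: (1 : DUG K)).
Proof.
by exists (k *: (1 : DUG K)); rewrite -palg_scalerAl -palg_scalerAr mul1r mulr1.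
Qed.
Lemma hfunZ k f : hfun f -> hfun (k *: f).
Proof.
by move=> hf; rewrite -[f]mul1r palg_scalerAl; apply: hfunM hf; apply: hfun_scal.
Qed.
Lemma hfun1 : hfun 1. Proof. by exists 1; rewrite mulr1 mul1r. Qed.
Lemma hfunH : hfun H.
Proof. by exists (H + 1); rewrite UH_Xm1 mulrDr mulr1. Qed.
Lemma hfun_Hinv n : hfun (Hi n).
Proof.
by exists (Hi (n - 1)); rewrite -{1}[n](subrK 1) Hinv_Xm1_shift.
Qed.
Lemma hfun_loc_inv d (Dd : Dset d) : hfun (loc_inv Dd).
Proof.
by apply: (@loc_inv_ind _ hfun); [apply: hfun1 | apply: hfun_Hinv | apply: hfunM].
Qed.

Lemma hfunX f n : hfun f -> hfun (f ^+ n).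
Proof.
move=> hf; elim: n => [|n IH]; first exact: hfun1.
by rewrite exprS; apply: hfunM.
Qed.

Lemma DUh_hfun f : DUh f -> hfun f.
Proof.
move=> [q [d [Dd ->]]]; apply: hfunM; last exact: hfun_loc_inv.
apply: big_ind => [|f' g|i _].
- by rewrite -(scale0r (1 : DUG K)); apply: hfun_scal.
- exact: hfunD.
- by apply/hfunZ/hfunX/hfunH.
Qed.

Lemma lactE f u : hfun f -> lact f (cl u) = cl (f * u).
Proof.
move=> [f' ef]; rewrite /lact.
have [a [b ->]] : exists a b, repr (cl u) = u + m * a + b * p.
  by apply: (clE char0); rewrite /cl reprK.
apply: (@cl_eq _ char0 _ _ (f' * a) (f * b)).
by rewrite !mulrDr !mulrA ef add3K.
Qed.

Lemma scale2_add u : 2 *: u = u + u.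
Proof. by rewrite scaler_nat mulr2n. Qed.

Lemma Tm1_Xm1 : t Xm1 * m = - (m * t Xm1) + (t Xm2 + t Xm2).
Proof. by rewrite Xm1_Tm1 scale2_add opprD opprK addrNK. Qed.

Lemma Xp1_Tp1' : p * t Xp1 = - (t Xp1 * p) - (t Xp2 + t Xp2).
Proof. by rewrite Xp1_Tp1 scale2_add. Qed.

Lemma T0_Xm1 : t X0 * m = m * t X0 + t Xm1.
Proof. by rewrite Xm1_T0 subrK. Qed.

Lemma UH_T0 : H * t X0 = t X0 * H.
Proof. by rewrite UH_T /= inT0 addr0. Qed.
Lemma UH_Tm1 : H * t Xm1 = t Xm1 * H + t Xm1.
Proof. by rewrite UH_T /= inT_e. Qed.
Lemma UH_Tm2 : H * t Xm2 = t Xm2 * H + (t Xm2 + t Xm2).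
Proof. by rewrite UH_T /= inTZ inT_e scale2_add. Qed.

Lemma Tm1_Hinv : t Xm1 * Hi 1 = Hi 2 * t Xm1.
Proof.
apply: (swap_inv (HinvKr K 1) (HinvK K 2)).
have -> : H - 2%:~R = H - 1 - 1 by rewrite -addrA -opprD.
rewrite -[1%:~R]/1; move: UH_Tm1; move: H (t Xm1) => x y e.
by rewrite !mulrBl e; ncring.
Qed.

Lemma Hinv_Xm1 : Hi 2 * m = m * Hi 1.
Proof. by rewrite -(Hinv_Xm1_shift K 1). Qed.

Lemma Psum2 : Psum K 2 = 1 - Hi 1 * m * p.
Proof.
rewrite /Psum 2!big_ord_recr big_ord0 /= add0r !expr0 !mulr1 !mulNr !expr1.
by rewrite subr0.
Qed.

Lemma Psum3 : Psum K 3 = 1 - Hi 1 * m * p - Hi 1 * (m * m) * (p * p).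
Proof.
rewrite {1}/Psum big_ord_recr -/(Psum K 2) Psum2 /= invr1 scale1r subr0 mulr1.
by rewrite !expr2 !mulNr.
Qed.

Lemma dia22 : dia (xbar K Xm2) (xbar K Xp2) = cl (t Xm2 * t Xp2).
Proof.
rewrite /xbar (@diaE _ char0 _ _ 1 (t Xp2)) ?expr1 ?Xp1_Tp2 //.
by rewrite /Psum big_ord1 /= !expr0 !mulr1.
Qed.

Lemma dia11 : dia (xbar K Xm1) (xbar K Xp1) =
  cl (t Xm1 * t Xp1 + 4 * Hi 2 * t Xm2 * t Xp2).
Proof.
rewrite /xbar (@diaE _ char0 _ _ 2 (- (p * t Xp1) - (t Xp2 + t Xp2))).
  rewrite Psum2 (dia11_identity Tm1_Hinv Hinv_Xm1 Tm1_Xm1 Xp1_Tp1').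
  exact: (cl_eq char0 (add3K _ _ _)).
rewrite expr2 -mulrA {1}Xp1_Tp1' mulrBr mulrDr Xp1_Tp2 mulrN mulrA.
by rewrite mulrBl mulrDl mulNr.
Qed.

Lemma UH1_Hinv : (H - 1) * Hi 1 = 1. Proof. exact: (HinvKr K 1). Qed.

Lemma hhatE : hhat K = cl ((H - 1) * t X0).
Proof.
rewrite /hhat lactE //; apply: hfunD; first exact: hfunH.
by rewrite -scaleN1r; apply: hfun_scal.
Qed.

Lemma dia00 : dia (hhat K) (hhat K) = cl ((H - 1) * (H - 1) * t X0 * t X0
   - (H - 1) * t Xm1 * t Xp1 + 4 * (H - 1) * t Xm2 * t Xp2).
Proof.
rewrite hhatE.
have e := cube_absorb (Xp1_UH K) (Xp1_T0 K) Xp1_Tp1' (Xp1_Tp2 K).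
rewrite (diaE char0 _ e) Psum3.
rewrite (dia00_identity UH1_Hinv UH_T0 (UH_Xm1 K) (Xp1_UH K) Tm1_Xm1 T0_Xm1
  Xp1_Tp1' (Xp1_T0 K) UH_Tm1 UH_Tm2).
exact: (cl_eq char0 (add3K _ _ _)).
Qed.

(** The passage from diamond monomials to monomials in the t's is triangular, with invertible
    diagonal. Its coefficients return as [comb2], [comb1], [comb0] in the uniqueness argument. *)
Lemma C2E f2 f1 f0 g : hfun f2 -> hfun f1 -> hfun f0 ->
  C2 f2 f1 f0 g = cl
    ((f2 + f1 * (4 * Hi 2) + f0 * (4 * (H - 1))) * (t Xm2 * t Xp2)
     + (f1 - f0 * (H - 1)) * (t Xm1 * t Xp1)
     + f0 * ((H - 1) * (H - 1)) * (t X0 * t X0) + g).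
Proof.
move=> h2 h1 h0; rewrite /C2 dia22 dia11 dia00 !lactE // -!clD; congr cl.
clear h2 h1 h0; congr (_ + _).
move: (t Xm2) (t Xp2) (t Xm1) (t Xp1) (t X0) H (Hi 2) f2 f1 f0.
move=> *; ncring.
Qed.

Definition ghost1 (a : ospb -> DUG K) : DUG K :=
  a Xm1 * a Xp1 - 2^-1 *: a X0 + 4^-1 *: (1 : DUG K).

Definition ghost2 : DUG K := loc_in (@Dset K) (uea_tensor (ospL K) (ospL K)).

Lemma ghost2E : ghost2 = ghost1 (@y1 K) * ghost1 (@y2 K).
Proof.
have h1 := @lie_inlP K (osp12 K) (osp12 K).
have h2 := @lie_inrP K (osp12 K) (osp12 K).
rewrite /ghost2 /uea_tensor loc_inM; congr (_ * _).
  rewrite /uea_map /ospL !(palg_liftD h1) -scaleN1r !(palg_liftZ h1) (palg_liftM h1).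
  rewrite !(palg_lift_gen h1) (palg_lift1 h1) !loc_inD !loc_inZ loc_inM loc_in1.
  by rewrite scaleN1r.
rewrite /uea_map /ospL !(palg_liftD h2) -scaleN1r !(palg_liftZ h2) (palg_liftM h2).
rewrite !(palg_lift_gen h2) (palg_lift1 h2) !loc_inD !loc_inZ loc_inM loc_in1.
by rewrite scaleN1r.
Qed.

Lemma ghost1_4 a : 4 *: ghost1 a = 4 * a Xm1 * a Xp1 - 2 * a X0 + 1.
Proof.
have n2 : 2 != 0 :> K by apply: (natK_neq0 char0 1).
have n4 : 4 != 0 :> K by apply: (natK_neq0 char0 3).
rewrite /ghost1 scalerDr scalerBr !scalerA mulfV // scale1r.
have -> : 4 * 2^-1 = 2 :> K by field.
by rewrite !scaler_nat -[_ *+ 4]mulr_natl -[_ *+ 2]mulr_natl mulrA.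
Qed.

Local Notation a := (y1 K Xm1).
Local Notation b := (y1 K Xp1).
Local Notation h := (y1 K X0).
Local Notation c := (y2 K Xm1).
Local Notation e := (y2 K Xp1).
Local Notation k := (y2 K X0).

Lemma y1_pm : b * a = - (a * b) + h.
Proof. by rewrite y1_br /= expr1 scaleN1r. Qed.
Lemma y1_0m : h * a = a * h + a.
Proof. by rewrite y1_br /= scale1r. Qed.
Lemma y1_p0 : b * h = h * b + b.
Proof. by rewrite y1_br /= scale1r. Qed.
Lemma y2_pm : e * c = - (c * e) + k.
Proof. by rewrite y2_br /= expr1 scaleN1r. Qed.
Lemma y2_0m : k * c = c * k + c.
Proof. by rewrite y2_br /= scale1r. Qed.
Lemma y2_p0 : e * k = k * e + e.
Proof. by rewrite y2_br /= scale1r. Qed.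
Lemma y21_mm : c * a = - (a * c).
Proof. by rewrite y12_comm /= expr1 scaleN1r opprK. Qed.
Lemma y21_pm : e * a = - (a * e).
Proof. by rewrite y12_comm /= expr1 scaleN1r opprK. Qed.
Lemma y12_pm : b * c = - (c * b).
Proof. by rewrite y12_comm /= expr1 scaleN1r. Qed.
Lemma y21_pp : e * b = - (b * e).
Proof. by rewrite y12_comm /= expr1 scaleN1r opprK. Qed.
Lemma y21_0m : k * a = a * k.
Proof. by rewrite y12_comm /= scale1r. Qed.
Lemma y12_0m : h * c = c * h.
Proof. by rewrite y12_comm /= scale1r. Qed.
Lemma y21_00 : k * h = h * k.
Proof. by rewrite y12_comm /= scale1r. Qed.
Lemma y12_p0 : b * k = k * b.
Proof. by rewrite y12_comm /= scale1r. Qed.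
Lemma y21_p0 : e * h = h * e.
Proof. by rewrite y12_comm /= scale1r. Qed.

Lemma ghost2_16 : 16 *: ghost2 =
  (4 * a * b - 2 * h + 1) * (4 * c * e - 2 * k + 1).
Proof.
rewrite -(ghost1_4 (@y1 K)) -(ghost1_4 (@y2 K)) -palg_scalerAl -palg_scalerAr.
by rewrite scalerA -natrM -ghost2E.
Qed.

Lemma L16E : 16 *: Lbar K = cl (- 4 * (t Xm2 * t Xp2)
  - 2 * (H - 2) * (t Xm1 * t Xp1) - t X0 * t X0 + (H - 1) * (H - 1)).
Proof.
rewrite -[Lbar K]/(cl ghost2) -clZ ghost2_16.
rewrite (ghost2_identity y1_0m y2_0m y21_mm y12_pm y21_pp y21_0m y12_0m y21_00 y12_p0).
rewrite -!UXE -/(UH K).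
have -> : t Xm2 = a * a - c * c by rewrite UTE y1_m2 // y2_m2.
have -> : t Xp2 = e * e - b * b by rewrite UTE y1_p2 // y2_p2 // opprK addrC.
rewrite !UTE !mulrA.
exact: (cl_eq char0 (add3K _ _ _)).
Qed.

Lemma Hinv_UH1 : Hi 1 * (H - 1) = 1. Proof. exact: (HinvK K 1). Qed.
Lemma UH2_Hinv : (H - 2) * Hi 2 = 1. Proof. exact: (HinvKr K 2). Qed.

Definition L16_f2 : DUG K := 4 * (H - 1) * Hi 2.
Definition L16_f1 : DUG K := - (2 * (H - 2) + Hi 1).
Definition L16_f0 : DUG K := - (Hi 1 ^+ 2).
Definition L16_g : DUG K := (H - 1) ^+ 2.

Lemma L16_coef_identity (A : pzRingType) (x i j : A) :
  (x - 1) * i = 1 -> i * (x - 1) = 1 -> (x - 2) * j = 1 ->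
  [/\ 4 * (x - 1) * j + - (2 * (x - 2) + i) * (4 * j)
         + - (i ^+ 2) * (4 * (x - 1)) = - 4,
      - (2 * (x - 2) + i) - - (i ^+ 2) * (x - 1) = - 2 * (x - 2)
    & - (i ^+ 2) * ((x - 1) * (x - 1)) = - 1].
Proof.
move=> xi ix xj; rewrite expr2.
have e1 : i * i * (x - 1) = i by rewrite -mulrA ix mulr1.
have e2 : (x - 1) * j = 1 + j.
  have -> : (x - 1) * j = (x - 2) * j + j by ncring.
  by rewrite xj.
(* Partial fractions of 1 / ((x - 1) (x - 2)). *)
have e3 : i * j = j - i.
  have -> : j - i = (i * (x - 1)) * j - i * ((x - 2) * j).
    by rewrite ix xj mul1r mulr1.
  by ncring.
split.
- have -> : 4 * (x - 1) * j + - (2 * (x - 2) + i) * (4 * j)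
      + - (i * i) * (4 * (x - 1)) =
     4 * ((x - 1) * j) - 8 * ((x - 2) * j) - 4 * (i * j)
      - 4 * (i * i * (x - 1)) by ncring.
  by rewrite e1 e2 e3 xj; ncring.
- have -> : - (2 * (x - 2) + i) - - (i * i) * (x - 1) =
    - 2 * (x - 2) - i + i * i * (x - 1) by ncring.
  by rewrite e1; ncring.
- have -> : - (i * i) * ((x - 1) * (x - 1)) = - (i * i * (x - 1) * (x - 1)).
    by ncring.
  by rewrite e1 ix.
Qed.

Lemma hfunN f : hfun f -> hfun (- f).
Proof. by rewrite -scaleN1r; apply: hfunZ. Qed.
Lemma hfun_nat n : hfun n%:R.
Proof. by rewrite -scaler_nat; apply: hfun_scal. Qed.
Lemma hfunHn n : hfun (H - n%:R).
Proof. by apply: (hfunD hfunH); apply/hfunN/hfun_nat. Qed.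

Lemma L16_C2 : 16 *: Lbar K = C2 L16_f2 L16_f1 L16_f0 L16_g.
Proof.
have [e2 e1 e0] := L16_coef_identity UH1_Hinv Hinv_UH1 UH2_Hinv.
rewrite C2E; first last.
- exact/hfunN/hfunX/hfun_Hinv.
- apply/hfunN/hfunD; last exact: hfun_Hinv.
  by apply: (hfunM (hfun_nat 2)); apply: (hfunHn 2).
- apply: hfunM; last exact: hfun_Hinv.
  by apply: (hfunM (hfun_nat 4)); apply: (hfunHn 1).
rewrite /L16_f2 /L16_f1 /L16_f0 /L16_g e2 e1 e0 L16E expr2; congr cl.
by rewrite mulN1r !mulNr.
Qed.
End GhostClass.

(** * Anti-centrality *)

Lemma skew_pass (A : pzRingType) (x f g m y z v : A) :
  x * m = - (m * x) -> x * f = f * x -> f * m = m * g ->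
  x * (f * (m * y) * z) * v = m * (- g * x * y * z * v).
Proof.
move=> xm xf fm.
have -> : x * (f * (m * y) * z) * v = x * f * m * y * z * v by rewrite !mulrA.
have -> : x * f * m = - (f * m * x) by rewrite xf -mulrA xm mulrN mulrA.
by rewrite fm !mulNr mulrN !mulrA.
Qed.

Section Anticentral.
Variable K : fieldType.
Hypothesis char0 : [pchar K] =i pred0.

Local Notation m := (UX K Xm1).
Local Notation p := (UX K Xp1).
Local Notation H := (UH K).
Local Notation t := (UT K).
Local Notation Hi := (Hinv K).
Implicit Types (u v w f : DUG K).

Local Notation M := (16 *: ghost2 K).

(* The sign of the even ghost 16 L (x) L past an element of parity s. *)
Definition twists (s : bool) u := M * u = (-1) ^+ s *: (u * M).

Lemma twistsM r s u v : twists r u -> twists s v -> twists (r (+) s) (u * v).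
Proof.
rewrite /twists signr_addb; move: M => x eu ev.
rewrite mulrA eu -palg_scalerAl -[u * _ * v]mulrA ev -palg_scalerAr scalerA.
by rewrite mulrA.
Qed.

Lemma twists_linear s k u v : twists s u -> twists s v -> twists s (k *: u + v).
Proof.
rewrite /twists; move: M => x eu ev.
rewrite mulrDr mulrDl -palg_scalerAr -palg_scalerAl.
by rewrite eu ev scalerDr !scalerA mulrC.
Qed.

Lemma twists1 : twists false 1.
Proof. by rewrite /twists scale1r mulr1 mul1r. Qed.

Lemma twists0 s : twists s 0.
Proof. by rewrite /twists mulr0 mul0r scaler0. Qed.

Lemma swap_neg (A : pzRingType) (x y z : A) :
  x * z = - (z * x) -> y * z = z * y -> x * y * z = - (z * (x * y)).
Proof. by move=> e1 e2; rewrite -mulrA e2 mulrA e1 mulNr mulrA. Qed.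
Lemma swap_neg' (A : pzRingType) (x y z : A) :
  x * z = z * x -> y * z = - (z * y) -> x * y * z = - (z * (x * y)).
Proof. by move=> e1 e2; rewrite -mulrA e2 mulrN mulrA e1 mulrA. Qed.

Lemma oppr_sym (V : zmodType) (x y : V) : x = - y -> y = - x.
Proof. by move=> ->; rewrite opprK. Qed.

Lemma twists_a : twists true (y1 K Xm1).
Proof.
rewrite /twists expr1 scaleN1r (ghost2_16 char0); apply: swap_neg.
  exact: (ghost_anticomm_a (y1_pm K) (y1_0m K)).
exact: (ghost_comm_c (oppr_sym (y21_mm K)) (y21_pm K) (y21_0m K)).
Qed.
Lemma twists_b : twists true (y1 K Xp1).
Proof.
rewrite /twists expr1 scaleN1r (ghost2_16 char0); apply: swap_neg.
  exact: (ghost_anticomm_b (y1_pm K) (y1_p0 K)).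
exact: (ghost_comm_e (y12_pm K) (oppr_sym (y21_pp K)) (y12_p0 K)).
Qed.
Lemma twists_c : twists true (y2 K Xm1).
Proof.
rewrite /twists expr1 scaleN1r (ghost2_16 char0); apply: swap_neg'.
  exact: (ghost_comm_c (y21_mm K) (y12_pm K) (y12_0m K)).
exact: (ghost_anticomm_a (y2_pm K) (y2_0m K)).
Qed.
Lemma twists_e : twists true (y2 K Xp1).
Proof.
rewrite /twists expr1 scaleN1r (ghost2_16 char0); apply: swap_neg'.
  exact: (ghost_comm_e (y21_pm K) (y21_pp K) (y21_p0 K)).
exact: (ghost_anticomm_b (y2_pm K) (y2_p0 K)).
Qed.

Lemma twistsZ s k u : twists s u -> twists s (k *: u).
Proof. by move=> hu; rewrite -[_ *: u]addr0; apply/twists_linear/twists0. Qed.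
Lemma twistsD s u v : twists s u -> twists s v -> twists s (u + v).
Proof. by move=> hu hv; rewrite -[u]scale1r; apply: twists_linear. Qed.
Lemma twistsN s u : twists s u -> twists s (- u).
Proof. by rewrite -scaleN1r; apply: twistsZ. Qed.

Lemma y1_0E : y1 K X0 = y1 K Xp1 * y1 K Xm1 + y1 K Xm1 * y1 K Xp1.
Proof. by rewrite (y1_pm K) addrAC addNr add0r. Qed.
Lemma y2_0E : y2 K X0 = y2 K Xp1 * y2 K Xm1 + y2 K Xm1 * y2 K Xp1.
Proof. by rewrite (y2_pm K) addrAC addNr add0r. Qed.

Lemma twists_y1 b : twists (ospb_odd b) (y1 K b).
Proof.
case: b; [| exact: twists_a | | exact: twists_b |].
- by rewrite y1_m2 //; apply: (twistsM twists_a twists_a).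
- rewrite y1_0E; apply: twistsD.
    exact: (twistsM twists_b twists_a).
  exact: (twistsM twists_a twists_b).
- by rewrite y1_p2 //; apply: twistsN; apply: (twistsM twists_b twists_b).
Qed.
Lemma twists_y2 b : twists (ospb_odd b) (y2 K b).
Proof.
case: b; [| exact: twists_c | | exact: twists_e |].
- by rewrite y2_m2 //; apply: (twistsM twists_c twists_c).
- rewrite y2_0E; apply: twistsD.
    exact: (twistsM twists_e twists_c).
  exact: (twistsM twists_c twists_e).
- by rewrite y2_p2 //; apply: twistsN; apply: (twistsM twists_e twists_e).
Qed.

Lemma in1D x y : in1 (x + y) = in1 x + in1 y :> DUG K.
Proof. by rewrite -[x]scale1r in1_linear !scale1r. Qed.
Lemma in2D x y : in2 (x + y) = in2 x + in2 y :> DUG K.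
Proof. by rewrite -[x]scale1r in2_linear !scale1r. Qed.

Lemma in1E (x : osp12 K) : in1 x = \sum_a (x a : K) *: y1 K a.
Proof.
rewrite {1}(osp_eE x) (big_morph _ in1D (in10 K)); apply: eq_bigr => a _.
exact: in1Z.
Qed.
Lemma in2E (x : osp12 K) : in2 x = \sum_a (x a : K) *: y2 K a.
Proof.
rewrite {1}(osp_eE x) (big_morph _ in2D (in20 K)); apply: eq_bigr => a _.
exact: in2Z.
Qed.

Lemma twists_in s (x : GG K) : shom s x -> twists s (loc_in (@Dset K) (uea_in x)).
Proof.
case: x => x y [/= hx hy]; rewrite in_pair in1E in2E; apply: twistsD.
  apply: big_ind => [||a _]; [exact: twists0 | exact: twistsD |].
  have [<-|na] := eqVneq (ospb_odd a) s; first exact/twistsZ/twists_y1.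
  by rewrite hx // scale0r; apply: twists0.
apply: big_ind => [||a _]; [exact: twists0 | exact: twistsD |].
have [<-|na] := eqVneq (ospb_odd a) s; first exact/twistsZ/twists_y2.
by rewrite hy // scale0r; apply: twists0.
Qed.

Lemma twists_H : twists false H.
Proof.
by rewrite [H]UXE; apply: twistsD; [apply: (twists_y1 X0) | apply: (twists_y2 X0)].
Qed.

Lemma twists_Hinv n : twists false (Hi n).
Proof.
have e : M * H = H * M by have := twists_H; rewrite /twists scale1r.
rewrite /twists scale1r; apply: (swap_inv (HinvKr K n) (HinvK K n)).
by rewrite mulrBl mulrBr e mulrzl mulrzr.
Qed.

Lemma DUG_hom_twists s u : DUG_hom s u -> twists s u.
Proof.
elim=> {s u} [s u hu|d Dd|s k u v _ hu _ hv|r s u v _ hu _ hv].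
- elim: s u / hu => [s x|| s k u v _ hu _ hv|r s u v _ hu _ hv].
  + exact: twists_in.
  + by rewrite loc_in1; apply: twists1.
  + by rewrite loc_in_linear; apply: twists_linear.
  + by rewrite loc_inM; apply: twistsM.
- apply: (@loc_inv_ind _ (twists false)); first exact: twists1.
    exact: twists_Hinv.
  by move=> u v hu hv; apply: (twistsM hu hv).
- exact: twists_linear.
- exact: twistsM.
Qed.

Lemma ghost2_Xm1 : M * m = - (m * M).
Proof.
have := twistsD (twists_y1 Xm1) (twists_y2 Xm1).
by rewrite -UXE /twists /= expr1 scaleN1r.
Qed.
Lemma ghost2_Xp1 : M * p = - (p * M).
Proof.
have := twistsD (twists_y1 Xp1) (twists_y2 Xp1).
by rewrite -UXE /twists /= expr1 scaleN1r.
Qed.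

Lemma twists_phis k (n : nat) : twists false (phis K k n).
Proof.
elim: n => [|n IH] /=; first exact: twists1.
case: odd; first exact: twistsZ.
by apply: (twistsM (r := false) (s := false)) => //; apply/twistsN/twists_Hinv.
Qed.

(** Since p M = - M p already lies in U p, only the term n = 0 survives. *)
Lemma dia_ghost2r v : dia (cl v) (cl M) = cl (v * M).
Proof.
rewrite (@diaE _ char0 _ _ 1 (- M)); first by rewrite /Psum big_ord1 /= !expr0 !mulr1.
by rewrite expr1 mulNr ghost2_Xp1 opprK.
Qed.

(* M passes phi_n(H) m ^+ n up to sign, so the terms n > 0 start with m. *)
Lemma dia_ghost2l v : dia (cl M) (cl v) = cl (M * v).
Proof.
have [N [w e]] := @absorbs_all _ char0 v 1.
have [w' e'] := absorbs_ge e (leqnSn N).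
rewrite (diaE char0 _ e') {e e' w w'}.
elim: N => [|N IH]; first by rewrite /Psum big_ord1 /= !expr0 !mulr1.
rewrite /Psum big_ord_recr -/(Psum K N.+1) mulrDr mulrDl clD IH /=.
rewrite -/(phis K 0 N.+1); set f := phis K 0 N.+1.
have -> : M * (f * m ^+ N.+1 * p ^+ N.+1) * v =
          m * (- phis K (0 + 1) N.+1 * M * m ^+ N * p ^+ N.+1 * v).
  have ef : M * f = f * M by have := twists_phis 0 N.+1; rewrite /twists scale1r.
  have em : f * m = m * phis K (0 + 1) N.+1 by rewrite /f phis_Xm1.
  by rewrite exprS; apply: skew_pass ghost2_Xm1 ef em.
by rewrite cl_m // addr0.
Qed.

Lemma DUG_hom0 s : DUG_hom s (0 : DUG K).
Proof.
rewrite -(loc_in0 (@Dset K)); apply: DUG_hom_in; rewrite -uea_in0.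
exact/uea_hom_in/lie_shom0.
Qed.

Lemma DUG_homZ s k u : DUG_hom s u -> DUG_hom s (k *: u).
Proof.
by move=> hu; rewrite -[_ *: u]addr0; apply: DUG_hom_linear => //; apply: DUG_hom0.
Qed.
Lemma DUG_homD s u v : DUG_hom s u -> DUG_hom s v -> DUG_hom s (u + v).
Proof. by move=> hu hv; rewrite -[u]scale1r; apply: DUG_hom_linear. Qed.

Lemma DUG_hom_y1 b : DUG_hom (ospb_odd b) (y1 K b).
Proof.
apply/DUG_hom_in/uea_hom_in; split; first exact: shom_osp_e.
exact: lie_shom0.
Qed.
Lemma DUG_hom_y2 b : DUG_hom (ospb_odd b) (y2 K b).
Proof.
apply/DUG_hom_in/uea_hom_in; split; last exact: shom_osp_e.
exact: lie_shom0.
Qed.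

Lemma DUG_hom1 : DUG_hom false (1 : DUG K).
Proof. by rewrite -(loc_in1 (@Dset K)); apply/DUG_hom_in/uea_hom1. Qed.

Lemma DUG_hom_ghost2 : DUG_hom false M.
Proof.
apply: DUG_homZ; rewrite ghost2E; apply: (@DUG_homM _ false false).
  rewrite /ghost1 -scaleN1r; apply: DUG_homD; last exact/DUG_homZ/DUG_hom1.
  apply: DUG_homD; first exact: (DUG_homM (DUG_hom_y1 Xm1) (DUG_hom_y1 Xp1)).
  exact/DUG_homZ/DUG_homZ/(DUG_hom_y1 X0).
rewrite /ghost1 -scaleN1r; apply: DUG_homD; last exact/DUG_homZ/DUG_hom1.
apply: DUG_homD; first exact: (DUG_homM (DUG_hom_y2 Xm1) (DUG_hom_y2 Xp1)).
exact/DUG_homZ/DUG_homZ/(DUG_hom_y2 X0).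
Qed.

Lemma L16_anticentral : anticentral (16 *: Lbar K).
Proof.
rewrite -[Lbar K]/(cl (ghost2 K)) -clZ; split.
- by exists M => //; apply: DUG_hom_ghost2.
- move=> _ [u hu ->]; rewrite dia_ghost2l dia_ghost2r.
  by have := DUG_hom_twists hu; rewrite /twists scale1r => ->.
- move=> _ [u hu ->]; rewrite dia_ghost2l dia_ghost2r -clN //.
  by have := DUG_hom_twists hu; rewrite /twists expr1 scaleN1r => ->.
Qed.

End Anticentral.

(** * Rational functions of H *)

Section PolyH.
Variable K : fieldType.
Hypothesis char0 : [pchar K] =i pred0.
Local Notation H := (UH K).
Local Notation Hi := (Hinv K).
Implicit Types (q r : {poly K}) (f : DUG K).

(** Evaluation at H, written exactly as in [DUh] so that membership there is immediate. *)
Definition hev q : DUG K := \sum_(i < size q) q`_i *: H ^+ i.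

Lemma hev_wide q n : (size q <= n)%N -> hev q = \sum_(i < n) q`_i *: H ^+ i.
Proof.
move=> le; rewrite /hev (big_ord_widen_cond _ xpredT (fun i => q`_i *: H ^+ i) le).
rewrite [RHS](bigID (fun i : 'I_n => (i < size q)%N)) /=.
rewrite [X in _ + X]big1 ?addr0 // => i.
by rewrite -leqNgt => h; rewrite nth_default // scale0r.
Qed.

Lemma hevD q r : hev (q + r) = hev q + hev r.
Proof.
set n := maxn (size q) (size r).
rewrite (@hev_wide (q + r) n) ?size_polyD // (@hev_wide q n) ?leq_maxl //.
rewrite (@hev_wide r n) ?leq_maxr // -big_split; apply: eq_bigr => i _ /=.
by rewrite coefD scalerDl.
Qed.

Lemma hev0 : hev 0 = 0.
Proof. by rewrite /hev size_poly0 big_ord0. Qed.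

Lemma hevZ k q : hev (k *: q) = k *: hev q.
Proof.
rewrite (@hev_wide (k *: q) (size q)) ?size_scale_leq // scaler_sumr.
by apply: eq_bigr => i _; rewrite coefZ scalerA.
Qed.

Lemma hev1 : hev 1 = 1.
Proof.
by rewrite (@hev_wide 1 1) ?size_poly1 // big_ord1 coef1 scale1r expr0.
Qed.

Lemma hevC k : hev k%:P = k *: (1 : DUG K).
Proof. by rewrite -[k%:P]mulr1 mul_polyC hevZ hev1. Qed.

Lemma hevMX q : hev (q * 'X) = hev q * H.
Proof.
rewrite (@hev_wide _ (size q).+1).
  rewrite big_ord_recl coefMX scale0r add0r /hev mulr_suml.
  by apply: eq_bigr => i _; rewrite coefMX /= -palg_scalerAl exprSr.
by rewrite (leq_trans (size_polyMleq _ _)) // size_polyX addn2.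
Qed.

Lemma hevX : hev 'X = H.
Proof. by rewrite -['X]mul1r hevMX hev1 mul1r. Qed.

Lemma hevM q r : hev (q * r) = hev q * hev r.
Proof.
elim/poly_ind: r q => [|r c IH] q; first by rewrite !(mulr0, hev0).
rewrite mulrDr mulrA !hevD !hevMX IH hevC mulrDr mulrA [q * _]mulrC mul_polyC hevZ.
by congr (_ + _); rewrite -palg_scalerAr mulr1.
Qed.

Lemma hevN q : hev (- q) = - hev q.
Proof. by rewrite -scaleN1r hevZ scaleN1r. Qed.

Lemma hev_nat n : hev n%:R = n%:R.
Proof. by rewrite -scaler_nat hevZ hev1 scaler_nat. Qed.

Lemma hev_sub n : hev ('X - n%:~R) = H - n%:~R.
Proof.
by rewrite hevD hevN hevX -[n%:~R in LHS]scaler_int hevZ hev1 scaler_int.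
Qed.

Lemma hev_comm q r : hev q * hev r = hev r * hev q.
Proof. by rewrite -!hevM mulrC. Qed.

Lemma DUh_hev q d (Dd : Dset d) : DUh (hev q * loc_inv Dd).
Proof. by exists q, d, Dd. Qed.

(** The points of K at which no element of D vanishes. *)
Definition nonint (z : K) := forall n : int, z != n%:~R.

Lemma nonintD (z : K) n : nonint z -> nonint (z + n%:R).
Proof.
move=> hz i; rewrite -subr_eq0 -[n%:R]/(n%:Z%:~R) -addrA -rmorphB /=.
by rewrite addr_eq0 -mulrNz hz.
Qed.

(* f = P(H) / Q(H), without poles outside the integers *)
Definition fracH f P Q := [/\ f * hev Q = hev P,
  exists j, hev Q * j = 1 & forall z, nonint z -> Q.[z] != 0].

Lemma Dset_hev (d : UG K) : Dset d -> exists Q,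
  [/\ loc_in (@Dset K) d = hev Q, exists j, hev Q * j = 1
    & forall z, nonint z -> Q.[z] != 0].
Proof.
elim=> {d} [|n|d e _ [P [eP [i iP] hP]] _ [Q [eQ [j jQ] hQ]]].
- exists 1; rewrite loc_in1 hev1; split=> //; first by exists 1; rewrite mulr1.
  by move=> z _; rewrite hornerC oner_eq0.
- exists ('X - n%:~R); rewrite loc_in_subC hev_sub; split=> //.
    by exists (Hi n); apply: HinvKr.
  move=> z hz; rewrite hornerD hornerX hornerN -[n%:~R]scaler_int hornerZ hornerC mulr1.
  by rewrite subr_eq0.
- exists (P * Q); rewrite loc_inM eP eQ hevM; split=> //.
    by exists (j * i); rewrite mulrA -[_ * j]mulrA jQ mulr1.
  by move=> z hz; rewrite hornerM mulf_neq0 ?hP ?hQ.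
Qed.

Lemma DUh_frac f : DUh f -> exists P Q, fracH f P Q.
Proof.
move=> [P [d [Dd ->]]]; have [Q [eQ jQ hQ]] := Dset_hev Dd.
exists P, Q; split=> //.
by rewrite -mulrA -eQ loc_invl mulr1.
Qed.

Lemma fracH_eq f f' P P' Q Q' : fracH f P Q -> fracH f' P' Q' ->
  P * Q' = P' * Q -> f = f'.
Proof.
move=> [eP [j jQ] _] [eP' [j' jQ'] _] e.
have {}e : f * hev Q * hev Q' = f' * hev Q * hev Q'.
  by rewrite -[RHS]mulrA [hev Q * _]hev_comm mulrA eP eP' -!hevM e.
have := congr1 (fun x => x * j' * j) e.
by rewrite /= -!(mulrA _ (hev Q')) jQ' !mulr1 -!mulrA jQ !mulr1.
Qed.

Lemma loc_inv1 : loc_inv (@Dset1 K) = 1.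
Proof. by apply: (inv_uniq (loc_invl _)); rewrite mulr1 loc_in1. Qed.

Lemma loc_invMM d e (Dd : Dset d) (De : Dset e) :
  loc_inv (DsetM Dd De) = loc_inv De * loc_inv Dd :> DUG K.
Proof.
apply: (inv_uniq (loc_invl _)).
by rewrite loc_inM mulrA -[_ * _ * loc_inv De]mulrA loc_invr mulr1 loc_invr.
Qed.

Lemma L16_f2E : L16_f2 K = hev (4 * ('X - 1%:~R)) * Hi 2.
Proof. by rewrite hevM hev_sub hev_nat. Qed.

Lemma L16_f1E : L16_f1 K = hev (- (2 * ('X - 2%:~R) * ('X - 1%:~R) + 1)) * Hi 1.
Proof.
rewrite hevN hevD !hevM !hev_sub hev_nat hev1.
have aux (A : pzRingType) (x y i : A) : y * i = 1 ->
    - (2 * x + i) = - (2 * x * y + 1) * i.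
  by move=> yi; rewrite mulNr [(_ + 1) * i]mulrDl mul1r -[_ * y * i]mulrA yi mulr1.
exact: aux (HinvKr K 1).
Qed.

Lemma L16_f0E : L16_f0 K = hev (- 1) * (Hi 1 * Hi 1).
Proof. by rewrite hevN hev1 mulN1r. Qed.

Lemma L16_gE : L16_g K = hev (('X - 1%:~R) ^+ 2).
Proof. by rewrite !expr2 hevM hev_sub. Qed.

Lemma L16_form : has_C2_form (16 *: Lbar K).
Proof.
exists (L16_f2 K), (L16_f1 K), (L16_f0 K), (L16_g K); split; last exact: L16_C2.
- by rewrite L16_f2E; apply: DUh_hev.
- by rewrite L16_f1E; apply: DUh_hev.
- by rewrite L16_f0E -(loc_invMM (Dset_gen K 1) (Dset_gen K 1)); apply: DUh_hev.
- by rewrite L16_gE -[hev _]mulr1 -loc_inv1; apply: DUh_hev.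
Qed.

End PolyH.

(** * A representation on products of Verma modules *)

Section Endomorphisms.
Variables (K : fieldType) (V : lmodType K).

(** Target of the representation: linear maps form a ring under composition, in which noncommutative
    identities can be normalized. *)
Record endo := Endo {
  efun :> V -> V;
  _ : forall k x y, efun (k *: x + y) = k *: efun x + efun y
}.

Lemma endo_linear (f : endo) k x y : f (k *: x + y) = k *: f x + f y.
Proof. by case: f. Qed.
Lemma endoP (f g : endo) : (forall x, f x = g x) -> f = g.
Proof.
case: f g => [f hf] [g hg] /= /funext e; case: _ / e in hg *.
by congr Endo; apply: Prop_irrelevance.
Qed.
Lemma endo0 (f : endo) : f 0 = 0.
Proof.
by have := endo_linear f (-1) 0 0; rewrite scaler0 addr0 scaleN1r addNr.
Qed.
Lemma endoZ (f : endo) k x : f (k *: x) = k *: f x.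
Proof. by rewrite -[k *: x]addr0 endo_linear endo0 addr0. Qed.
Lemma endoD (f : endo) x y : f (x + y) = f x + f y.
Proof. by rewrite -[x]scale1r endo_linear !scale1r. Qed.

Definition endo_0 : endo.
Proof. by exists (fun=> 0) => k x y; rewrite scaler0 addr0. Defined.
Definition endo_1 : endo. Proof. by exists id. Defined.
Definition endo_opp (f : endo) : endo.
Proof. by exists (fun x => - f x) => k x y; rewrite endo_linear opprD scalerN. Defined.
Definition endo_add (f g : endo) : endo.
Proof.
by exists (fun x => f x + g x) => k x y; rewrite !endo_linear scalerDr addrACA.
Defined.
Definition endo_mul (f g : endo) : endo.
Proof. by exists (fun x => f (g x)) => k x y; rewrite !endo_linear. Defined.
Definition endo_scale (k : K) (f : endo) : endo.
Proof.
exists (fun x => k *: f x) => j x y.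
by rewrite !endo_linear scalerDr !scalerA mulrC.
Defined.

HB.instance Definition _ := gen_eqMixin endo.
HB.instance Definition _ := gen_choiceMixin endo.

Fact endo_addA : associative endo_add.
Proof. by move=> f g h; apply: endoP => x; apply: addrA. Qed.
Fact endo_addC : commutative endo_add.
Proof. by move=> f g; apply: endoP => x; apply: addrC. Qed.
Fact endo_add0 : left_id endo_0 endo_add.
Proof. by move=> f; apply: endoP => x; apply: add0r. Qed.
Fact endo_addN : left_inverse endo_0 endo_opp endo_add.
Proof. by move=> f; apply: endoP => x; apply: addNr. Qed.
HB.instance Definition _ := GRing.isZmodule.Build endo
  endo_addA endo_addC endo_add0 endo_addN.

Fact endo_mulA : associative endo_mul.
Proof. by move=> f g h; apply: endoP. Qed.
Fact endo_mul1 : left_id endo_1 endo_mul.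
Proof. by move=> f; apply: endoP. Qed.
Fact endo_mulr1 : right_id endo_1 endo_mul.
Proof. by move=> f; apply: endoP. Qed.
Fact endo_mulDl : left_distributive endo_mul endo_add.
Proof. by move=> f g h; apply: endoP. Qed.
Fact endo_mulDr : right_distributive endo_mul endo_add.
Proof. by move=> f g h; apply: endoP => x; apply: endoD. Qed.
HB.instance Definition _ := GRing.Zmodule_isPzRing.Build endo
  endo_mulA endo_mul1 endo_mulr1 endo_mulDl endo_mulDr.

Fact endo_scaleA a b f : endo_scale a (endo_scale b f) = endo_scale (a * b) f.
Proof. by apply: endoP => x; apply: scalerA. Qed.
Fact endo_scale1 : left_id 1 endo_scale.
Proof. by move=> f; apply: endoP => x; apply: scale1r. Qed.
Fact endo_scaleDr : right_distributive endo_scale +%R.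
Proof. by move=> k f g; apply: endoP => x; apply: scalerDr. Qed.
Fact endo_scaleDl f : {morph endo_scale^~ f : a b / a + b}.
Proof. by move=> a b; apply: endoP => x; apply: scalerDl. Qed.
HB.instance Definition _ := GRing.Zmodule_isLmodule.Build K endo
  endo_scaleA endo_scale1 endo_scaleDr endo_scaleDl.

Fact endo_scalerAl k (f g : endo) : k *: (f * g) = (k *: f) * g.
Proof. exact: endoP. Qed.
Fact endo_scalerAr k (f g : endo) : k *: (f * g) = f * (k *: g).
Proof. by apply: endoP => x; apply/esym/endoZ. Qed.

Lemma endo_addE (f g : endo) x : (f + g) x = f x + g x. Proof. by []. Qed.
Lemma endo_oppE (f : endo) x : (- f) x = - f x. Proof. by []. Qed.
Lemma endo_mulE (f g : endo) x : (f * g) x = f (g x). Proof. by []. Qed.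
Lemma endo_scaleE k (f : endo) x : (k *: f) x = k *: f x. Proof. by []. Qed.
End Endomorphisms.

(** * Representations of presented algebras and of their localizations *)

Section Eval.
Variables (K : fieldType) (V : lmodType K) (X : Type).
Variables (rel : aterm K X -> aterm K X -> Prop) (f : X -> endo V).

(** Counterpart of [aeval], whose values lie in a presented algebra, for values in endomorphisms. *)
Fixpoint teval (t : aterm K X) : endo V :=
  match t with
  | Gen x => f x
  | Cst a => a *: (1 : endo V)
  | Add s t => teval s + teval t
  | Mul s t => teval s * teval t
  end.

Hypothesis relf : forall s t, rel s t -> teval s = teval t.

Lemma teval_cong s t : acong rel s t -> teval s = teval t.
Proof.
elim=> {s t} /=.
- exact: relf.
- by [].
- by move=> s t _ ->.
- by move=> s t u _ -> _ ->.
- by move=> s s' t t' _ -> _ ->.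
- by move=> s s' t t' _ -> _ ->.
- by move=> s t u; rewrite addrA.
- by move=> s t; rewrite addrC.
- by move=> s; rewrite scale0r add0r.
- by move=> s t u; rewrite mulrA.
- by move=> s; rewrite scale0r mul0r.
- by move=> s; rewrite scale1r mul1r.
- by move=> s t u; rewrite mulrDl.
- by move=> s t u; rewrite mulrDr.
- by move=> a b; rewrite scalerDl.
- by move=> a b; rewrite -endo_scalerAl mul1r scalerA.
- by move=> a s; rewrite -endo_scalerAl -endo_scalerAr mul1r mulr1.
Qed.

Definition palg_rep (u : palg rel) : endo V := teval (repr u).

Lemma palg_rep_pi t : palg_rep (\pi_(palg rel)%qT t) = teval t.
Proof. exact/teval_cong/palg_repr. Qed.
Lemma palg_rep_gen x : palg_rep (palg_gen rel x) = f x.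
Proof. exact: palg_rep_pi. Qed.
Lemma palg_rep1 : palg_rep 1 = 1.
Proof. by rewrite [LHS]palg_rep_pi /= scale1r. Qed.
Lemma palg_repD u v : palg_rep (u + v) = palg_rep u + palg_rep v.
Proof. by rewrite [LHS]palg_rep_pi. Qed.
Lemma palg_repM u v : palg_rep (u * v) = palg_rep u * palg_rep v.
Proof. by rewrite [LHS]palg_rep_pi. Qed.
Lemma palg_repZ a u : palg_rep (a *: u) = a *: palg_rep u.
Proof.
rewrite [a *: u]/(palg_cst rel a * u) palg_repM [palg_rep (palg_cst _ _)]palg_rep_pi.
by rewrite /= -endo_scalerAl mul1r.
Qed.
End Eval.

Section LocEval.
Variables (K : fieldType) (V : lmodType K) (X : Type).
Variables (rel : aterm K X -> aterm K X -> Prop) (S : palg rel -> Prop).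
Variable r : palg rel -> endo V.
Hypotheses (r1 : r 1 = 1) (rL : forall k u v, r (k *: u + v) = k *: r u + r v)
  (rM : forall u v, r (u * v) = r u * r v).
Hypothesis r_inv : forall s, S s -> exists j, j * r s = 1 /\ r s * j = 1.

(** Universal property of the localization: the formal inverse of s goes to an inverse picked by
    choice, the only one possible since it is two-sided. *)
Definition locf (x : palg rel + {s : palg rel | S s}) : endo V :=
  match x with inl u => r u | inr s => sval (cid (r_inv (svalP s))) end.

Lemma locfP s t : loc_rel s t -> teval locf s = teval locf t.
Proof.
case=> [k u v|u v||s'|s'] /=.
- by rewrite rL -endo_scalerAl mul1r.
- exact: rM.
- by rewrite r1 scale1r.
- by case: cid => j [/= e _]; rewrite e scale1r.
- by case: cid => j [/= _ e]; rewrite e scale1r.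
Qed.
End LocEval.

(** * Actions of osp(1|2) built from two odd operators *)

Section OspRep.
Variables (K : fieldType) (V : lmodType K) (a b : endo V).
Let h : endo V := b * a + a * b.
Hypotheses (ha : h * a = a * h + a) (bh : b * h = h * b + b).

Definition osp_op (x : ospb) : endo V :=
  match x with
  | Xm2 => a * a | Xm1 => a | X0 => h | Xp1 => b | Xp2 => - (b * b)
  end.
Definition osp_act (x : osp12 K) : endo V := \sum_c (x c : K) *: osp_op c.

Lemma osp_act_linear k x y : osp_act (k *: x + y) = k *: osp_act x + osp_act y.
Proof.
rewrite /osp_act scaler_sumr -big_split; apply: eq_bigr => c _ /=.
by rewrite !ffunE scalerDl scalerA.
Qed.

Lemma osp_act_e c : osp_act (osp_e K c) = osp_op c.
Proof.
rewrite /osp_act (bigD1 c) //= ffunE eqxx scale1r big1 ?addr0 // => d /negPf dc.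
by rewrite ffunE dc scale0r.
Qed.

Lemma osp_act0 : osp_act 0 = 0.
Proof. by rewrite /osp_act big1 // => c _; rewrite ffunE scale0r. Qed.
Lemma osp_actZ k x : osp_act (k *: x) = k *: osp_act x.
Proof. by rewrite -[k *: x]addr0 osp_act_linear osp_act0 addr0. Qed.
Lemma osp_actN x : osp_act (- x) = - osp_act x.
Proof. by rewrite -!scaleN1r osp_actZ. Qed.

(** As osp(1|2) is generated by its odd part, [ha] and [bh] imply all 25 brackets, with h the
    anticommutator of a and b. The facts [e1] to [e5] treat the squares. *)
Lemma osp_op_br x y : osp_op x * osp_op y =
  (-1) ^+ (ospb_odd x && ospb_odd y) *: (osp_op y * osp_op x)
  + osp_act (osp_brb K x y).
Proof.
have hE : b * a + a * b = h by [].
have ba : b * a = h - a * b by rewrite -hE addrK.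
have ah : a * h = h * a - a by rewrite ha addrK.
have e1 : h * (a * a) = a * a * h + (a * a + a * a).
  by rewrite mulrA ha mulrDl -[a * h * a]mulrA ha; ncring.
have e2 : b * b * h = h * (b * b) + (b * b + b * b).
  by rewrite -mulrA bh mulrDr [b * (h * b)]mulrA bh; ncring.
have e3 : b * (a * a) = a * a * b + a.
  have -> : b * (a * a) = (b * a) * a by ncring.
  by rewrite ba mulrBl -[a * b * a]mulrA ba mulrBr ah; ncring.
have e4 : b * b * a = a * (b * b) + b.
  have -> : b * b * a = b * (b * a) by ncring.
  by rewrite ba mulrBr bh [b * (a * b)]mulrA ba; ncring.
have e5 : b * b * (a * a) = a * a * (b * b) + h.
  have -> : b * b * (a * a) = b * (b * (a * a)) by ncring.
  rewrite e3 mulrDr ba mulrA e3.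
  have -> : (a * a * b + a) * b = a * a * (b * b) + a * b by ncring.
  by ncring.
case: x; case: y; rewrite /= ?expr1 ?expr0 ?scaleN1r ?scale1r
  ?(osp_actN, osp_actZ, osp_act_e, osp_act0) /= ?scaler_nat ?mulr2n -/h.
all: rewrite ?mulNr ?mulrN ?(e1, e2, e3, e4, e5, ha, bh, ba) ?addr0; by [|ncring].
Qed.
End OspRep.

Section PairRep.
Variables (K : fieldType) (V : lmodType K) (a b c e : endo V).
Let h : endo V := b * a + a * b.
Let k : endo V := e * c + c * e.
Hypotheses (ha : h * a = a * h + a) (bh : b * h = h * b + b).
Hypotheses (kc : k * c = c * k + c) (ek : e * k = k * e + e).
Hypotheses (ca : c * a = - (a * c)) (ea : e * a = - (a * e))
  (cb : c * b = - (b * c)) (eb : e * b = - (b * e)).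

(** The sign rule passes to products and sums, so it suffices to know it for a, b against c, e. *)
Lemma osp_op_comm x y : osp_op c e y * osp_op a b x =
  (-1) ^+ (ospb_odd x && ospb_odd y) *: (osp_op a b x * osp_op c e y).
Proof.
have push (s : bool) (u v w : endo V) : u * v = (-1) ^+ s *: (v * u) ->
    forall s' : bool, u * w = (-1) ^+ s' *: (w * u) ->
    u * (v * w) = (-1) ^+ (s (+) s') *: (v * w * u).
  move=> e1 s' e2; rewrite mulrA e1 -endo_scalerAl -mulrA e2 -endo_scalerAr scalerA.
  by rewrite mulrA signr_addb.
have neg (u v : endo V) : u * v = - (v * u) -> u * v = (-1) ^+ true *: (v * u).
  by move=> ->; rewrite expr1 scaleN1r.
have sym (s : bool) (u v : endo V) : u * v = (-1) ^+ s *: (v * u) ->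
    v * u = (-1) ^+ s *: (u * v).
  by move=> ->; rewrite scalerA -expr2 sqrr_sign scale1r.
have add (s : bool) (u v w : endo V) : u * v = (-1) ^+ s *: (v * u) ->
    u * w = (-1) ^+ s *: (w * u) -> u * (v + w) = (-1) ^+ s *: ((v + w) * u).
  by move=> e1 e2; rewrite mulrDr mulrDl e1 e2 scalerDr.
have opp (s : bool) (u v : endo V) : u * v = (-1) ^+ s *: (v * u) ->
    u * - v = (-1) ^+ s *: (- v * u).
  by move=> e1; rewrite mulrN mulNr e1 scalerN.
have gen (u : endo V) : u * a = - (a * u) -> u * b = - (b * u) -> forall x',
    u * osp_op a b x' = (-1) ^+ (ospb_odd x') *: (osp_op a b x' * u).
  move=> /neg ua /neg ub; case=> //=.
  - exact: (push true _ _ _ ua true).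
  - by apply: (add false);
      [apply: (push true _ _ _ ub true) | apply: (push true _ _ _ ua true)].
  - by apply: (opp false); apply: (push true _ _ _ ub true).
have gc := sym _ _ _ (gen c ca cb x); have ge := sym _ _ _ (gen e ea eb x).
apply: sym; case: y => /=; rewrite ?andbF ?andbT //.
- by rewrite -(addbb (ospb_odd x)); apply: push.
- by rewrite -(addbb (ospb_odd x)); apply: add; apply: push.
- by rewrite -(addbb (ospb_odd x)); apply: opp; apply: push.
Qed.

Definition gg_act (x : GG K) : endo V := osp_act a b x.1 + osp_act c e x.2.

Lemma gg_act_linear j x y : gg_act (j *: x + y) = j *: gg_act x + gg_act y.
Proof. by rewrite /gg_act /= !osp_act_linear scalerDr addrACA. Qed.

(** Basis vectors of the wrong parity have coefficient 0 in x and in y, so all remaining terms carry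
    the same sign. *)
Lemma act_br (O O' : ospb -> endo V) (E : ospb -> ospb -> endo V) p q
    (x y : osp12 K) :
  (forall i j, O i * O' j =
     (-1) ^+ (ospb_odd i && ospb_odd j) *: (O' j * O i) + E i j) ->
  shom p x -> shom q y ->
  (\sum_i (x i : K) *: O i) * (\sum_j (y j : K) *: O' j) =
  (-1) ^+ (p && q) *: ((\sum_j (y j : K) *: O' j) * (\sum_i (x i : K) *: O i))
  + \sum_i \sum_j (x i * y j : K) *: E i j.
Proof.
move=> br hx hy.
rewrite mulr_suml [in X in _ = _ *: X + _]mulr_sumr scaler_sumr -big_split.
apply: eq_bigr => i _ /=.
rewrite mulr_sumr mulr_suml scaler_sumr -big_split; apply: eq_bigr => j _ /=.
rewrite -!endo_scalerAl -!endo_scalerAr br !scalerDr !scalerA.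
congr (_ *: _ + _).
have [ei|ni] := eqVneq (ospb_odd i) p; last by rewrite hx // !(mul0r, mulr0).
have [ej|nj] := eqVneq (ospb_odd j) q; last by rewrite hy // !(mul0r, mulr0).
by rewrite ei ej mulrC mulrA mulrAC.
Qed.

Lemma gg_act_br p q (x y : GG K) : shom p x -> shom q y ->
  gg_act x * gg_act y = (-1) ^+ (p && q) *: (gg_act y * gg_act x) + gg_act (sbr x y).
Proof.
have sumE (a' b' : endo V) (u v : osp12 K) :
    \sum_i \sum_j (u i * v j : K) *: osp_act a' b' (osp_brb K i j)
    = osp_act a' b' (sbr u v).
  rewrite [sbr u v]/(osp_sbr u v) /osp_sbr.
  have D : {morph osp_act a' b' : z w / z + w}.
    by move=> z w; rewrite -[z]scale1r osp_act_linear !scale1r.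
  rewrite (big_morph _ D (osp_act0 a' b')); apply: eq_bigr => i _.
  rewrite (big_morph _ D (osp_act0 a' b')); apply: eq_bigr => j _.
  by rewrite osp_actZ.
case: x y => [x x'] [y y'] [/= hx hx'] [/= hy hy'].
have cross i j : osp_op c e i * osp_op a b j = (-1) ^+ (ospb_odd i && ospb_odd j) *:
    (osp_op a b j * osp_op c e i) + 0 by rewrite andbC addr0 osp_op_comm.
have zero (u v : osp12 K) : \sum_i \sum_j (u i * v j : K) *: (0 : endo V) = 0.
  by rewrite big1 // => i _; rewrite big1 // => j _; rewrite scaler0.
have e1 := act_br (osp_op_br ha bh) hx hy; rewrite sumE in e1.
have e2 := act_br (osp_op_br kc ek) hx' hy'; rewrite sumE in e2.
have e3 := act_br cross hx' hy; rewrite zero addr0 in e3.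
have e4 := act_br cross hy' hx; rewrite zero addr0 andbC in e4.
rewrite /gg_act /= !mulrDl !mulrDr.
rewrite -!/(osp_act a b _) -!/(osp_act c e _) in e1 e2 e3 e4.
rewrite e1 e2 e3 e4 !scalerDr scalerA -expr2 sqrr_sign scale1r.
by ncring.
Qed.
End PairRep.

(** * The completed tensor product of two Verma modules *)

Section Verma.
Variable K : fieldType.
Hypothesis char0 : [pchar K] =i pred0.
(** All functions are allowed, without a support condition: each coefficient of an image under [Va],
    [Vb], [Vc] or [Ve] depends on at most one coefficient of the argument. *)
Definition grid : lmodType K := (nat -> nat -> K^o)%type.
Implicit Types (g v : grid).

(* In the Verma module with basis e_i = x_-a^i e_0 and h e_0 = x e_0, one has
   x_a e_i = vcoef x i e_(i-1). *)
Fixpoint vcoef (x : K) (i : nat) : K :=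
  if i is i'.+1 then x + i'%:R - vcoef x i' else 0.

Lemma gridP g g' : (forall i j, g i j = g' i j) -> g = g'.
Proof. by move=> e; apply/funext => i; apply/funext => j. Qed.

Variables la mu : K.

(* Va, Vb (resp. Vc, Ve) are x_-a and x_a of the first (resp. second) factor of
   the completed tensor product of two Verma modules: g i j is the coefficient of
   e_i (x) e_j, and the sign (-1)^i comes from the parity of e_i. *)
Definition Va : endo grid.
Proof.
by exists (fun g i j => if i is i'.+1 then g i' j else 0) => k x y;
  apply: gridP => -[|i] j //=; rewrite -[RHS]/(k * 0 + 0) mulr0 addr0.
Defined.
Definition Vb : endo grid.
Proof.
exists (fun g i j => vcoef la i.+1 * g i.+1 j) => k x y; apply: gridP => i j.
by rewrite -[RHS]/(k * (_ * _) + _ * _) -[X in _ * X = _]/(k * _ + _) mulrDr mulrCA.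
Defined.
Definition Vc : endo grid.
Proof.
exists (fun g i j => (-1) ^+ i * (if j is j'.+1 then g i j' else 0 : K)) => k x y.
apply: gridP => i [|j] /=.
  by rewrite -[RHS]/(k * ((-1) ^+ i * 0) + (-1) ^+ i * 0) !mulr0 addr0.
by rewrite -[RHS]/(k * (_ * _) + _ * _) -[X in _ * X = _]/(k * _ + _) mulrDr mulrCA.
Defined.
Definition Ve : endo grid.
Proof.
exists (fun g i j => (-1) ^+ i * (vcoef mu j.+1 * g i j.+1)) => k x y.
apply: gridP => i j.
rewrite -[RHS]/(k * (_ * (_ * _)) + _ * (_ * _)) -[X in _ * (_ * X) = _]/(k * _ + _).
by rewrite !mulrDr; congr (_ + _); rewrite [RHS]mulrCA [X in _ * X = _]mulrCA.
Defined.

Lemma VaE g i j : Va g i.+1 j = g i j. Proof. by []. Qed.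
Lemma Va0 g j : Va g 0%N j = 0. Proof. by []. Qed.
Lemma VbE g i j : Vb g i j = vcoef la i.+1 * g i.+1 j. Proof. by []. Qed.
Lemma VcE g i j : Vc g i j.+1 = (-1) ^+ i * g i j. Proof. by []. Qed.
Lemma Vc0 g i : Vc g i 0%N = 0. Proof. exact: mulr0. Qed.
Lemma VeE g i j : Ve g i j = (-1) ^+ i * (vcoef mu j.+1 * g i j.+1).
Proof. by []. Qed.

Lemma grid_addE g g' i j : (g + g') i j = g i j + g' i j. Proof. by []. Qed.
Lemma grid_oppE g i j : (- g) i j = - g i j. Proof. by []. Qed.
Lemma grid_scaleE k g i j : (k *: g) i j = k * g i j. Proof. by []. Qed.

(** The recursion of [vcoef] is made for this: [vcoef la i.+1 + vcoef la i = la + i%:R]. *)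
Lemma VhE g i j : (Vb * Va + Va * Vb) g i j = (la + i%:R) * g i j.
Proof.
rewrite endo_addE grid_addE !endo_mulE VbE VaE; case: i => [|i].
  by rewrite Va0 /= subr0 addr0.
by rewrite VaE VbE -mulrDl [vcoef la i.+2]/= subrK.
Qed.

Lemma VkE g i j : (Ve * Vc + Vc * Ve) g i j = (mu + j%:R) * g i j.
Proof.
rewrite endo_addE grid_addE !endo_mulE VeE VcE mulrCA signrMK.
case: j => [|j]; first by rewrite Vc0 /= subr0 addr0.
rewrite VcE VeE signrMK -mulrDl.
by rewrite [vcoef mu j.+2]/= subrK.
Qed.

Lemma V_ha : (Vb * Va + Va * Vb) * Va = Va * (Vb * Va + Va * Vb) + Va.
Proof.
apply: endoP => g; apply: gridP => i j; rewrite endo_addE grid_addE !endo_mulE VhE.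
case: i => [|i]; first by rewrite !Va0 mulr0 addr0.
by rewrite !VaE VhE -natr1 addrA mulrDl mul1r.
Qed.
Lemma V_bh : Vb * (Vb * Va + Va * Vb) = (Vb * Va + Va * Vb) * Vb + Vb.
Proof.
apply: endoP => g; apply: gridP => i j; rewrite endo_addE grid_addE.
rewrite !endo_mulE VhE !VbE VhE.
by rewrite -natr1; ring.
Qed.
Lemma V_kc : (Ve * Vc + Vc * Ve) * Vc = Vc * (Ve * Vc + Vc * Ve) + Vc.
Proof.
apply: endoP => g; apply: gridP => i j; rewrite endo_addE grid_addE !endo_mulE VkE.
case: j => [|j]; first by rewrite !Vc0 mulr0 addr0.
by rewrite !VcE VkE -natr1; ring.
Qed.
Lemma V_ek : Ve * (Ve * Vc + Vc * Ve) = (Ve * Vc + Vc * Ve) * Ve + Ve.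
Proof.
apply: endoP => g; apply: gridP => i j; rewrite endo_addE grid_addE.
rewrite !endo_mulE VkE !VeE VkE.
by rewrite -natr1; ring.
Qed.
Lemma V_ca : Vc * Va = - (Va * Vc).
Proof.
apply: endoP => g; apply: gridP => i j; rewrite endo_oppE grid_oppE !endo_mulE.
case: i j => [|i] [|j]; rewrite ?(Va0, VaE, Vc0, VcE, mulr0, oppr0) //.
by rewrite exprS; ring.
Qed.
Lemma V_ea : Ve * Va = - (Va * Ve).
Proof.
apply: endoP => g; apply: gridP => i j; rewrite endo_oppE grid_oppE !endo_mulE VeE.
case: i => [|i]; rewrite ?(Va0, VaE, VeE, mulr0, oppr0) //.
by rewrite exprS; ring.
Qed.
Lemma V_cb : Vc * Vb = - (Vb * Vc).
Proof.
apply: endoP => g; apply: gridP => i j; rewrite endo_oppE grid_oppE !endo_mulE VbE.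
case: j => [|j]; rewrite ?(Vc0, VcE, VbE, mulr0, oppr0) //.
by rewrite exprS; ring.
Qed.
Lemma V_eb : Ve * Vb = - (Vb * Ve).
Proof.
apply: endoP => g; apply: gridP => i j; rewrite endo_oppE grid_oppE.
rewrite !endo_mulE VbE !VeE VbE.
by rewrite exprS; ring.
Qed.

Local Notation act := (gg_act Va Vb Vc Ve).

Lemma actP s t : @uea_rel K (GG K) s t -> teval act s = teval act t.
Proof.
case=> [k x y|p q x y hx hy] /=; rewrite -endo_scalerAl mul1r.
  exact: gg_act_linear.
exact: (gg_act_br V_ha V_bh V_kc V_ek V_ca V_ea V_cb V_eb).
Qed.

Definition urep : UG K -> endo grid := @palg_rep _ _ _ (@uea_rel K (GG K)) act.

Lemma urep_in x : urep (uea_in x) = act x. Proof. exact: (palg_rep_gen actP). Qed.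
Lemma urep1 : urep 1 = 1. Proof. exact: (palg_rep1 actP). Qed.
Lemma urepM (u v : UG K) : urep (u * v) = urep u * urep v.
Proof. exact: (palg_repM actP). Qed.
Lemma urepL k (u v : UG K) : urep (k *: u + v) = k *: urep u + urep v.
Proof. by rewrite /urep (palg_repD actP) (palg_repZ actP). Qed.

Lemma actHE g i j : act (gX K X0) g i j = (la + mu + (i + j)%:R) * g i j.
Proof.
rewrite -[act _]/(osp_act Va Vb (osp_e K X0) + osp_act Vc Ve (osp_e K X0)).
by rewrite !osp_act_e endo_addE grid_addE VhE VkE natrD; ring.
Qed.

Lemma urepHn n g i j : urep (uea_in (gX K X0) - n%:~R) g i j =
  (la + mu + (i + j)%:R - n%:~R) * g i j.
Proof.
have -> : uea_in (gX K X0) - n%:~R = - n%:~R *: (1 : UG K) + uea_in (gX K X0).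
  by rewrite scaleNr scaler_int addrC.
by rewrite urepL urep1 urep_in endo_addE grid_addE actHE /= grid_scaleE addrC -mulrDl.
Qed.

Hypothesis nz : nonint (la + mu).

Definition Vdiag (q : nat -> nat -> K) : endo grid.
Proof.
exists (fun g i j => q i j * g i j) => k x y; apply: gridP => i j.
by rewrite -[RHS]/(k * (_ * _) + _ * _) -[X in _ * X = _]/(k * _ + _) mulrDr mulrCA.
Defined.

Lemma VdiagE q g i j : Vdiag q g i j = q i j * g i j. Proof. by []. Qed.

(** H is diagonal with eigenvalues la + mu + (i + j), and [nz] keeps these away from every integer
    n. *)
Lemma urep_inv d : Dset d -> exists j, j * urep d = 1 /\ urep d * j = 1.
Proof.
elim=> {d} [|n|d e _ [i [i1 i2]] _ [j [j1 j2]]].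
- by exists 1; rewrite urep1 mulr1.
- pose q i j : K := la + mu + (i + j)%:R - n%:~R.
  have q0 i j : q i j != 0.
    by rewrite subr_eq0 (nonintD _ nz).
  exists (Vdiag (fun i j => (q i j)^-1)).
  split; apply: endoP => g; apply: gridP => i0 j0.
    by rewrite endo_mulE VdiagE urepHn mulKf.
  by rewrite endo_mulE urepHn VdiagE (mulVKf (q0 i0 j0)).
- exists (j * i); rewrite urepM; split.
    by rewrite mulrA -[j * i * _]mulrA i1 mulr1 j1.
  by rewrite mulrA -[urep d * _ * _]mulrA j2 mulr1 i2.
Qed.

Definition rho : DUG K -> endo grid :=
  @palg_rep _ _ _ (@loc_rel _ _ _ (@Dset K)) (locf urep_inv).

Let P := locfP urep1 urepL urepM urep_inv.

Lemma rho_in u : rho (loc_in (@Dset K) u) = urep u.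
Proof. exact: (palg_rep_gen P). Qed.
Lemma rho1 : rho 1 = 1. Proof. exact: (palg_rep1 P). Qed.
Lemma rhoM (u v : DUG K) : rho (u * v) = rho u * rho v.
Proof. exact: (palg_repM P). Qed.
Lemma rhoD (u v : DUG K) : rho (u + v) = rho u + rho v.
Proof. exact: (palg_repD P). Qed.
Lemma rhoZ k u : rho (k *: u) = k *: rho u. Proof. exact: (palg_repZ P). Qed.
Lemma rhoN u : rho (- u) = - rho u.
Proof. by rewrite -!scaleN1r rhoZ. Qed.

Lemma rho_X a : rho (UX K a) = osp_op Va Vb a + osp_op Vc Ve a.
Proof.
by rewrite rho_in urep_in -!osp_act_e.
Qed.
Lemma rho_T a : rho (UT K a) = osp_op Va Vb a - osp_op Vc Ve a.
Proof.
by rewrite rho_in urep_in -!osp_act_e -osp_actN.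
Qed.

Lemma rho_y1 a : rho (y1 K a) = osp_op Va Vb a.
Proof.
rewrite rho_in urep_in -[act _]/(osp_act Va Vb (osp_e K a) + osp_act Vc Ve 0).
by rewrite osp_act0 addr0 osp_act_e.
Qed.
Lemma rho_y2 a : rho (y2 K a) = osp_op Vc Ve a.
Proof.
rewrite rho_in urep_in -[act _]/(osp_act Va Vb 0 + osp_act Vc Ve (osp_e K a)).
by rewrite osp_act0 add0r osp_act_e.
Qed.

Lemma rho_H g i j : rho (UH K) g i j = (la + mu + (i + j)%:R) * g i j.
Proof. by rewrite rho_in urep_in actHE. Qed.

Lemma rho_hev q g i j : rho (hev q) g i j = q.[la + mu + (i + j)%:R] * g i j.
Proof.
elim/poly_ind: q g => [|q c IH] g.
  by rewrite hev0 -(scale0r (1 : DUG K)) rhoZ scale0r horner0 mul0r.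
rewrite hevD hevMX hevC rhoD rhoM rhoZ rho1 endo_addE grid_addE endo_mulE IH rho_H.
rewrite hornerMXaddC -[X in _ + X = _]/(c * g i j); ring.
Qed.

Lemma rho_frac f p q g i j : fracH f p q -> rho f g i j =
  p.[la + mu + (i + j)%:R] / q.[la + mu + (i + j)%:R] * g i j.
Proof.
move=> [e _ hq].
pose z i j : K := la + mu + (i + j)%:R.
have qz i' j' : q.[z i' j'] != 0.
  exact/hq/(nonintD _ nz).
(* Only the product f Q(H) is known, so g is first written as an image under Q(H). *)
have {1}-> : g = rho (hev q) (Vdiag (fun i j => q.[z i j]^-1) g).
  by apply: gridP => i' j'; rewrite rho_hev VdiagE (mulVKf (qz i' j')).
rewrite -endo_mulE -rhoM e rho_hev VdiagE; exact: mulrA.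
Qed.

(* The matrix coefficient u |-> w (u g) factors through U/J when g is killed by
   g_+ and w kills the image of g_-, and it turns the diamond product into
   composition. *)
Section Functional.
Variables (w : grid -> K) (g : grid).
Hypotheses (wD : forall x y, w (x + y) = w x + w y).
Hypothesis w_m : forall x, w (rho (UX K Xm1) x) = 0.
Hypothesis g_p : rho (UX K Xp1) g = 0.

Lemma coef_cl (u v : DUG K) : cl u = cl v -> w (rho u g) = w (rho v g).
Proof.
move=> /(clE char0)[a [b ->]].
have -> : rho (v + UX K Xm1 * a + b * UX K Xp1) g =
    rho v g + rho (UX K Xm1) (rho a g) + rho b (rho (UX K Xp1) g).
  by rewrite !rhoD !rhoM.
by rewrite g_p endo0 addr0 wD w_m addr0.
Qed.

Lemma coef_dia (u v : DUG K) : rho (UX K Xp1) (rho v g) = 0 -> forall z,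
  dia (cl u) (cl v) = cl z -> w (rho (u * v) g) = w (rho z g).
Proof.
move=> v_p z e.
have [N [x ex]] := @absorbs_all _ char0 v 1.
have [x' ex'] := absorbs_ge ex (leqnSn N).
have := diaE char0 u ex'; rewrite e => /coef_cl ->.
rewrite !rhoM !endo_mulE.
congr (w (rho u _)).
(* As p kills v g, every nonempty truncation of the series acts on it as the identity. *)
elim: {ex ex'} N => [|N IH].
  by rewrite /Psum big_ord1 /= !expr0 !mulr1 rho1.
rewrite /Psum big_ord_recr -/(Psum K N.+1) [nat_of_ord _]/= [UX K Xp1 ^+ _]exprSr mulrA.
have T y : rho (y * UX K Xp1) (rho v g) = 0 by rewrite rhoM endo_mulE v_p endo0.
by rewrite rhoD endo_addE -IH T addr0.
Qed.
End Functional.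

End Verma.

(** * Singular vectors and uniqueness *)

Section Equations.
Variable K : fieldType.
Hypothesis char0 : [pchar K] =i pred0.
Variables la mu : K.
Hypothesis nz : nonint (la + mu).
Implicit Types (g : grid K).

Local Notation Va := (Va K).
Local Notation Vb := (Vb la).
Local Notation Vc := (Vc K).
Local Notation Ve := (Ve mu).
Local Notation rho := (rho nz).
Local Notation t := (UT K).

Definition vac : grid K := fun i j => ((i == 0%N) && (j == 0%N))%:R.

(* sing k maps the highest weight vector to the singular vector of weight
   la + mu + k; the last case is meant for k = 3. *)
Definition sing (k : nat) : DUG K :=
  let a := y1 K Xm1 in let c := y2 K Xm1 in
  match k with
  | 1%N => mu *: a - la *: c
  | 2%N => mu *: (a * a) + a * c - la *: (c * c)
  | _ => - (mu * (mu + 1)) *: (a * a * a)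
         + (la + 1) * (mu + 1) *: (a * a * c + a * c * c)
         - (la * (la + 1)) *: (c * c * c)
  end.
Definition singv (k : nat) : grid K := rho (sing k) vac.

(* The functional on the weight space of weight la + mu + k that kills the image
   of X_-a; the last case is meant for k = 3. *)
Definition weight_form (k : nat) g : K :=
  match k with
  | 1%N => g 1%N 0%N - g 0%N 1%N
  | 2%N => g 2%N 0%N + g 1%N 1%N - g 0%N 2%N
  | _ => g 3%N 0%N - g 2%N 1%N - g 1%N 2%N + g 0%N 3%N
  end.

(** Coordinates of [singv k]. In [sing] each c stands to the right of each a and so acts in row 0,
    where the sign of [Vc] is 1; the coefficients are simply copied. *)
Definition sing_fun (k : nat) : grid K := fun i j =>
  match k, i, j with
  | 1%N, 1%N, 0%N => mu | 1%N, 0%N, 1%N => - la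
  | 2%N, 2%N, 0%N => mu | 2%N, 1%N, 1%N => 1 | 2%N, 0%N, 2%N => - la
  | 3%N, 3%N, 0%N => - (mu * (mu + 1))
  | 3%N, 2%N, 1%N | 3%N, 1%N, 2%N => (la + 1) * (mu + 1)
  | 3%N, 0%N, 3%N => - (la * (la + 1))
  | _, _, _ => 0
  end.

Lemma grid0E i j : (0 : grid K) i j = 0 :> K. Proof. by []. Qed.

Definition rhoE := (rhoD, rhoN, rhoZ, rhoM, rho_y1, rho_y2).
Definition appE := (endo_addE, endo_oppE, endo_scaleE, endo_mulE,
  grid_addE, grid_oppE, grid_scaleE).

Lemma singvE k : (0 < k < 4)%N -> singv k = sing_fun k.
Proof.
case: k => [//|[|[|[|//]]]] _; rewrite /singv /sing ?rhoE;
  apply: gridP => i j; rewrite ?appE.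
- by case: i j => [|[|i]] [|[|j]] /=; rewrite /vac /= ?expr0; ring.
- by case: i j => [|[|[|i]]] [|[|[|j]]] /=; rewrite /vac /=; ring.
- by case: i j => [|[|[|[|i]]]] [|[|[|[|j]]]] /=; rewrite /vac /=; ring.
Qed.

Lemma vac_p : rho (UX K Xp1) vac = 0.
Proof.
apply: gridP => i j; rewrite rho_X !appE grid0E /= /vac.
case: i => [|i] /=; rewrite ?andbF /=; ring.
Qed.

Lemma sing_p k : (0 < k < 4)%N -> rho (UX K Xp1) (singv k) = 0.
Proof.
move=> hk; rewrite singvE // rho_X; apply: gridP => i j; rewrite !appE grid0E /=.
case: k hk => [//|[|[|[|//]]]] _.
- by case: i j => [|[|i]] [|[|j]]; rewrite /sing_fun /=; ring.
- by case: i j => [|[|[|i]]] [|[|[|j]]]; rewrite /sing_fun /=; ring.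
- by case: i j => [|[|[|[|i]]]] [|[|[|[|j]]]]; rewrite /sing_fun /=; ring.
Qed.

Lemma weight_formD k x y : weight_form k (x + y) = weight_form k x + weight_form k y.
Proof. by rewrite /weight_form; case: k => [|[|[|k]]]; rewrite !grid_addE; ring. Qed.

Lemma weight_form_Xm1 k g : (0 < k < 4)%N -> weight_form k (rho (UX K Xm1) g) = 0.
Proof.
rewrite rho_X; case: k => [//|[|[|[|//]]]] _; rewrite /weight_form ?appE /=; ring.
Qed.

Lemma sing_hom k : (0 < k < 4)%N -> DUG_hom (odd k) (sing k).
Proof.
have h_a := DUG_hom_y1 K Xm1; have h_c := DUG_hom_y2 K Xm1.
have haa := DUG_homM h_a h_a; have hac := DUG_homM h_a h_c.
have hcc := DUG_homM h_c h_c.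
case: k => [//|[|[|[|//]]]] _; rewrite /sing -?scaleNr.
- by apply: DUG_homD; apply: DUG_homZ.
- apply: DUG_homD; last exact: DUG_homZ.
  by apply: DUG_homD => //; apply: DUG_homZ.
- apply: DUG_homD; last by apply: DUG_homZ; apply: (DUG_homM hcc h_c).
  apply: DUG_homD; first by apply: DUG_homZ; apply: (DUG_homM haa h_a).
  apply: DUG_homZ; apply: DUG_homD; first exact: (DUG_homM haa h_c).
  exact: (DUG_homM hac h_c).
Qed.

Lemma vac_t2 : rho (t Xp2) vac = 0.
Proof.
apply: gridP => i j; rewrite rho_T !appE grid0E /= /vac.
by case: i => [|i] /=; rewrite ?andbF /=; ring.
Qed.
Lemma vac_t1 : rho (t Xp1) vac = 0.
Proof.
apply: gridP => i j; rewrite rho_T !appE grid0E /= /vac.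
by case: i => [|i] /=; rewrite ?andbF /=; ring.
Qed.
Lemma vac_t0 : rho (t X0) vac = (la - mu) *: vac.
Proof.
apply: gridP => i j; rewrite rho_T [osp_op _ _ _]/= [osp_op Vc _ _]/=.
rewrite endo_addE endo_oppE grid_addE grid_oppE VhE VkE grid_scaleE /vac.
by case: i j => [|i] [|j] /=; ring.
Qed.

Definition hval (f : DUG K) (F : K -> K) :=
  forall x i j, rho f x i j = F (la + mu + (i + j)%:R) * x i j.

Variables (f2 f1 f0 f : DUG K) (F2 F1 F0 G : K -> K).
Hypotheses (h2 : hval f2 F2) (h1 : hval f1 F1) (h0 : hval f0 F0) (h : hval f G).

Definition quad : DUG K :=
  f2 * (t Xm2 * t Xp2) + f1 * (t Xm1 * t Xp1) + f0 * (t X0 * t X0) + f.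

Lemma rho_quad x i j : let z := la + mu + (i + j)%:R in rho quad x i j =
  F2 z * rho (t Xm2) (rho (t Xp2) x) i j + F1 z * rho (t Xm1) (rho (t Xp1) x) i j
  + F0 z * rho (t X0) (rho (t X0) x) i j + G z * x i j.
Proof.
by move=> z; rewrite /quad !(rhoD, rhoM) !appE h2 h1 h0 h.
Qed.

Definition vac_eigenvalue : K := F0 (la + mu) * (la - mu) ^+ 2 + G (la + mu).

Lemma quad_vac : rho quad vac = vac_eigenvalue *: vac.
Proof.
apply: gridP => i j; rewrite rho_quad vac_t2 vac_t1 vac_t0 endoZ vac_t0 !endo0.
rewrite !grid_scaleE !grid0E /vac_eigenvalue /vac.
by case: i j => [|i] [|j] /=; rewrite ?addr0; ring.
Qed.

Hypothesis anti : anticentral (cl quad).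

(** The diamond products of [quad] and [sing k] in the two orders differ by (-1)^k. Evaluated on the
    vacuum, one order gives [quad] applied to the singular vector, the other the vacuum eigenvalue
    times that vector. *)
Lemma weight_eq k : (0 < k < 4)%N ->
  weight_form k (rho quad (sing_fun k)) =
  (-1) ^+ k * vac_eigenvalue * weight_form k (sing_fun k).
Proof.
move=> hk.
have w0 := @weight_formD k; have wm g := @weight_form_Xm1 k g hk.
have wZ c x : weight_form k (c *: x) = c * weight_form k x.
  by rewrite /weight_form; case: (k) => [|[|[|k']]]; rewrite !grid_scaleE; ring.
(* One representative lets [coef_dia] evaluate both orders. *)
pose z := repr (dia (cl quad) (cl (sing k))).
have e1 : dia (cl quad) (cl (sing k)) = cl z by rewrite /cl reprK.
have hs : UJ_hom (odd k) (cl (sing k)) by exists (sing k) => //; apply: sing_hom.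
have e2 : dia (cl (sing k)) (cl quad) = cl ((-1) ^+ k *: z).
  rewrite clZ -e1 -signr_odd; case: anti => _ ev od.
  case: (odd k) hs => hs; first by rewrite od // scalerN expr1 scaleN1r opprK.
  by rewrite ev // scale1r.
have := coef_dia char0 w0 wm vac_p (sing_p hk) e1.
have qp : rho (UX K Xp1) (rho quad vac) = 0.
  by rewrite quad_vac endoZ vac_p scaler0.
have := coef_dia char0 w0 wm vac_p qp e2.
rewrite [rho (_ *: z)]rhoZ [rho (quad * _)]rhoM [rho (sing k * _)]rhoM !endo_mulE.
rewrite endo_scaleE quad_vac endoZ -/(singv k) singvE // !wZ => e4 e3.
by rewrite e3 -mulrA e4 signrMK.
Qed.
End Equations.

(** * The equations at weights s + 1, s + 2 and s + 3 in coordinates *)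

Section Weights.
Variable K : fieldType.
Hypothesis char0 : [pchar K] =i pred0.
Variables la mu : K.
Hypothesis nz : nonint (la + mu).
Variables (f2 f1 f0 f : DUG K) (F2 F1 F0 G : K -> K).
Hypotheses (h2 : hval nz f2 F2) (h1 : hval nz f1 F1) (h0 : hval nz f0 F0)
  (h : hval nz f G).
Hypothesis anti : anticentral (cl (quad f2 f1 f0 f)).
Local Notation s := (la + mu).
Local Notation d := (la - mu).
Local Notation kappa := (F0 s * d ^+ 2 + G s).
Local Notation z k := (s + k%:R).

(** The operators again, as bare functions of coordinates, so that reduction leaves only expressions
    over K. *)
Definition fa (x : nat -> nat -> K) i j : K := if i is i'.+1 then x i' j else 0.
Definition fb (x : nat -> nat -> K) i j : K := vcoef la i.+1 * x i.+1 j.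
Definition fc (x : nat -> nat -> K) i j : K :=
  (-1) ^+ i * (if j is j'.+1 then x i j' else 0).
Definition fe (x : nat -> nat -> K) i j : K :=
  (-1) ^+ i * (vcoef mu j.+1 * x i j.+1).

Definition fm2 (x : nat -> nat -> K) i j : K := fa (fa x) i j - fc (fc x) i j.
Definition fm1 (x : nat -> nat -> K) i j : K := fa x i j - fc x i j.
Definition f00 (x : nat -> nat -> K) i j : K := (la + i%:R - (mu + j%:R)) * x i j.
Definition fp1 (x : nat -> nat -> K) i j : K := fb x i j - fe x i j.
Definition fp2 (x : nat -> nat -> K) i j : K := fe (fe x) i j - fb (fb x) i j.

Lemma rho_fm1 x : rho nz (UT K Xm1) x = fm1 x.
Proof. by rewrite rho_T. Qed.
Lemma rho_fm2 x : rho nz (UT K Xm2) x = fm2 x.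
Proof. by rewrite rho_T. Qed.
Lemma rho_fp1 x : rho nz (UT K Xp1) x = fp1 x.
Proof. by rewrite rho_T. Qed.
Lemma rho_fp2 x : rho nz (UT K Xp2) x = fp2 x.
Proof.
rewrite rho_T; apply: gridP => i j.
by rewrite /= [RHS]/(_ - _) opprK addrC.
Qed.
Lemma rho_f00 x : rho nz (UT K X0) x = f00 x.
Proof.
rewrite rho_T; apply: gridP => i j.
rewrite [osp_op _ _ _]/= [osp_op (Vc K) _ _]/= endo_addE endo_oppE grid_addE grid_oppE.
by rewrite VhE VkE -mulrBl.
Qed.

Lemma rho_quadE x i j : rho nz (quad f2 f1 f0 f) x i j =
  F2 (z (i + j)) * fm2 (fp2 x) i j + F1 (z (i + j)) * fm1 (fp1 x) i j
  + F0 (z (i + j)) * f00 (f00 x) i j + G (z (i + j)) * x i j.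
Proof.
rewrite (rho_quad h2 h1 h0 h).
by rewrite rho_fm2 rho_fp2 rho_fm1 rho_fp1 !rho_f00.
Qed.

(** The form takes the values s, s + 1 and - (s + 1) (s + 2) on the three singular vectors, whence
    the right-hand sides of [weight1] to [weight3]. F2 is absent here because t_2 lowers the weight
    by 2. *)
Lemma weight1 : F1 (z 1) * (4 * la * mu)
  + F0 (z 1) * (mu * (d + 1) ^+ 2 + la * (d - 1) ^+ 2) + G (z 1) * s = - kappa * s.
Proof.
have := weight_eq char0 h2 h1 h0 h anti (isT : 0 < 1 < 4)%N.
rewrite /weight_form !rho_quadE -[vac_eigenvalue _ _ _ _]/kappa /sing_fun.
rewrite /fm2 /fm1 /fp2 /fp1 /f00 /fa /fb /fc /fe /=.
move: (F2 _) (F1 _) (F0 (z 1)) (G (z 1)) kappa => x2 x1 x0 x k e.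
transitivity ((-1) ^+ 1 * k * (mu - - la)); last by ring.
by rewrite -e; ring.
Qed.

Lemma weight2 : - F2 (z 2) * (4 * la * mu) + F1 (z 2) * (4 * s)
  + F0 (z 2) * (mu * (d + 2) ^+ 2 + d ^+ 2 + la * (d - 2) ^+ 2) + G (z 2) * (s + 1)
  = kappa * (s + 1).
Proof.
have := weight_eq char0 h2 h1 h0 h anti (isT : 0 < 2 < 4)%N.
rewrite /weight_form !rho_quadE -[vac_eigenvalue _ _ _ _]/kappa /sing_fun.
rewrite /fm2 /fm1 /fp2 /fp1 /f00 /fa /fb /fc /fe /=.
move: (F2 _) (F1 _) (F0 (z 2)) (G (z 2)) kappa => x2 x1 x0 x k e.
transitivity ((-1) ^+ 2 * k * (mu + 1 - - la)); last by ring.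
by rewrite -e; ring.
Qed.

Lemma weight3 :
  F2 (z 3) * (4 * (la + 1) * (mu + 1) * s)
  - F1 (z 3) * (4 * (la + 1) * (mu + 1) * (s + 1))
  - F0 (z 3) * (mu * (mu + 1) * (d + 3) ^+ 2 + la * (la + 1) * (d - 3) ^+ 2
      + (la + 1) * (mu + 1) * ((d + 1) ^+ 2 + (d - 1) ^+ 2))
  - G (z 3) * ((s + 1) * (s + 2)) = kappa * ((s + 1) * (s + 2)).
Proof.
have := weight_eq char0 h2 h1 h0 h anti (isT : 0 < 3 < 4)%N.
rewrite /weight_form !rho_quadE -[vac_eigenvalue _ _ _ _]/kappa /sing_fun.
rewrite /fm2 /fm1 /fp2 /fp1 /f00 /fa /fb /fc /fe /=.
move: (F2 _) (F1 _) (F0 (z 3)) (G (z 3)) kappa => x2 x1 x0 x k e.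
transitivity ((-1) ^+ 3 * k * (- (mu * (mu + 1)) - (la + 1) * (mu + 1)
  - (la + 1) * (mu + 1) + - (la * (la + 1)))); last by ring.
by rewrite -e; ring.
Qed.

End Weights.

(** * Rational functions off the integers and the recurrence *)

Section Rational.
Variable K : fieldType.
Hypothesis char0 : [pchar K] =i pred0.
Implicit Types (P Q : {poly K}) (F : K -> K) (z : K).

Lemma natK_inj (x y : nat) : x%:R = y%:R :> K -> x = y.
Proof.
move=> e; wlog lt : x y e / (x <= y)%N.
  by move=> h; case: (leqP x y) => [|/ltnW] l; [|apply/esym]; apply: h.
apply/eqP; rewrite eqn_leq lt /= -subn_eq0 -((pcharf0P K).1 char0) natrB //.
by rewrite e subrr.
Qed.

Lemma nonint_half : nonint (2^-1 : K).
Proof.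
have n2 : 2 != 0 :> K by apply: (natK_neq0 char0 1).
move=> n; apply/eqP => e.
have {}e : n%:~R * 2 = 1 :> K by rewrite -e mulVf.
case: n e => n.
  rewrite -[_%:~R]/(n%:R) -natrM => /(natK_inj (y := 1%N))/(congr1 odd).
  by rewrite oddM andbF.
rewrite NegzE mulrNz mulNr -[_%:~R]/(n.+1%:R) -natrM => e.
have : (n.+1 * 2).+1%:R == 0 :> K by rewrite -natr1 -[X in _ + X]e subrr.
by rewrite ((pcharf0P K).1 char0).
Qed.

Lemma nonintB z n : nonint z -> nonint (z - n%:R).
Proof.
move=> hz i; rewrite subr_eq -[n%:R]/(n%:Z%:~R) -rmorphD /=; exact: hz.
Qed.
Lemma nonint_nat z n : nonint z -> z - n%:R != 0.
Proof. by move=> hz; rewrite subr_eq0 -[n%:R]/(n%:Z%:~R) hz. Qed.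

Lemma poly_progression P z n : (0 < n)%N ->
  (forall k, P.[z + (n * k)%:R] = 0) -> P = 0.
Proof.
move=> n0 h; apply: (@roots_geq_poly_eq0 _ P
  [seq z + (n * k)%:R | k <- iota 0 (size P)]).
- by apply/allP => _ /mapP[k _ ->]; apply/eqP.
- rewrite map_inj_uniq ?iota_uniq // => i j /addrI /natK_inj /eqP.
  by rewrite eqn_pmul2l // => /eqP.
- by rewrite size_map size_iota.
Qed.

(** Values at integers are left arbitrary: these are the possible poles of elements of D^-1 U(h). *)
Definition ratf F := exists P Q,
  forall z, nonint z -> Q.[z] != 0 /\ F z = P.[z] / Q.[z].

Lemma ratfD F G : ratf F -> ratf G -> ratf (fun z => F z + G z).
Proof.
move=> [P [Q h]] [P' [Q' h']]; exists (P * Q' + P' * Q), (Q * Q') => z hz.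
have [q ->] := h z hz; have [q' ->] := h' z hz.
by rewrite hornerD !hornerM mulf_neq0 //; split=> //; field; rewrite q q'.
Qed.
Lemma ratfM F G : ratf F -> ratf G -> ratf (fun z => F z * G z).
Proof.
move=> [P [Q h]] [P' [Q' h']]; exists (P * P'), (Q * Q') => z hz.
have [q ->] := h z hz; have [q' ->] := h' z hz.
by rewrite !hornerM mulf_neq0 //; split=> //; field; rewrite q q'.
Qed.
Lemma ratf_poly P : ratf (fun z => P.[z]).
Proof.
by exists P, 1 => z _; rewrite hornerC oner_eq0 divr1.
Qed.
Lemma ratf_inv n : ratf (fun z => (z - n%:R)^-1).
Proof.
exists 1, ('X - n%:R%:P) => z hz; rewrite hornerXsubC hornerC div1r; split=> //.
exact: nonint_nat.
Qed.
Lemma ratf_shift F n : ratf F -> ratf (fun z => F (z + n%:R)).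
Proof.
move=> [P [Q h]]; exists (P \Po ('X + n%:R%:P)), (Q \Po ('X + n%:R%:P)) => z hz.
by rewrite !horner_comp hornerD hornerX hornerC; apply/h/nonintD.
Qed.
Lemma ratf_eq F G : (forall z, nonint z -> F z = G z) -> ratf F -> ratf G.
Proof. by move=> e [P [Q h]]; exists P, Q => z hz; rewrite -e //; apply: h. Qed.

(** For F = P / Q and z0 = 1/2, the polynomial Q(z0) P - P(z0) Q vanishes at all z0 + 2 k, hence
    identically. *)
Lemma ratf_periodic F : ratf F -> (forall z, nonint z -> F (z + 2) = F z) ->
  exists c, forall z, nonint z -> F z = c.
Proof.
move=> [P [Q h]] per; pose z0 : K := 2^-1; have hz0 : nonint z0 := nonint_half.
have [q0 e0] := h _ hz0; exists (F z0) => z hz.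
have perk k : F (z0 + (2 * k)%:R) = F z0.
  elim: k => [|k IH]; first by rewrite muln0 addr0.
  by rewrite mulnSr natrD addrA per //; apply: nonintD.
have R0 : Q.[z0] *: P - P.[z0] *: Q = 0.
  apply: (@poly_progression _ z0 2) => // k.
  have [q e] := h _ (nonintD (2 * k) hz0).
  move: (perk k); rewrite e e0 => /eqP; rewrite eqr_div // => /eqP e1.
  by rewrite hornerD hornerN !hornerZ mulrC e1 subrr.
have [q ->] := h z hz; rewrite e0; apply/eqP; rewrite eqr_div //.
have := congr1 (horner^~ z) R0; rewrite hornerD hornerN !hornerZ horner0.
by move=> /subr0_eq; rewrite mulrC => ->.
Qed.

(** Antiperiodicity gives period 2, so F is a constant equal to its opposite. *)
Lemma ratf_antiperiodic F : ratf F -> (forall z, nonint z -> F (z + 1) = - F z) ->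
  forall z, nonint z -> F z = 0.
Proof.
move=> rF anti z hz.
have [|c hc] := ratf_periodic rF.
  move=> y hy; have -> : y + 2 = y + 1 + 1 by rewrite -addrA.
  by rewrite !anti ?opprK //; apply: (nonintD 1).
have := anti z hz; rewrite !hc //; last exact: (nonintD 1).
move=> /eqP; rewrite -addr_eq0 -mulr2n -mulr_natl mulf_eq0 => /orP[|/eqP//].
by rewrite (negPf (natK_neq0 char0 1)).
Qed.

Variables F2 F1 F0 G : K -> K.
Hypotheses (r0 : ratf F0) (rG : ratf G).
Hypothesis e1 : forall s, nonint s -> F1 (s + 1) = s * F0 s + (s - 2) * F0 (s + 1).
Hypothesis e1' : forall s, nonint s ->
  s ^+ 2 * F0 s + (s - 1) ^+ 2 * F0 (s + 1) + G s + G (s + 1) = 0.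
Hypothesis e2 : forall s, nonint s ->
  F2 (s + 2) = (s + 1) * F0 s - (s - 3) * F0 (s + 2).
Hypothesis e3 : forall s, nonint s ->
  - s * F2 (s + 3) + (s + 1) * F1 (s + 3) - s * (s - 3) * F0 (s + 3) =
  (s + 1) * (s + 2) * F0 s.

Lemma recurrence_solution : exists c, forall s, nonint s ->
  [/\ F0 s = c, G s = - c * (s - 1) ^+ 2, F1 s = 2 * (s - 2) * c & F2 s = 4 * c].
Proof.
have per s : nonint s -> F0 (s + 2) = F0 s.
  (* This is (F0(z + 2) - F0(z)) / z, spelled so that the closure properties of [ratf] apply. *)
  have rW : ratf (fun z => (F0 (z + 2%:R) + (- 1%:P).[z] * F0 z) * (z - 0%:R)^-1).
    apply: ratfM (ratf_inv 0); apply: ratfD; first exact: (ratf_shift 2).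
    by apply: ratfM r0; apply: ratf_poly.
  move=> hs; have := ratf_antiperiodic rW _ hs.
  rewrite hornerN hornerC mulN1r subr0 => /(_ _)/eqP.
  rewrite mulf_eq0 subr_eq0 invr_eq0.
  have s0 : s != 0 by have := nonint_nat 0 hs; rewrite subr0.
  rewrite (negPf s0) orbF => h; apply/eqP/h => {hs s0 h} {}s hs.
  have s0 : s != 0 by have := nonint_nat 0 hs; rewrite subr0.
  have s1 : s + 1 != 0.
    by have := nonint_nat 0 (nonintD 1 hs); rewrite subr0.
  have s2 : s + 2 != 0.
    by have := nonint_nat 0 (nonintD 2 hs); rewrite subr0.
  rewrite !hornerN !hornerC !subr0 !mulN1r.
  have a3 : s + 3 = s + 2 + 1 by ring.
  have a3' : s + 3 = s + 1 + 2 by ring.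
  (* F2(s + 3) comes from [e2] at s + 1 and F1(s + 3) from [e1] at s + 2. A factor s + 2 then splits
     off. *)
  have := e3 hs; rewrite {1}a3' (e2 (nonintD 1 hs)) {1}a3 (e1 (nonintD 2 hs)).
  rewrite -a3' -a3.
  move: (F0 s) (F0 (s + 1)) (F0 (s + 2)) (F0 (s + 3)) => x0 x1 x2 x3 e.
  have {}e : (s + 2) * (s * (x3 - x1) + (s + 1) * (x2 - x0)) = 0.
    by rewrite -[RHS](subrr ((s + 1) * (s + 2) * x0)) -[X in _ = X - _]e; ring.
  have {}e : s * (x3 - x1) = - ((s + 1) * (x2 - x0)).
    apply/eqP; rewrite -addr_eq0; move/eqP: e; rewrite mulf_eq0 => /orP[|//].
    by rewrite (negPf s2).
  apply: (mulfI (mulf_neq0 s0 s1)).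
  transitivity (s * (x3 - x1)); first by field; rewrite s1.
  by rewrite e; field.
have [c hc] := ratf_periodic r0 per; exists c.
(* With F0 = c, [e1'] says that G(s) + c (s - 1)^2 is antiperiodic. *)
have hG : forall s, nonint s -> G s + (c *: ('X - 1) ^+ 2).[s] = 0.
  apply: ratf_antiperiodic; first by apply: ratfD => //; apply: ratf_poly.
  move=> s hs; have := e1' hs; rewrite !hc //; last exact: (nonintD 1).
  rewrite !hornerZ !horner_exp !hornerD !hornerX !hornerN !hornerC.
  move: (G s) (G (s + 1)) => x y e.
  by apply/eqP; rewrite -addr_eq0 -[X in _ == X]e; apply/eqP; ring.
move=> s hs; split; first exact: hc.
- have := hG _ hs; rewrite hornerZ horner_exp hornerD hornerX hornerN hornerC.
  by move=> /eqP; rewrite addr_eq0 mulNr => /eqP.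
- have := e1 (nonintB 1 hs); rewrite subrK !hc // => [->|]; last exact: (nonintB 1).
  by ring.
- have := e2 (nonintB 2 hs); rewrite subrK !hc // => [->|]; last exact: (nonintB 2).
  by ring.
Qed.
End Rational.

(** * Recovering the coefficients: uniqueness and nonvanishing *)

Section Uniqueness.
Variable K : fieldType.
Hypothesis char0 : [pchar K] =i pred0.
Implicit Types (f : DUG K) (F : K -> K).
Local Notation H := (UH K).
Local Notation Hi := (Hinv K).

Definition hfrac f F := exists P Q,
  fracH f P Q /\ forall z, nonint z -> F z = P.[z] / Q.[z].

Lemma DUh_hfrac f : DUh f -> exists F, hfrac f F.
Proof.
by move=> /DUh_frac[P [Q h]]; exists (fun z => P.[z] / Q.[z]), P, Q.
Qed.

Lemma hfrac_ratf f F : hfrac f F -> ratf F.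
Proof.
by move=> [P [Q [[_ _ hQ] h]]]; exists P, Q => z hz; rewrite h ?hQ.
Qed.

Lemma hfrac_hval la mu (nz : nonint (la + mu)) f F : hfrac f F -> hval nz f F.
Proof.
move=> [P [Q [h hF]]] x i j; rewrite (rho_frac _ _ _ _ h) hF //.
exact: nonintD.
Qed.

Lemma hfracZ k f F : hfrac f F -> hfrac (k *: f) (fun z => k * F z).
Proof.
move=> [P [Q [[e j hQ] hF]]]; exists (k *: P), Q; split.
  by split=> //; rewrite -palg_scalerAl e hevZ.
by move=> z hz; rewrite hF // hornerZ mulrA.
Qed.

(** Agreement at the points 1/2 + k equates the cross products of numerators and denominators as
    polynomials, so an element of D^-1 U(h) is determined by its function. *)
Lemma hfrac_eq f f' F F' : hfrac f F -> hfrac f' F' ->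
  (forall z, nonint z -> F z = F' z) -> f = f'.
Proof.
move=> [P [Q [h hF]]] [P' [Q' [h' hF']]] e; apply: (fracH_eq h h').
apply: subr0_eq; apply: (@poly_progression _ char0 _ 2^-1 1) => // k.
have hz := nonintD (1 * k) (nonint_half char0).
have [[_ _ hQ] [_ _ hQ']] := (h, h').
have := e _ hz; rewrite hF // hF' // => /eqP; rewrite eqr_div ?hQ ?hQ' // => /eqP e1.
by rewrite hornerD hornerN !hornerM e1 subrr.
Qed.

Section Values.
Variables (la mu : K) (nz : nonint (la + mu)).
Local Notation hval := (hval nz).

Lemma hvalD f f' F F' : hval f F -> hval f' F' ->
  hval (f + f') (fun z => F z + F' z).
Proof. by move=> h h' x i j; rewrite rhoD endo_addE grid_addE h h' -mulrDl. Qed.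
Lemma hvalN f F : hval f F -> hval (- f) (fun z => - F z).
Proof. by move=> h x i j; rewrite rhoN endo_oppE grid_oppE h mulNr. Qed.
Lemma hvalM f f' F F' : hval f F -> hval f' F' ->
  hval (f * f') (fun z => F z * F' z).
Proof. by move=> h h' x i j; rewrite rhoM endo_mulE h h' mulrA. Qed.
Lemma hval_nat n : hval n%:R (fun=> n%:R).
Proof.
by move=> x i j; rewrite -hev_nat rho_hev -polyC_natr hornerC.
Qed.
Lemma hval_Hn n : hval (H - n%:R) (fun z => z - n%:R).
Proof.
move=> x i j; rewrite -[_ - _](hev_sub K n) rho_hev -[n%:~R]polyC_natr.
by rewrite hornerXsubC.
Qed.
Lemma hval_Hi n : hval (Hi n%:Z) (fun z => (z - n%:R)^-1).
Proof.
apply: hfrac_hval; exists 1, ('X - n%:~R); split.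
  split; first by rewrite hev_sub HinvK hev1.
    by exists (Hi n); rewrite hev_sub HinvKr.
  by move=> z hz; rewrite -[n%:~R]polyC_natr hornerXsubC nonint_nat.
by move=> z hz; rewrite -[n%:~R]polyC_natr hornerXsubC hornerC div1r.
Qed.
End Values.

Section Combination.
Variables (f2 f1 f0 g : DUG K) (F2 F1 F0 G : K -> K).
Hypotheses (h2 : hfrac f2 F2) (h1 : hfrac f1 F1) (h0 : hfrac f0 F0) (hg : hfrac g G).

Definition comb2 := f2 + f1 * (4 * Hi 2) + f0 * (4 * (H - 1)).
Definition comb1 := f1 - f0 * (H - 1).
Definition comb0 := f0 * ((H - 1) * (H - 1)).
Definition Comb2 z := F2 z + F1 z * (4 * (z - 2)^-1) + F0 z * (4 * (z - 1)).
Definition Comb1 z := F1 z - F0 z * (z - 1).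
Definition Comb0 z := F0 z * ((z - 1) * (z - 1)).

Section Fixed.
Variables (la mu : K) (nz : nonint (la + mu)).
Lemma hval_comb2 : hval nz comb2 Comb2.
Proof.
have v2 := hfrac_hval nz h2; have v1 := hfrac_hval nz h1.
have v0 := hfrac_hval nz h0.
have n4 := hval_nat nz 4.
exact: (hvalD (hvalD v2 (hvalM v1 (hvalM n4 (hval_Hi nz 2))))
  (hvalM v0 (hvalM n4 (hval_Hn nz 1)))).
Qed.
Lemma hval_comb1 : hval nz comb1 Comb1.
Proof.
have [v1 v0] := (hfrac_hval nz h1, hfrac_hval nz h0).
exact: (hvalD v1 (hvalN (hvalM v0 (hval_Hn nz 1)))).
Qed.
Lemma hval_comb0 : hval nz comb0 Comb0.
Proof.
exact: (hvalM (hfrac_hval nz h0) (hvalM (hval_Hn nz 1) (hval_Hn nz 1))).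
Qed.
End Fixed.

Hypothesis anti : anticentral (cl (quad comb2 comb1 comb0 g)).

(** Take la = (s + d) / 2 and mu = (s - d) / 2: only the sum must avoid the integers, so d is
    arbitrary. Products of la and mu turn into s and d by 4 la mu = s^2 - d^2. *)
Lemma weights s d : nonint s ->
  [/\ Comb1 (s + 1) * (s ^+ 2 - d ^+ 2) + Comb0 (s + 1) * ((s - 2) * d ^+ 2 + s)
        + G (s + 1) * s = - (Comb0 s * d ^+ 2 + G s) * s,
      - Comb2 (s + 2) * (s ^+ 2 - d ^+ 2) + Comb1 (s + 2) * (4 * s)
        + Comb0 (s + 2) * ((s - 3) * d ^+ 2 + 4 * s) + G (s + 2) * (s + 1)
        = (Comb0 s * d ^+ 2 + G s) * (s + 1) &
      Comb2 (s + 3) * (s * ((s + 2) ^+ 2 - d ^+ 2))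
      - Comb1 (s + 3) * ((s + 1) * ((s + 2) ^+ 2 - d ^+ 2))
      - Comb0 (s + 3) * (s * (s - 3) * d ^+ 2 + (5 * s + 1) * (s + 2))
      - G (s + 3) * ((s + 1) * (s + 2))
      = (Comb0 s * d ^+ 2 + G s) * ((s + 1) * (s + 2))].
Proof.
move=> hs; have n2 : 2 != 0 :> K by apply: (natK_neq0 char0 1).
pose la := (s + d) / 2; pose mu := (s - d) / 2.
have es : la + mu = s by rewrite /la /mu; field.
have ed : la - mu = d by rewrite /la /mu; field.
have nz : nonint (la + mu) by rewrite es.
have hvs := (hval_comb2 nz, hval_comb1 nz, hval_comb0 nz, hfrac_hval nz hg).
case: hvs => [[[v2 v1] v0] v].
have w1 := weight1 char0 v2 v1 v0 v anti.
have w2 := weight2 char0 v2 v1 v0 v anti.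
have w3 := weight3 char0 v2 v1 v0 v anti.
rewrite es ed in w1 w2 w3; rewrite -{}w1 -{}w2 -{}w3 /la /mu.
by split; field.
Qed.

Lemma comb_solution : exists c, forall s, nonint s ->
  [/\ Comb0 s = c, G s = - c * (s - 1) ^+ 2, Comb1 s = 2 * (s - 2) * c
    & Comb2 s = 4 * c].
Proof.
have nz0 (s : K) : nonint s -> s != 0.
  by move=> hs; have := nonint_nat 0 hs; rewrite subr0.
have sub4 (x y z u : K) : x = y -> z = u -> x - z = y - u by move=> -> ->.
(* Each equation is affine in d^2, so comparing its instances at d = 0 and d = 1 isolates the
   coefficient of d^2. [E2] and [E3] arise in the same way. *)
have E1 s : nonint s -> Comb1 (s + 1) = s * Comb0 s + (s - 2) * Comb0 (s + 1).
  move=> hs; have [a0 _ _] := weights 0 hs; have [a1 _ _] := weights 1 hs.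
  have := sub4 _ _ _ _ a0 a1.
  move: (Comb1 _) (Comb0 _) (Comb0 _) (G _) (G _) => x y z u v e.
  apply/eqP; rewrite -subr_eq0; apply/eqP.
  transitivity ((- (y * 0 ^+ 2 + u) * s - - (y * 1 ^+ 2 + u) * s) - s * y).
    by rewrite -e; ring.
  by ring.
(* The instance d = 0 of the first equation, with [Comb1] eliminated by [E1] and a factor s
   cancelled. *)
have E1' s : nonint s ->
    s ^+ 2 * Comb0 s + (s - 1) ^+ 2 * Comb0 (s + 1) + G s + G (s + 1) = 0.
  move=> hs; have [a0 _ _] := weights 0 hs; rewrite E1 // in a0.
  apply: (mulfI (nz0 s hs)).
  rewrite mulr0 -[RHS](subrr (- (Comb0 s * 0 ^+ 2 + G s) * s)).
  by rewrite -{1}a0; ring.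
have E2 s : nonint s -> Comb2 (s + 2) = (s + 1) * Comb0 s - (s - 3) * Comb0 (s + 2).
  move=> hs; have [_ a0 _] := weights 0 hs; have [_ a1 _] := weights 1 hs.
  have := sub4 _ _ _ _ a1 a0.
  move: (Comb2 _) (Comb1 _) (Comb0 _) (Comb0 _) (G _) (G _) => w x y z u v e.
  apply/eqP; rewrite -subr_eq0; apply/eqP.
  transitivity (((y * 1 ^+ 2 + u) * (s + 1) - (y * 0 ^+ 2 + u) * (s + 1))
    - (s + 1) * y).
    by rewrite -e; ring.
  by ring.
have E3 s : nonint s -> - s * Comb2 (s + 3) + (s + 1) * Comb1 (s + 3)
    - s * (s - 3) * Comb0 (s + 3) = (s + 1) * (s + 2) * Comb0 s.
  move=> hs; have [_ _ a0] := weights 0 hs; have [_ _ a1] := weights 1 hs.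
  have := sub4 _ _ _ _ a1 a0.
  move: (Comb2 _) (Comb1 _) (Comb0 _) (Comb0 _) (G _) (G _) => w x y z u v e.
  transitivity ((y * 1 ^+ 2 + u) * ((s + 1) * (s + 2))
    - (y * 0 ^+ 2 + u) * ((s + 1) * (s + 2))).
    by rewrite -e; ring.
  by ring.
apply: recurrence_solution => //; last exact: hfrac_ratf hg.
apply: (ratf_eq _ (ratfM (hfrac_ratf h0) (ratf_poly (('X - 1) * ('X - 1))))).
by move=> z _; rewrite hornerM hornerD hornerX hornerN hornerC.
Qed.
End Combination.

Lemma horner_nat n (z : K) : (n%:R : {poly K}).[z] = n%:R.
Proof. by rewrite -polyC_natr hornerC. Qed.

Lemma horner_X1 (z : K) : ('X - 1%:~R : {poly K}).[z] = z - 1.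
Proof. by rewrite -[1%:~R]polyC1 hornerXsubC. Qed.

Lemma horner_X2 (z : K) : ('X - 2%:~R : {poly K}).[z] = z - 2.
Proof. by rewrite -[2%:~R](polyC_natr K 2) hornerXsubC. Qed.

Lemma hfrac_Hi P n : hfrac (hev P * Hi n%:Z) (fun z => P.[z] / (z - n%:R)).
Proof.
exists P, ('X - n%:~R); split; last first.
  by move=> z hz; rewrite -[n%:~R]polyC_natr hornerXsubC.
split; first by rewrite hev_sub -mulrA HinvK mulr1.
  by exists (Hi n); rewrite hev_sub HinvKr.
by move=> z hz; rewrite -[n%:~R]polyC_natr hornerXsubC nonint_nat.
Qed.

Lemma hfrac_Hi2 P n :
  hfrac (hev P * (Hi n%:Z * Hi n%:Z)) (fun z => P.[z] / ((z - n%:R) * (z - n%:R))).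
Proof.
have e : hev ('X - n%:~R) * Hi n = 1 by rewrite hev_sub HinvKr.
have e' : Hi n * hev ('X - n%:~R) = 1 by rewrite hev_sub HinvK.
have E z : ('X - n%:~R : {poly K}).[z] = z - n%:R.
  by rewrite -[n%:~R]polyC_natr hornerXsubC.
exists P, (('X - n%:~R) * ('X - n%:~R)); split; last by move=> z hz; rewrite hornerM E.
split.
- by rewrite hevM -!mulrA [Hi n * (_ * hev _)]mulrA e' mul1r e' mulr1.
- by exists (Hi n * Hi n); rewrite hevM mulrA -[hev _ * hev _ * Hi n]mulrA e mulr1.
- by move=> z hz; rewrite hornerM E mulf_neq0 ?nonint_nat.
Qed.

Lemma hfrac_hev P : hfrac (hev P) (fun z => P.[z]).
Proof.
exists P, 1; split; last by move=> z _; rewrite hornerC divr1.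
split; rewrite ?hev1 ?mulr1 //; first by exists 1; rewrite mulr1.
by move=> z _; rewrite hornerC oner_eq0.
Qed.

Lemma C2_scale k f2 f1 f0 g : hfun f2 -> hfun f1 -> hfun f0 ->
  C2 (k *: f2) (k *: f1) (k *: f0) (k *: g) = k *: C2 f2 f1 f0 g.
Proof.
move=> h2 h1 h0; rewrite !C2E //; try exact: hfunZ.
rewrite -clZ; congr cl.
have [e ke] : exists e, forall x : DUG K, k *: x = e * x.
  by exists (k *: (1 : DUG K)) => x; rewrite -palg_scalerAl mul1r.
rewrite !ke; clear h2 h1 h0 ke.
move: (UT K Xm2 * _) (UT K Xm1 * _) (UT K X0 * _) (H - 1) (4 * Hi 2) => *.
by ncring.
Qed.

Lemma C2_unique f2 f1 f0 g : DUh f2 -> DUh f1 -> DUh f0 -> DUh g ->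
  anticentral (C2 f2 f1 f0 g) -> exists k, C2 f2 f1 f0 g = k *: (16 *: Lbar K).
Proof.
move=> d2 d1 d0 dg anti.
have [F2 h2] := DUh_hfrac d2; have [F1 h1] := DUh_hfrac d1.
have [F0 h0] := DUh_hfrac d0; have [G hg] := DUh_hfrac dg.
have hf2 := DUh_hfun d2; have hf1 := DUh_hfun d1; have hf0 := DUh_hfun d0.
rewrite (C2E char0 g hf2 hf1 hf0) in anti.
have [c hc] := comb_solution h2 h1 h0 hg anti.
have l2 : hfun (L16_f2 K) by rewrite L16_f2E; apply/DUh_hfun/DUh_hev.
have l1 : hfun (L16_f1 K) by rewrite (L16_f1E K); apply/DUh_hfun/DUh_hev.
have l0 : hfun (L16_f0 K).
  by rewrite L16_f0E -(loc_invMM (Dset_gen K 1) (Dset_gen K 1)); apply/DUh_hfun/DUh_hev.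
have z1 z : nonint z -> z - 1 != 0 by move=> hz; apply: (nonint_nat 1 hz).
have z2 z : nonint z -> z - 2 != 0 by move=> hz; apply: (nonint_nat 2 hz).
(* The triangular relations [Comb0], [Comb1], [Comb2] are inverted one after the other. *)
have v0 z : nonint z -> F0 z = c / ((z - 1) * (z - 1)).
  move=> hz; have [<- _ _ _] := hc z hz; rewrite /Comb0.
  by field; rewrite z1.
have v1 z : nonint z -> F1 z = 2 * (z - 2) * c + c / (z - 1).
  move=> hz; have [_ _ <- _] := hc z hz; rewrite /Comb1 (v0 z hz).
  by field; rewrite z1.
have v2 z : nonint z -> F2 z = - (4 * c * (z - 1)) / (z - 2).
  move=> hz; have [_ _ _] := hc z hz; rewrite /Comb2 (v0 z hz) (v1 z hz) => e.
  apply: (@addIr _ ((2 * (z - 2) * c + c / (z - 1)) * (4 * (z - 2)^-1) +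
    c / ((z - 1) * (z - 1)) * (4 * (z - 1)))).
  by rewrite addrA e; field; rewrite z1 ?z2.
(* The scalar is - c because [L16_f0] makes [Comb0] equal to - 1. *)
exists (- c); rewrite (L16_C2 char0) -C2_scale //.
have -> : f2 = - c *: L16_f2 K.
  rewrite L16_f2E; apply: (hfrac_eq h2 (hfracZ _ (hfrac_Hi _ 2))) => z hz.
  by rewrite v2 // hornerM horner_nat horner_X1; field; rewrite z2.
have -> : f1 = - c *: L16_f1 K.
  rewrite (L16_f1E K); apply: (hfrac_eq h1 (hfracZ _ (hfrac_Hi _ 1))) => z hz.
  rewrite v1 // hornerN hornerD !hornerM horner_nat horner_X1 horner_X2 hornerC.
  by field; rewrite z1.
have -> : f0 = - c *: L16_f0 K.
  rewrite L16_f0E; apply: (hfrac_eq h0 (hfracZ _ (hfrac_Hi2 _ 1))) => z hz.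
  by rewrite v0 // hornerN hornerC; field; rewrite z1.
have -> : g = - c *: L16_g K.
  rewrite L16_gE; apply: (hfrac_eq hg (hfracZ _ (hfrac_hev _))) => z hz.
  by have [_ -> _ _] := hc z hz; rewrite horner_exp horner_X1.
by [].
Qed.

(** The coefficient of the vacuum in the image of the vacuum factors through U/J. With la = mu =
    1/4, so s = 1/2 and d = 0, it equals (1/2 - 1)^2. *)
Lemma L16_neq0 : 16 *: Lbar K <> 0.
Proof.
have l2 : hfun (L16_f2 K) by rewrite L16_f2E; apply/DUh_hfun/DUh_hev.
have l1 : hfun (L16_f1 K) by rewrite (L16_f1E K); apply/DUh_hfun/DUh_hev.
have l0 : hfun (L16_f0 K).
  by rewrite L16_f0E -(loc_invMM (Dset_gen K 1) (Dset_gen K 1)); apply/DUh_hfun/DUh_hev.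
rewrite (L16_C2 char0) (C2E char0 _ l2 l1 l0) -(@cl0 K) => e.
have n2 : 2 != 0 :> K by apply: (natK_neq0 char0 1).
have n4 : 4 != 0 :> K by apply: (natK_neq0 char0 3).
pose q : K := 4^-1.
have es : q + q = 2^-1 by rewrite /q; field; rewrite ?n2 ?n4.
have nz : nonint (q + q) by rewrite es; apply: nonint_half.
pose w (x : grid K) : K := x 0%N 0%N.
have wD x y : w (x + y) = w x + w y by [].
have wm x : w (rho nz (UX K Xm1) x) = 0.
  by rewrite rho_X endo_addE /w grid_addE Va0 Vc0 addr0.
have := coef_cl char0 wD wm (vac_p nz) e.
have h2 := hfrac_Hi (4 * ('X - 1%:~R)) 2; rewrite -[_ * _]L16_f2E in h2.
have h1 := hfrac_Hi (- (2 * ('X - 2%:~R) * ('X - 1%:~R) + 1)) 1.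
rewrite -[_ * _](L16_f1E K) in h1.
have h0 := hfrac_Hi2 (- 1) 1; rewrite -[_ * _]L16_f0E in h0.
have hg := hfrac_hev (('X - 1%:~R) ^+ 2); rewrite -L16_gE in hg.
have v2 := hval_comb2 h2 h1 h0 nz; have v1 := hval_comb1 h1 h0 nz.
have v0 := hval_comb0 h0 nz; have v := hfrac_hval nz hg.
rewrite -[_ + L16_g K]/(quad (comb2 _ _ _) (comb1 _ _) (comb0 _) _).
have r00 x : rho nz 0 x = 0 by rewrite -(scale0r (1 : DUG K)) rhoZ scale0r.
rewrite (quad_vac v2 v1 v0 v) r00.
rewrite /w grid_scaleE grid0E /vac_eigenvalue subrr expr0n mulr0 add0r es.
rewrite horner_exp horner_X1.
rewrite /vac /= mulr1 => /eqP; rewrite sqrf_eq0 subr_eq0 => /eqP e2.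
by have := nonint_half char0 1%Z; rewrite e2 eqxx.
Qed.
End Uniqueness.

(* f_2 is 4 (H - 1) / (H - 2), not the 4 (H - 2) / (H - 1) of the source, with
   which the identity is false: see the computation before has_C2_form. *)
Theorem theorem4p5 (R : realType) :
  let C : fieldType := R[i]%C in
  let H := UH C in
  let L16 : UJ C := 16 *: Lbar C in
  [/\ L16 = C2 (4 * (H - 1) * Hinv C 2)
               (- (2 * (H - 2) + Hinv C 1))
               (- (Hinv C 1 ^+ 2))
               ((H - 1) ^+ 2),
      has_C2_form L16,
      anticentral L16,
      L16 <> 0
    & forall a : UJ C, has_C2_form a -> anticentral a ->
        exists c : C, a = c *: L16].
Proof.
move=> C H L16; have char0 : [pchar C] =i pred0 := Num.Theory.pchar_num _.
split.
- exact: L16_C2.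
- exact: L16_form.
- exact: L16_anticentral.
- exact: L16_neq0.
- by move=> _ [f2 [f1 [f0 [g [d2 d1 d0 dg ->]]]]]; apply: C2_unique.
Qed.
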